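(* Let $\Bbbk$ be an algebraically closed field and $n>2$. The basic generalized tilting $C_n$-modules are, up to isomorphism, exactly the modules $$P(2)\oplus P(3)\oplus\dots\oplus P(n-1)\oplus S(i,i+1)\oplus N(j,j+1),$$ where $i,j\in\{1,2,\dots,n-1\}$.
   Context: Modules are finite-dimensional right modules. The algebra $C_n$ ($n\geq 2$): consider the quiver with vertices $1,2,\dots,n$ and, for each $1\leq i\leq n-1$, one arrow $i\to i+1$ and one arrow $i+1\to i$. Then $C_n$ is the quotient of the path algebra over $\Bbbk$ of this quiver by the ideal generated by the relations: any path of length three is zero; any path of length two which is not a cycle is zero; for each vertex $v$, all length two cycles which start and terminate at $v$ are equal; the length two cycle at the vertex $n$ is zero; the length two cycle at the vertex $1$ is zero. $L(i)$ is the simple $C_n$-module associated to the vertex $i$ and $P(i)$ is its indecomposable projective cover. For $1\leq i\leq n-1$, $S(i,i+1)$ is the (unique up to isomorphism) uniserial $C_n$-module of length two with top $L(i)$ and socle $L(i+1)$, and $N(i,i+1)$ is the (unique up to isomorphism) uniserial $C_n$-module of length two with top $L(i+1)$ and socle $L(i)$. A module $T$ over a finite-dimensional algebra $\Lambda$ is a generalized tilting module if: $T$ has finite projective dimension; $\mathrm{Ext}^i_\Lambda(T,T)=0$ for all $i>0$; and the right regular module $\Lambda_\Lambda$ has a finite coresolution by modules in $\mathrm{add}(T)$, i.e. there is an exact sequence $0\to\Lambda_\Lambda\to T_0\to\dots\to T_m\to 0$ with all $T_i\in\mathrm{add}(T)$. A module is basic if it is isomorphic to a direct sum of pairwise non-isomorphic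 indecomposable modules. *)

(* Defs.v *)
From HB Require Import structures.
From mathcomp Require Import all_boot all_order all_algebra.
From mathcomp Require Import finmap boolp.
From mathcomp Require Import monalg.

Set Implicit Arguments.
Unset Strict Implicit.
Unset Printing Implicit Defensive.

Import GRing.Theory.
Local Open Scope ring_scope.

Record quiver := Quiver {
  vertex : finType;
  arrow : finType;
  src : arrow -> vertex;
  tgt : arrow -> vertex;
  vertex_gt0 : (0 < #|vertex|)%N
}.

Section Paths.
Variable Q : quiver.

Fixpoint composable (v : vertex Q) (s : seq (arrow Q)) : bool :=
  if s is a :: s' then (src a == v) && composable (tgt a) s' else true.

(* The source is recorded separately so that there is one trivial path at     *)
(* each vertex; the arrows are listed in the order in which they are followed.*)
Record qpath := QPath {
  qpath_val : vertex Q * seq (arrow Q);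
  qpath_valP : composable qpath_val.1 qpath_val.2
}.

HB.instance Definition _ := [isSub for qpath_val].
HB.instance Definition _ := [Choice of qpath by <:].

Definition psrc (p : qpath) : vertex Q := (val p).1.
Definition parrows (p : qpath) : seq (arrow Q) := (val p).2.
Definition ptgt (p : qpath) : vertex Q := last (psrc p) (map (@tgt Q) (parrows p)).
Definition plength (p : qpath) : nat := size (parrows p).

Definition ptriv (v : vertex Q) : qpath := @QPath (v, [::]) isT.

(* First p, then q. *)
Definition pcomp (p q : qpath) : option qpath :=
  if ptgt p == psrc q then insub (psrc p, parrows p ++ parrows q) else None.

Lemma composable_cat v s t :
  composable v (s ++ t) = composable v s && composable (last v (map (@tgt Q) s)) t.
Proof. by elim: s v => //= a s IH v; rewrite IH andbA. Qed.

Lemma pcompP p q :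
  (ptgt p == psrc q /\
    exists r, [/\ pcomp p q = Some r, psrc r = psrc p, ptgt r = ptgt q
                & parrows r = parrows p ++ parrows q])
  \/ (ptgt p != psrc q /\ pcomp p q = None).
Proof.
rewrite /pcomp; case: ifP => pq; [left; split=> // | by right].
case: insubP => [r _ rE|]; last first.
  by rewrite composable_cat (valP p) -[last _ _]/(ptgt p) (eqP pq) (valP q).
have r1 : psrc r = psrc p by rewrite /psrc rE.
have r2 : parrows r = parrows p ++ parrows q by rewrite /parrows rE.
exists r; split=> //.
by rewrite /ptgt r1 r2 map_cat last_cat -[last (psrc p) _]/(ptgt p) (eqP pq).
Qed.

Lemma qpath_eq (p q : qpath) : psrc p = psrc q -> parrows p = parrows q -> p = q.
Proof.
by move=> h1 h2; apply/val_inj/eqP; rewrite /= -pair_eqE /=; apply/andP; split;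
  apply/eqP.
Qed.

Lemma pcompA p q r :
  obind (pcomp^~ r) (pcomp p q) = obind (pcomp p) (pcomp q r).
Proof.
case: (pcompP p q) => [[pq [x [-> x1 x2 x3]]]|[pq xE]];
case: (pcompP q r) => [[qr [y [yE y1 y2 y3]]]|[qr yE]] /=.
- rewrite yE /=.
  case: (pcompP x r) => [[xr [z [-> z1 z2 z3]]]|[+ _]]; last by rewrite x2 qr.
  case: (pcompP p y) => [[py [w [-> w1 w2 w3]]]|[+ _]]; last by rewrite y1 pq.
  congr Some; apply: qpath_eq; first by rewrite z1 x1 w1.
  by rewrite z3 x3 w3 y3 catA.
- by rewrite yE /= /pcomp x2 (negbTE qr).
- by rewrite yE xE /= /pcomp y1 (negbTE pq).
- by rewrite yE xE.
Qed.

End Paths.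

HB.lock Definition pbasis (k : fieldType) (Q : quiver) (p : qpath Q) :
  {malg k[qpath Q]} := << p >>.

(* The product of two paths is their concatenation when they are composable   *)
(* and zero otherwise; it is extended bilinearly.                             *)
HB.lock Definition pmul (k : fieldType) (Q : quiver) (f g : {malg k[qpath Q]}) :
  {malg k[qpath Q]} :=
  \sum_(p <- msupp f) \sum_(q <- msupp g)
    (f@_p * g@_q) *: (if pcomp p q is Some r then pbasis k r else 0).

HB.lock Definition pone (k : fieldType) (Q : quiver) : {malg k[qpath Q]} :=
  \sum_(v : vertex Q) pbasis k (ptriv v).

Section PathAlgebra.
Variables (k : fieldType) (Q : quiver).
Local Notation path := (qpath Q).
Local Notation "'kQ'" := {malg k[path]}.
Local Notation pbasis := (pbasis k).
Local Notation pone := (pone k Q).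

Implicit Types (f g h : kQ) (p q : path).

Let pmul_basis p q : kQ := if pcomp p q is Some r then pbasis r else 0.

Let plin (V : lmodType k) (phi : path -> V) f : V :=
  \sum_(p <- msupp f) f@_p *: phi p.

Lemma pbasis_coeff p q : (pbasis p)@_q = (p == q)%:R.
Proof. by rewrite pbasis.unlock mcoeffU. Qed.

Let plinw (V : lmodType k) (phi : path -> V) f (d : {fset path}) :
  (msupp f `<=` d)%fset -> plin phi f = \sum_(p <- d) f@_p *: phi p.
Proof.
move=> le; rewrite /plin (big_fset_incl _ le) //= => p _ /mcoeff_outdom ->.
by rewrite scale0r.
Qed.

Let plinD (V : lmodType k) (phi : path -> V) c f g :
  plin phi (c *: f + g) = c *: plin phi f + plin phi g.
Proof.
pose d := (msupp f `|` msupp g)%fset.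
have hf : (msupp f `<=` d)%fset by apply: fsubsetUl.
have hg : (msupp g `<=` d)%fset by apply: fsubsetUr.
have hh : (msupp (c *: f + g) `<=` d)%fset.
  apply: fsubset_trans (msuppD_le _ _) _; apply: fsetSU; exact: msuppZ_le.
rewrite (plinw _ hf) (plinw _ hg) (plinw _ hh) scaler_sumr -big_split /=.
apply: eq_bigr => p _; rewrite scalerA -scalerDl; congr (_ *: _).
by rewrite (mcoeffD p (c *: f) g) mcoeffZ.
Qed.

Let plinDf (V : lmodType k) (phi psi : path -> V) c f :
  plin (fun p => c *: phi p + psi p) f = c *: plin phi f + plin psi f.
Proof.
rewrite /plin scaler_sumr -big_split /=; apply: eq_bigr => p _.
by rewrite scalerDr !scalerA mulrC.
Qed.

Let plin0 (V : lmodType k) (phi : path -> V) : plin phi 0 = 0.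
Proof. by rewrite /plin msupp0 big_seq_fset0. Qed.

Let plin_basis (V : lmodType k) (phi : path -> V) p : plin phi (pbasis p) = phi p.
Proof.
have le : (msupp (pbasis p) `<=` [fset p])%fset.
  by rewrite pbasis.unlock; exact: msuppU_le.
by rewrite (plinw _ le) big_seq_fset1 pbasis_coeff eqxx scale1r.
Qed.

Lemma pbasisE f : f = \sum_(p <- msupp f) f@_p *: pbasis p.
Proof.
rewrite {1}[f]monalgE; apply: eq_bigr => p _; apply/malgP=> q.
by rewrite [LHS]mcoeffU [RHS]mcoeffZ pbasis_coeff mulr_natr.
Qed.

Lemma plin_ext (V : lmodType k) (F G : kQ -> V) :
  linear F -> linear G -> (forall p, F (pbasis p) = G (pbasis p)) -> F =1 G.
Proof.
move=> linF linG FG f.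
have F0 : F 0 = 0 by have := linF (-1) 0 0; rewrite scaler0 addr0 scaleN1r addNr.
have G0 : G 0 = 0 by have := linG (-1) 0 0; rewrite scaler0 addr0 scaleN1r addNr.
rewrite [f]pbasisE.
elim: (enum_fset _) => [|p s IH]; first by rewrite !big_nil F0 G0.
by rewrite !big_cons linF linG FG IH.
Qed.

Let pmulE f g : pmul f g = plin (fun p => plin (pmul_basis p) g) f.
Proof.
rewrite pmul.unlock; apply: eq_bigr => p _; rewrite scaler_sumr.
by apply: eq_bigr => q _; rewrite scalerA.
Qed.

Let pmull g c f1 f2 : pmul (c *: f1 + f2) g = c *: pmul f1 g + pmul f2 g.
Proof. by rewrite !pmulE; exact: plinD. Qed.

Let pmulr f c g1 g2 : pmul f (c *: g1 + g2) = c *: pmul f g1 + pmul f g2.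
Proof.
rewrite !pmulE -[RHS]plinDf; apply: eq_bigr => p _.
by congr (_ *: _); exact: plinD.
Qed.

Let pmul_pbasis p q : pmul (pbasis p) (pbasis q) = pmul_basis p q.
Proof. by rewrite pmulE !plin_basis. Qed.

Let pmul0g g : pmul 0 g = 0. Proof. by rewrite pmulE plin0. Qed.
Let pmulg0 f : pmul f 0 = 0.
Proof. by rewrite pmulE; apply: big1 => p _; rewrite plin0 scaler0. Qed.

Let pmulDl : left_distributive (@pmul k Q) +%R.
Proof. by move=> x y z; have := pmull z 1 x y; rewrite !scale1r. Qed.

Let pmulDr : right_distributive (@pmul k Q) +%R.
Proof. by move=> x y z; have := pmulr x 1 y z; rewrite !scale1r. Qed.

Let pmulA : associative (@pmul k Q).
Proof.
move=> f g h.
apply: (@plin_ext _ (fun f => pmul f (pmul g h)) (fun f => pmul (pmul f g) h)).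
- by move=> c x y; rewrite pmull.
- by move=> c x y; rewrite (pmull g) pmull.
move=> p; apply: (@plin_ext _ (fun g => pmul (pbasis p) (pmul g h))
                             (fun g => pmul (pmul (pbasis p) g) h)).
- by move=> c x y; rewrite pmull pmulr.
- by move=> c x y; rewrite pmulr pmull.
move=> q; apply: (@plin_ext _ (fun h => pmul (pbasis p) (pmul (pbasis q) h))
                             (fun h => pmul (pmul (pbasis p) (pbasis q)) h)).
- by move=> c x y; rewrite (pmulr (pbasis q)) pmulr.
- by move=> c x y; rewrite pmulr.
move=> r; rewrite !pmul_pbasis /pmul_basis.
have := pcompA p q r; case: (pcomp p q) (pcomp q r) => [x|] [y|] /=.
- by rewrite !pmul_pbasis /pmul_basis => ->.
- by rewrite pmulg0 pmul_pbasis /pmul_basis => ->.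
- by rewrite pmul0g pmul_pbasis /pmul_basis => <-.
- by rewrite pmul0g pmulg0.
Qed.

Let pmul1g : left_id pone (@pmul k Q).
Proof.
apply: (@plin_ext _ (pmul pone) id); [exact: pmulr | by [] |] => p.
have -> : pmul pone (pbasis p) = \sum_v pmul (pbasis (ptriv v)) (pbasis p).
  rewrite pone.unlock.
  exact: (big_morph (fun f => pmul f (pbasis p)) (fun x y => pmulDl x y _) (pmul0g _)).
rewrite (bigD1 (psrc p)) //= big1 ?addr0 => [|v vp]; rewrite pmul_pbasis /pmul_basis.
- case: (pcompP (ptriv (psrc p)) p) => [[_ [r [-> r1 _ r2]]]|[]]; last by rewrite eqxx.
  by congr pbasis; apply: qpath_eq.
- by rewrite /pcomp (negbTE vp).
Qed.

Let pmulg1 : right_id pone (@pmul k Q).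
Proof.
apply: (@plin_ext _ ((@pmul k Q)^~ pone) id); [|by []|] => [c x y|p] /=.
  by rewrite pmull.
have -> : pmul (pbasis p) pone = \sum_v pmul (pbasis p) (pbasis (ptriv v)).
  rewrite pone.unlock.
  exact: (big_morph (pmul (pbasis p)) (pmulDr (pbasis p)) (pmulg0 _)).
rewrite (bigD1 (ptgt p)) //= big1 ?addr0 => [|v vp]; rewrite pmul_pbasis /pmul_basis.
- case: (pcompP p (ptriv (ptgt p))) => [[_ [r [-> r1 _ r2]]]|[]]; last by rewrite eqxx.
  by congr pbasis; apply: qpath_eq; rewrite // r2 cats0.
- by rewrite /pcomp eq_sym (negbTE vp).
Qed.

Let mcoeff_pone_triv v : pone@_(ptriv v) = 1.
Proof.
rewrite pone.unlock raddf_sum /= (bigD1 v) //= pbasis_coeff eqxx.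
rewrite big1 ?addr0 // => w wv.
rewrite pbasis_coeff; case: eqP => // - [] e; by rewrite e eqxx in wv.
Qed.

Let pone_neq0 : pone != 0.
Proof.
apply/eqP => pone0; have /card_gt0P[v _] := vertex_gt0 Q.
by have /eqP := mcoeff_pone_triv v; rewrite pone0 mcoeff0 eq_sym oner_eq0.
Qed.

Let pscalerAl c f g : c *: (pmul f g) = pmul (c *: f) g.
Proof. by rewrite -[c *: f in RHS]addr0 pmull pmul0g addr0. Qed.

Let pscalerAr c f g : c *: (pmul f g) = pmul f (c *: g).
Proof. by rewrite -[c *: g in RHS]addr0 pmulr pmulg0 addr0. Qed.

Definition path_algebra : Type := {malg k[path]}.
HB.instance Definition _ := GRing.Lmodule.on path_algebra.
HB.instance Definition _ := GRing.Zmodule_isNzRing.Build path_algebra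
  pmulA pmul1g pmulg1 pmulDl pmulDr pone_neq0.
HB.instance Definition _ := GRing.Lmodule_isLalgebra.Build k path_algebra pscalerAl.
HB.instance Definition _ := GRing.Lalgebra_isAlgebra.Build k path_algebra pscalerAr.

Lemma pbasisM p q :
  (pbasis p : path_algebra) * pbasis q
  = if pcomp p q is Some r then pbasis r else 0.
Proof. exact: pmul_pbasis. Qed.

Lemma mcoeff_triv_mul v (f g : path_algebra) :
  (f * g)@_(ptriv v) = f@_(ptriv v) * g@_(ptriv v).
Proof.
have cD a x y : (a *: x + y : kQ)@_(ptriv v) = a * x@_(ptriv v) + y@_(ptriv v).
  by rewrite [LHS]mcoeffD [X in X + _]mcoeffZ.
change ((pmul f g)@_(ptriv v) = f@_(ptriv v) * g@_(ptriv v)).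
apply: (@plin_ext k^o (fun f => (pmul f g)@_(ptriv v))
                      (fun f => f@_(ptriv v) * g@_(ptriv v))).
- by move=> a x y; rewrite pmull cD.
- by move=> a x y; rewrite cD mulrDl -mulrA.
move=> p; apply: (@plin_ext k^o (fun g => (pmul (pbasis p) g)@_(ptriv v))
                      (fun g => (pbasis p)@_(ptriv v) * g@_(ptriv v))).
- by move=> a x y; rewrite pmulr cD.
- by move=> a x y; rewrite cD mulrDr mulrCA.
move=> q; rewrite pmul_pbasis /pmul_basis !pbasis_coeff.
case: (pcompP p q) => [[pq [r [-> r1 r2 r3]]]|[pq ->]].
- rewrite pbasis_coeff.
  case: (p =P ptriv v) => [pE|pE]; case: (q =P ptriv v) => [qE|qE].
  + rewrite mulr1 (_ : r = ptriv v) ?eqxx //.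
    by apply: qpath_eq; rewrite ?r1 ?r3 pE // qE.
  + rewrite mulr0; case: eqP => // rE; case: qE; apply: qpath_eq.
      by rewrite -(eqP pq) pE.
    by move: r3; rewrite pE rE.
  + rewrite mul0r; case: eqP => // rE; case: pE; apply: qpath_eq.
      by rewrite -r1 rE.
    by move: r3; rewrite rE; case: (parrows p).
  + rewrite mul0r; case: eqP => // rE; case: pE; apply: qpath_eq.
      by rewrite -r1 rE.
    by move: r3; rewrite rE; case: (parrows p).
- rewrite mcoeff0; case: eqP => [pE|]; last by rewrite mul0r.
  case: eqP => [qE|]; last by rewrite mulr0.
  by move: pq; rewrite pE qE eqxx.
Qed.

End PathAlgebra.

HB.mixin Record isTwoSided (A : nzRingType) (I : A -> bool) := {
  idealM_subproof : forall u a, u \in I -> u * a \in I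
}.

(* A proper two-sided ideal: an idealr of ring_quotient is in fact a left     *)
(* ideal (closed under multiplication on the left by ring elements).          *)
#[short(type="ideal2")]
HB.structure Definition Ideal2 (A : nzRingType) :=
  {I of Idealr A I & isTwoSided A I}.

Section QuotientAlgebra.
Local Open Scope quotient_scope.
Variables (k : fieldType) (A : algType k) (I : ideal2 A).

Definition alg_quot : Type := {ideal_quot I}.
HB.instance Definition _ := Choice.on alg_quot.
HB.instance Definition _ := GRing.Zmodule.on alg_quot.
HB.instance Definition _ := EqQuotient.on alg_quot.

Definition alg_quot_pi (x : A) : alg_quot := \pi_alg_quot x.

Lemma alg_quot_eq x y : alg_quot_pi x = alg_quot_pi y <-> x - y \in I.
Proof. by rewrite Quotient.idealrBE; split=> /eqP. Qed.

Lemma alg_quot_piP (x : alg_quot) : alg_quot_pi (repr x) = x.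
Proof. exact: reprK. Qed.

Let piD x y : alg_quot_pi (x + y) = alg_quot_pi x + alg_quot_pi y.
Proof. exact: Quotient.pi_add. Qed.

Definition alg_quot_mul (x y : alg_quot) := alg_quot_pi (repr x * repr y).
Definition alg_quot_scale (c : k) (x : alg_quot) := alg_quot_pi (c *: repr x).

Let reprB x : repr (alg_quot_pi x) - x \in I.
Proof. by apply/alg_quot_eq; rewrite alg_quot_piP. Qed.

Let piM x y : alg_quot_mul (alg_quot_pi x) (alg_quot_pi y) = alg_quot_pi (x * y).
Proof.
apply/alg_quot_eq; set x' := repr _; set y' := repr _.
rewrite -(subrKA (x' * y)) -mulrBr -mulrBl rpredD //.
  by apply: idealMr; apply: reprB.
by apply: idealM_subproof; apply: reprB.
Qed.

Let piZ c x : alg_quot_scale c (alg_quot_pi x) = alg_quot_pi (c *: x).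
Proof.
apply/alg_quot_eq; rewrite -scalerBr -[_ - _]mul1r scalerAl.
by apply: idealMr; apply: reprB.
Qed.

Let qind (P : alg_quot -> Prop) : (forall x, P (alg_quot_pi x)) -> forall x, P x.
Proof. by move=> h x; rewrite -[x]alg_quot_piP. Qed.

Let qmulA : associative alg_quot_mul.
Proof. by elim/qind=> x; elim/qind=> y; elim/qind=> z; rewrite !piM mulrA. Qed.
Let qmul1x : left_id (alg_quot_pi 1) alg_quot_mul.
Proof. by elim/qind=> x; rewrite piM mul1r. Qed.
Let qmulx1 : right_id (alg_quot_pi 1) alg_quot_mul.
Proof. by elim/qind=> x; rewrite piM mulr1. Qed.
Let qmulDl : left_distributive alg_quot_mul +%R.
Proof.
elim/qind=> x; elim/qind=> y; elim/qind=> z.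
by rewrite -piD !piM mulrDl piD.
Qed.
Let qmulDr : right_distributive alg_quot_mul +%R.
Proof.
elim/qind=> x; elim/qind=> y; elim/qind=> z.
by rewrite -piD !piM mulrDr piD.
Qed.
Let q1_neq0 : alg_quot_pi 1 != 0.
Proof.
have pi0 : alg_quot_pi 0 = 0.
  by apply: (addrI (alg_quot_pi 0)); rewrite -piD !addr0.
rewrite -pi0.
apply/eqP => /alg_quot_eq; by rewrite subr0 idealr1.
Qed.

HB.instance Definition _ := GRing.Zmodule_isNzRing.Build alg_quot
  qmulA qmul1x qmulx1 qmulDl qmulDr q1_neq0.

Let qscaleA c d x : alg_quot_scale c (alg_quot_scale d x) = alg_quot_scale (c * d) x.
Proof. by elim/qind: x => x; rewrite !piZ scalerA. Qed.
Let qscale1 : left_id 1 alg_quot_scale.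
Proof. by elim/qind=> x; rewrite piZ scale1r. Qed.
Let qscaleDr : right_distributive alg_quot_scale +%R.
Proof. by move=> c; elim/qind=> x; elim/qind=> y; rewrite -piD !piZ scalerDr piD. Qed.
Let qscaleDl x : {morph alg_quot_scale^~ x : c d / c + d}.
Proof. by elim/qind: x => x c d; rewrite !piZ scalerDl piD. Qed.

HB.instance Definition _ := GRing.Zmodule_isLmodule.Build k alg_quot
  qscaleA qscale1 qscaleDr qscaleDl.

Let qscalerAl (c : k) (x y : alg_quot) : c *: (x * y) = (c *: x) * y.
Proof.
elim/qind: x => x; elim/qind: y => y.
by rewrite -[LHS]/(alg_quot_scale c (alg_quot_mul _ _))
  -[RHS]/(alg_quot_mul (alg_quot_scale c _) _) piM !piZ piM scalerAl.
Qed.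
HB.instance Definition _ := GRing.Lmodule_isLalgebra.Build k alg_quot qscalerAl.

Let qscalerAr (c : k) (x y : alg_quot) : c *: (x * y) = x * (c *: y).
Proof.
elim/qind: x => x; elim/qind: y => y.
by rewrite -[LHS]/(alg_quot_scale c (alg_quot_mul _ _))
  -[RHS]/(alg_quot_mul _ (alg_quot_scale c _)) piM !piZ piM scalerAr.
Qed.
HB.instance Definition _ := GRing.Lalgebra_isAlgebra.Build k alg_quot qscalerAr.

Lemma alg_quot_pi_linear : linear alg_quot_pi.
Proof. by move=> c x y; rewrite piD -piZ. Qed.
HB.instance Definition _ :=
  GRing.isLinear.Build k A alg_quot *:%R alg_quot_pi alg_quot_pi_linear.

Lemma alg_quot_pi_monoid : monoid_morphism alg_quot_pi.
Proof. by split=> // x y; rewrite -piM. Qed.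
HB.instance Definition _ :=
  GRing.isMonoidMorphism.Build A alg_quot alg_quot_pi alg_quot_pi_monoid.

End QuotientAlgebra.

(* The two-sided ideal generated by a set of elements: the intersection of    *)
(* all the two-sided ideals that contain it.                                  *)
Section GeneratedIdeal.
Variables (A : nzRingType) (S : A -> Prop).

Definition is_ideal (J : A -> Prop) : Prop :=
  [/\ J 0, forall x y, J x -> J y -> J (x - y)
     & forall a x, J x -> J (a * x) /\ J (x * a)].

Definition gen_ideal (x : A) : bool :=
  `[< forall J : A -> Prop, is_ideal J -> (forall y, S y -> J y) -> J x >].

Lemma gen_idealP x :
  reflect (forall J, is_ideal J -> (forall y, S y -> J y) -> J x) (x \in gen_ideal).
Proof. exact: asboolP. Qed.

Lemma gen_ideal_zmod_closed : zmod_closed gen_ideal.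
Proof.
split; first by apply/gen_idealP => J [].
move=> x y /gen_idealP hx /gen_idealP hy; apply/gen_idealP => J idJ SJ.
by have [_ JB _] := idJ; apply: JB; [apply: hx | apply: hy].
Qed.

Lemma gen_ideal_mull a x : x \in gen_ideal -> a * x \in gen_ideal.
Proof.
move=> /gen_idealP hx; apply/gen_idealP => J idJ SJ.
by have [_ _ JM] := idJ; case: (JM a x (hx _ idJ SJ)).
Qed.

Lemma gen_ideal_mulr x a : x \in gen_ideal -> x * a \in gen_ideal.
Proof.
move=> /gen_idealP hx; apply/gen_idealP => J idJ SJ.
by have [_ _ JM] := idJ; case: (JM a x (hx _ idJ SJ)).
Qed.

End GeneratedIdeal.

(* The vertices 1, ..., n are represented by 'I_n, so v : 'I_n stands for the *)
(* vertex v.+1; likewise i : 'I_n.-1 stands for the index i.+1 in 1, ..., n-1,*)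
(* and edge_lo i, edge_hi i are the vertices written i and i+1.               *)
Section DoubledLine.
Variable n : nat.

Lemma edge_hi_subproof (i : 'I_n.-1) : (i.+1 < n)%N.
Proof. by rewrite -ltn_predRL. Qed.

Definition edge_lo (i : 'I_n.-1) : 'I_n := widen_ord (leq_pred n) i.
Definition edge_hi (i : 'I_n.-1) : 'I_n := Ordinal (edge_hi_subproof i).

Hypothesis n_ge2 : (1 < n)%N.

Lemma line_vertex_gt0 : (0 < #|'I_n|)%N.
Proof. by rewrite card_ord ltnW. Qed.

(* (i, true) is the arrow i -> i+1 and (i, false) the arrow i+1 -> i.         *)
Definition C_quiver : quiver :=
  @Quiver 'I_n ('I_n.-1 * bool)%type
    (fun a => if a.2 then edge_lo a.1 else edge_hi a.1)
    (fun a => if a.2 then edge_hi a.1 else edge_lo a.1)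
    line_vertex_gt0.

Variable k : fieldType.

Definition C_path (p : qpath C_quiver) : path_algebra k C_quiver := pbasis k p.

Inductive C_rel : path_algebra k C_quiver -> Prop :=
| C_rel_length3 (p : qpath C_quiver) of plength p = 3%N : C_rel (C_path p)
| C_rel_noncycle (p : qpath C_quiver) of plength p = 2%N & psrc p <> ptgt p : C_rel (C_path p)
| C_rel_cycles (p q : qpath C_quiver) of plength p = 2%N & plength q = 2%N
    & psrc p = ptgt p & psrc q = ptgt q & psrc p = psrc q :
    C_rel (C_path p - C_path q)
| C_rel_last (p : qpath C_quiver) of plength p = 2%N & psrc p = ptgt p & nat_of_ord (psrc p : 'I_n) = n.-1 :
    C_rel (C_path p)
| C_rel_first (p : qpath C_quiver) of plength p = 2%N & psrc p = ptgt p & nat_of_ord (psrc p : 'I_n) = 0%N :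
    C_rel (C_path p).

Definition C_ideal : path_algebra k C_quiver -> bool := gen_ideal C_rel.

Lemma C_ideal_proper :
  1 \notin C_ideal /\ forall a, {in C_ideal, forall u, a * u \in C_ideal}.
Proof.
split; last by move=> a u; exact: gen_ideal_mull.
have /card_gt0P[v _] := vertex_gt0 C_quiver.
pose J (x : path_algebra k C_quiver) := x@_(ptriv v) = 0.
apply/negP => /gen_idealP /(_ J) H.
suff : J 1.
  have := mcoeff_triv_mul v 1 (C_path (ptriv v)).
  rewrite mul1r /J => + J1; rewrite J1 mul0r /C_path pbasis_coeff eqxx.
  by move/eqP; rewrite oner_eq0.
have Jp p : (0 < plength p)%N -> J (C_path p).
  by rewrite /J pbasis_coeff; case: eqP => // ->.
have JB x y : J x -> J y -> J (x - y).
  by rewrite /J => Jx Jy; rewrite [LHS]mcoeffB Jx Jy subr0.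
apply: H => [|y].
  split=> //; first exact: mcoeff0.
  by move=> a x Jx; rewrite /J !mcoeff_triv_mul Jx mulr0 mul0r.
by case=> [p|p|p q|p|p] hp; try move=> hq; intros; try apply: JB;
  apply: Jp; rewrite ?hp ?hq.
Qed.

HB.instance Definition _ := GRing.isZmodClosed.Build
  (path_algebra k C_quiver) C_ideal (gen_ideal_zmod_closed C_rel).
HB.instance Definition _ := isProperIdeal.Build
  (path_algebra k C_quiver) C_ideal C_ideal_proper.
HB.instance Definition _ := isTwoSided.Build
  (path_algebra k C_quiver) C_ideal (@gen_ideal_mulr _ C_rel).

Definition C_alg : algType k := alg_quot C_ideal.

Definition C_idem (v : 'I_n) : C_alg := alg_quot_pi C_ideal (C_path (@ptriv C_quiver v)).

End DoubledLine.

(* Right A-modules are left modules over the converse ring A^c: for x in such *)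
(* a module and a : A, a *: x is what is usually written x a.                 *)
Notation rmodType A := (lmodType A^c).

Definition fin_dim (k : fieldType) (A : algType k) (M : rmodType A) : Prop :=
  exists s : seq M, forall x : M, exists c : 'I_(size s) -> k,
    x = \sum_(i < size s) ((c i)%:A : A^c) *: s`_i.

Record fdMod (k : fieldType) (A : algType k) := FdMod {
  fdMod_sort :> rmodType A;
  fdMod_fin_dim : fin_dim fdMod_sort
}.

Section Modules.
Variables (k : fieldType) (A : algType k).
Implicit Types (L M N P T : fdMod A).

Definition is_zero (M : rmodType A) : Prop := forall x : M, x = 0.

Definition iso (M N : rmodType A) : Prop := exists f : {linear M -> N}, bijective f.

Definition dsum (s : seq (fdMod A)) : rmodType A :=
  foldr (fun (M : fdMod A) (N : rmodType A) => (M * N)%type : rmodType A)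
        ('rV[A^c]_0 : rmodType A) s.

Definition indecomposable M : Prop :=
  ~ is_zero M /\
  forall X Y : fdMod A, iso M (X * Y)%type -> is_zero X \/ is_zero Y.

Definition basic M : Prop :=
  exists (m : nat) (F : 'I_m -> fdMod A),
    [/\ forall i, indecomposable (F i),
        forall i j, iso (F i) (F j) -> i = j
      & iso M (dsum [seq F i | i <- enum 'I_m])].

Section Submodules.
Variable M : fdMod A.
Implicit Types U V : {pred M}.

Definition submodule U : Prop := submod_closed U.

Definition simple_submodule U : Prop :=
  [/\ submodule U, exists2 x, x \in U & x <> 0
    & forall V, submodule V -> {subset V <= U} ->
        (forall x, x \in V -> x = 0) \/ {subset U <= V}].

Definition maximal_submodule U : Prop :=
  [/\ submodule U, exists x, x \notin U
    & forall V, submodule V -> {subset U <= V} ->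
        {subset V <= U} \/ (forall x, x \in V)].

Definition radical (x : M) : Prop := forall U, maximal_submodule U -> x \in U.

(* The sum of the simple submodules.                                          *)
Definition socle (x : M) : Prop :=
  forall V, submodule V ->
    (forall U, simple_submodule U -> {subset U <= V}) -> x \in V.

Definition simple : Prop := simple_submodule (fun _ : M => true).

Definition uniserial : Prop :=
  forall U V, submodule U -> submodule V -> {subset U <= V} \/ {subset V <= U}.

(* M has a composition series 0 = F 0 < F 1 < ... < F l = M.                  *)
Definition has_length (l : nat) : Prop :=
  exists F : nat -> {pred M},
    [/\ forall i, submodule (F i),
        forall x, (x \in F 0) = (x == 0),
        forall x, x \in F l
      & forall i, (i < l)%N ->
        [/\ {subset F i <= F i.+1}, exists2 x, x \in F i.+1 & x \notin F i
          & forall V, submodule V -> {subset F i <= V} -> {subset V <= F i.+1} ->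
              {subset V <= F i} \/ {subset F i.+1 <= V}]].

End Submodules.

(* M / rad M is isomorphic to L.                                              *)
Definition top_iso M L : Prop :=
  exists f : {linear M -> L},
    (forall y, exists x, f x = y) /\ (forall x, f x = 0 <-> radical x).

Definition socle_iso M L : Prop :=
  exists f : {linear L -> M},
    injective f /\ (forall y, (exists x, f x = y) <-> socle y).

Definition projective P : Prop :=
  forall (M N : fdMod A) (g : {linear M -> N}) (f : {linear P -> N}),
    (forall y, exists x, g x = y) ->
    exists h : {linear P -> M}, forall x, g (h x) = f x.

(* A surjection from a projective module with superfluous kernel.             *)
Definition projective_cover P M : Prop :=
  projective P /\
  exists f : {linear P -> M},
    (forall y, exists x, f x = y) /\
    forall U : {pred P}, submodule U ->
      (forall x, exists u v, [/\ u \in U, f v = 0 & x = u + v]) ->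
      forall x, x \in U.

Definition exact (L M N : rmodType A) (f : {linear L -> M}) (g : {linear M -> N}) : Prop :=
  forall y, g y = 0 <-> exists x, f x = y.

Record projective_resolution M := ProjectiveResolution {
  res_term :> nat -> fdMod A;
  res_diff : forall i, {linear res_term i.+1 -> res_term i};
  res_aug : {linear res_term 0 -> M};
  res_projective : forall i, projective (res_term i);
  res_aug_surj : forall y, exists x, res_aug x = y;
  res_exact0 : exact (res_diff 0) res_aug;
  res_exactS : forall i, exact (res_diff i.+1) (res_diff i)
}.

Definition finite_projective_dimension M : Prop :=
  exists (R : projective_resolution M) (m : nat), forall i, (m < i)%N -> is_zero (R i).

Definition cocycle M N (R : projective_resolution M) i (f : {linear R i -> N}) : Prop :=
  forall x, f (res_diff R i x) = 0.

Definition coboundary M N (R : projective_resolution M) i : {linear R i -> N} -> Prop :=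
  match i with
  | 0 => fun f => forall x, f x = 0
  | j.+1 => fun f => exists g : {linear R j -> N}, forall x, f x = g (res_diff R j x)
  end.

(* Ext^i(M, N) = 0: the i-th cohomology of Hom(R, N) vanishes, where R is a   *)
(* projective resolution of M.                                                *)
Definition Ext_zero (i : nat) M N : Prop :=
  forall (R : projective_resolution M) (f : {linear R i -> N}),
    cocycle f -> coboundary f.

(* add T: the direct summands of the finite direct sums of copies of T.       *)
Definition in_add T M : Prop :=
  exists (m : nat) (N : fdMod A), iso (dsum (nseq m T)) (M * N)%type.

Definition regular_module : rmodType A := (A^c)^o.

(* 0 -> A -> K 0 -> ... -> K m -> 0, continued by zero modules.               *)
Definition finite_add_coresolution T : Prop :=
  exists (m : nat) (K : nat -> fdMod A) (eta : {linear regular_module -> K 0})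
         (d : forall i, {linear K i -> K i.+1}),
    [/\ forall i, in_add T (K i),
        forall i, (m < i)%N -> is_zero (K i),
        injective eta,
        exact eta (d 0)
      & forall i, exact (d i) (d i.+1)].

Definition generalized_tilting T : Prop :=
  [/\ finite_projective_dimension T,
      forall i, (0 < i)%N -> Ext_zero i T T
    & finite_add_coresolution T].

End Modules.

(* L is the simple module associated to the vertex v.                         *)
Definition simple_at (k : fieldType) (n : nat) (n_ge2 : (1 < n)%N)
    (v : 'I_n) (L : fdMod (C_alg n_ge2 k)) : Prop :=
  simple L /\ exists x : L, (C_idem n_ge2 k v : (C_alg n_ge2 k)^c) *: x <> 0.

Definition uniserial_length2 (k : fieldType) (A : algType k) (M L L' : fdMod A) : Prop :=
  [/\ uniserial M, has_length M 2, top_iso M L & socle_iso M L'].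

(* Main.v *)
(* A right C_n-module is a graded space M_1, ..., M_n with commuting square-zero
   maps x of degree 1 and y of degree -1. Splicing the exact sequences
   0 -> S(i-1, i) -> P(i) -> S(i, i+1) -> 0, which start with S(1, 2) = P(1),
   shows that Ext^m(S(i, i+1), M), m > 0, is the y-homology of M at i - m; the
   modules N are obtained by reversing the line. This makes the listed modules
   tilting, their coresolutions being spliced from the same sequences.

   Conversely let F be an indecomposable summand of a tilting module T, with
   nonzero y-homology. As T has finite projective dimension, the differential
   x + y (with signs) is exact on F, so some class of y-homology dies after
   finitely many steps of the zigzag x y^-1 x y^-1 ... x. Self-orthogonality
   of T shortens such a chain to a single step, i.e. x is nonzero on
   y-homology, and this splits off some S(i, i+1), with i determined by T since
   Ext^(i-j)(S(i, i+1), S(j, j+1)) <> 0 for j < i. Otherwise F is y-exact and,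
   by symmetry, x-exact; then x y <> 0 on F, which splits off some P(v) with
   1 < v < n. All these types occur in T because of the coresolution of C_n,
   which is neither x- nor y-exact and on which x y <> 0 at each inner vertex. *)

Require Import Defs.
From HB Require Import structures.
From mathcomp Require Import all_boot all_order all_algebra.
From mathcomp Require Import finmap boolp monalg zify.

Set Implicit Arguments.
Unset Strict Implicit.
Unset Printing Implicit Defensive.

Import GRing.Theory.
Local Open Scope ring_scope.

(** * Right modules *)

(** The map $x + y$ with signs alternating along the line squares to zero in $C_n$, and the regular
    module has no homology for it. Hence no projective module has any, nor, by induction along a
    finite resolution, has a module of finite projective dimension.

    A chain starting at the vertex $c$ yields a map $T \to S(c, c+1)$. Lifted along the sequences of
    $P(c), P(c-1), \dots$ it becomes, in each degree $l$ of an arbitrary projective resolution of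
    $T$, a cocycle with values in $S(c-l, c-l+1)$. Elements of the resolution lifted from the chain
    are carried along, so that the cocycle has a known value on one of them. Mapping its target onto
    the last element of the chain, self-orthogonality makes the cocycle a coboundary; the bounding
    cochain, evaluated on the lifted elements, is a zigzag further down the line with one term
    fewer.

    [Ext_zero] quantifies over all projective resolutions, while the listed modules come with one
    each. So independence of the resolution has to be proved; dimension shifting does it, for
    retracts up to maps through a projective. *)

Definition act (k : fieldType) (A : algType k) (M : rmodType A) (m : M) (a : A) : M :=
  (a : A^c) *: m.
Notation "m ## a" := (act m a) (at level 40, left associativity).

Section RightAction.
Variables (k : fieldType) (A : algType k).
Variables (M N : rmodType A).
Implicit Types (m : M) (a b : A) (c : k).

Lemma actA m a b : m ## a ## b = m ## (a * b).
Proof. by rewrite /act scalerA. Qed.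
Lemma act1 m : m ## 1 = m.
Proof. exact: scale1r. Qed.
Lemma act_r0 m : m ## 0 = 0.
Proof. exact: scale0r. Qed.
Lemma act0 a : (0 : M) ## a = 0.
Proof. exact: scaler0. Qed.
Lemma actDl m1 m2 a : (m1 + m2) ## a = m1 ## a + m2 ## a.
Proof. exact: scalerDr. Qed.
Lemma actDr m a b : m ## (a + b) = m ## a + m ## b.
Proof. exact: scalerDl. Qed.
Lemma actNl m a : (- m) ## a = - (m ## a).
Proof. exact: scalerN. Qed.
Lemma actNr m a : m ## (- a) = - (m ## a).
Proof. exact: scaleNr. Qed.
Lemma actBl m1 m2 a : (m1 - m2) ## a = m1 ## a - m2 ## a.
Proof. exact: scalerBr. Qed.
Lemma act_suml (I : Type) (r : seq I) (P : pred I) (F : I -> M) a :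
  (\sum_(i <- r | P i) F i) ## a = \sum_(i <- r | P i) (F i ## a).
Proof. exact: scaler_sumr. Qed.
Lemma act_sumr (I : Type) (r : seq I) (P : pred I) (F : I -> A) m :
  m ## (\sum_(i <- r | P i) F i) = \sum_(i <- r | P i) (m ## F i).
Proof. exact: scaler_suml. Qed.

Lemma lin_act (f : {linear M -> N}) m a : f (m ## a) = f m ## a.
Proof. exact: linearZ. Qed.

Lemma act_kC m c a : m ## c%:A ## a = m ## a ## c%:A.
Proof. by rewrite !actA mulr_algl mulr_algr. Qed.
Lemma act_kA m c a : m ## (c *: a) = m ## a ## c%:A.
Proof. by rewrite actA mulr_algr. Qed.
Lemma act_k1 m : m ## (1 : k)%:A = m.
Proof. by rewrite scale1r act1. Qed.
Lemma act_k0 m : m ## (0 : k)%:A = 0.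
Proof. by rewrite scale0r act_r0. Qed.
Lemma act_kD m c d : m ## (c + d)%:A = m ## c%:A + m ## d%:A.
Proof. by rewrite scalerDl actDr. Qed.
Lemma act_kN m c : m ## (- c)%:A = - (m ## c%:A).
Proof. by rewrite scaleNr actNr. Qed.
Lemma act_kM m c d : m ## c%:A ## d%:A = m ## (c * d)%:A.
Proof. by rewrite actA mulr_algl scalerA. Qed.
Lemma act_kV m c : c != 0 -> m ## c%:A ## (c^-1)%:A = m.
Proof. by move=> h; rewrite act_kM divff // act_k1. Qed.
Lemma act_kI m c : m ## c%:A = 0 -> m = 0 \/ c = 0.
Proof.
case: (eqVneq c 0) => [->|c0 h]; first by right.
by left; rewrite -(act_kV m c0) h act0.
Qed.

End RightAction.

Section LinearMaps.
Variables (k : fieldType) (A : algType k).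
Implicit Types (L M N : rmodType A).

Lemma mk_linear M N (f : M -> N) :
  (forall x y, f (x + y) = f x + f y) -> (forall x a, f (x ## a) = f x ## a) ->
  exists g : {linear M -> N}, g =1 f.
Proof.
move=> fD fZ.
have lin : linear f by move=> a x y; rewrite fD -[a *: x]/(x ## a) fZ.
pose l := GRing.isLinear.Build _ M N *:%R f lin.
by exists (HB.pack_for {linear M -> N} f l).
Qed.

Lemma iso_refl M : iso M M.
Proof. by exists (idfun : {linear M -> M}), id. Qed.

Lemma isoI M N (f : {linear M -> N}) : injective f -> (forall y, exists x, f x = y) ->
  iso M N.
Proof.
move=> fI fS; have [g gP] := choice fS.
by exists f, g => // x; apply: fI; rewrite gP.
Qed.

Lemma isoE M N : iso M N -> exists (f : {linear M -> N}) (g : {linear N -> M}),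
  cancel f g /\ cancel g f.
Proof.
case=> f [g fK gK].
have [h hE] : exists h : {linear N -> M}, h =1 g.
  apply: mk_linear => [x y|x a]; apply: (can_inj fK); last by rewrite lin_act !gK.
  by rewrite linearD !gK.
by exists f, h; split => x; rewrite hE.
Qed.

Lemma iso_sym M N : iso M N -> iso N M.
Proof. by move=> /isoE[f [g [fK gK]]]; exists g, f. Qed.

Lemma iso_trans L M N : iso L M -> iso M N -> iso L N.
Proof.
move=> [f bf] [g bg]; exists (g \o f : {linear L -> N}); exact: bij_comp.
Qed.

Lemma pair_lin L M N (f : {linear L -> M}) (g : {linear L -> N}) :
  exists h : {linear L -> (M * N)%type}, forall x, h x = (f x, g x).
Proof.
by apply: (@mk_linear L (M * N)%type (fun x => (f x, g x))) => [x y|x a];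
  rewrite ?linearD ?lin_act.
Qed.

Lemma copair_lin L M N (f : {linear M -> L}) (g : {linear N -> L}) :
  exists h : {linear (M * N)%type -> L}, forall x, h x = f x.1 + g x.2.
Proof.
apply: (@mk_linear (M * N)%type L (fun x => f x.1 + g x.2)) => [x y|x a].
  by rewrite !linearD addrACA.
by rewrite actDl -!lin_act.
Qed.

Lemma fst_lin M N : exists h : {linear (M * N)%type -> M}, forall x, h x = x.1.
Proof. exact: (@mk_linear (M * N)%type M fst). Qed.
Lemma snd_lin M N : exists h : {linear (M * N)%type -> N}, forall x, h x = x.2.
Proof. exact: (@mk_linear (M * N)%type N snd). Qed.

Lemma add_lin M N (f g : {linear M -> N}) :
  exists h : {linear M -> N}, forall x, h x = f x + g x.
Proof.
apply: mk_linear => [x y|x a]; first by rewrite !linearD addrACA.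
by rewrite !lin_act actDl.
Qed.
Lemma sub_lin M N (f g : {linear M -> N}) :
  exists h : {linear M -> N}, forall x, h x = f x - g x.
Proof.
apply: mk_linear => [x y|x a]; first by rewrite !linearD addrACA.
by rewrite actBl (lin_act f) (lin_act g).
Qed.
Lemma zero_lin M N : exists h : {linear M -> N}, forall x, h x = 0.
Proof. by apply: mk_linear => [x y|x a]; rewrite ?addr0 ?act0. Qed.

Lemma free_lin M (m : M) :
  exists h : {linear regular_module A -> M}, forall a : A, h a = m ## a.
Proof.
apply: (@mk_linear (regular_module A) M (fun a => m ## a)) => [x y|x a].
  exact: actDr.
by rewrite actA.
Qed.

Lemma iso_prod M M' N N' : iso M M' -> iso N N' -> iso (M * N)%type (M' * N')%type.
Proof.
move=> /isoE[f [f' [fK fK']]] /isoE[g [g' [gK gK']]].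
have [h hE] : exists h : {linear (M * N)%type -> (M' * N')%type},
    forall x, h x = (f x.1, g x.2).
  by apply: (@mk_linear (M * N)%type (M' * N')%type) => [x y|x a];
    rewrite /= ?linearD ?lin_act.
exists h, (fun x => (f' x.1, g' x.2)) => -[x y]; rewrite hE /=.
  by rewrite fK gK.
by rewrite fK' gK'.
Qed.

Lemma iso_prodA L M N : iso (L * (M * N))%type (L * M * N)%type.
Proof.
have [h hE] : exists h : {linear (L * (M * N))%type -> (L * M * N)%type},
    forall x, h x = (x.1, x.2.1, x.2.2).
  by apply: (@mk_linear (L * (M * N))%type (L * M * N)%type).
by exists h, (fun x => (x.1.1, (x.1.2, x.2))) => [[x [y z]]|[[x y] z]]; rewrite hE.
Qed.

Lemma iso_prodC M N : iso (M * N)%type (N * M)%type.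
Proof.
have [h hE] : exists h : {linear (M * N)%type -> (N * M)%type},
    forall x, h x = (x.2, x.1).
  by apply: (@mk_linear (M * N)%type (N * M)%type).
by exists h, (fun x => (x.2, x.1)) => -[x y]; rewrite hE.
Qed.

Lemma iso_zero_prod Z M : is_zero Z -> iso (Z * M)%type M.
Proof.
move=> Z0; have [h hE] := snd_lin Z M.
exists h, (fun x => (0, x)) => [[z x]|x]; rewrite hE //=.
by rewrite (Z0 z).
Qed.

Lemma iso_prod_zero Z M : is_zero Z -> iso (M * Z)%type M.
Proof. by move=> Z0; apply: iso_trans (iso_prodC _ _) (iso_zero_prod _ Z0). Qed.

End LinearMaps.

(** * Spanning lists and linear functionals *)

Section FiniteDimension.
Variables (k : fieldType) (A : algType k).

(** Recursion on the list, one coefficient at a time, gives covers and functionals by induction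
    without indexed sums. *)
Fixpoint kspan (M : rmodType A) (s : seq M) (x : M) : Prop :=
  if s is a :: s' then exists c : k, kspan s' (x - a ## c%:A) else x = 0.

Lemma fin_dimP (M : rmodType A) : fin_dim M <-> exists s : seq M, forall x, kspan s x.
Proof.
suff H (s : seq M) x : kspan s x <->
    exists c : 'I_(size s) -> k, x = \sum_(i < size s) s`_i ## (c i)%:A.
  by split=> -[s sP]; exists s => x; apply/H; exact: sP.
elim: s x => [|a s IH] x /=.
  split=> [->|[c ->]]; last by rewrite big_ord0.
  by exists (fun=> 0); rewrite big_ord0.
split=> [[c /IH[d xE]]|[c xE]].
  exists (fun i => if unlift ord0 i is Some j then d j else c).
  rewrite big_ord_recl unlift_none /= -[x](subrK (a ## c%:A)) xE addrC.
  by congr (_ + _); apply: eq_bigr => i _; rewrite liftK.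
exists (c ord0); apply/IH; exists (fun i => c (lift ord0 i)).
by rewrite xE big_ord_recl addrC addKr.
Qed.

Lemma kspan_cat (M : rmodType A) (s t : seq M) x y :
  kspan s x -> kspan t y -> kspan (s ++ t) (x + y).
Proof.
elim: s x => [|a s IH] x /=; first by move=> ->; rewrite add0r.
by move=> [c h] ht; exists c; rewrite addrAC; exact: IH.
Qed.

Lemma kspan_map (M N : rmodType A) (f : {linear M -> N}) (s : seq M) x :
  kspan s x -> kspan (map f s) (f x).
Proof.
elim: s x => [|a s IH] x /=; first by move=> ->; rewrite linear0.
by case=> c /IH h; exists c; rewrite -lin_act -linearB.
Qed.

Lemma fin_dim_surj (M N : rmodType A) (f : {linear M -> N}) :
  (forall y, exists x, f x = y) -> fin_dim M -> fin_dim N.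
Proof.
move=> fS /fin_dimP[s sP]; apply/fin_dimP; exists (map f s) => y.
by have [x <-] := fS y; apply: kspan_map.
Qed.

Lemma fin_dim_prod (M N : rmodType A) : fin_dim M -> fin_dim N -> fin_dim (M * N)%type.
Proof.
move=> /fin_dimP[s sP] /fin_dimP[t tP]; apply/fin_dimP.
have [z1 z1E] := zero_lin M N; have [z2 z2E] := zero_lin N M.
have [i iE] := pair_lin (idfun : {linear M -> M}) z1.
have [j jE] := pair_lin z2 (idfun : {linear N -> N}).
exists (map i s ++ map j t) => -[x y].
have -> : (x, y) = i x + j y :> (M * N)%type.
  by rewrite iE jE z1E z2E -[RHS]/(x + 0, 0 + y) addr0 add0r.
by apply: kspan_cat; apply: kspan_map.
Qed.

Lemma fin_dim_zero : fin_dim ('rV[A^c]_0 : rmodType A).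
Proof. by exists [::] => x; exists (fun=> 0); rewrite big_ord0 [x]thinmx0. Qed.

Definition prod_mod (M N : fdMod A) : fdMod A :=
  FdMod (fin_dim_prod (fdMod_fin_dim M) (fdMod_fin_dim N)).

Definition zero_mod : fdMod A := FdMod fin_dim_zero.

Lemma is_zero_zero_mod : is_zero zero_mod.
Proof. by move=> x; rewrite [x]thinmx0. Qed.

Lemma fin_dim_dsum (s : seq (fdMod A)) : fin_dim (dsum s).
Proof.
elim: s => [|M s IH]; first exact: fin_dim_zero.
exact: fin_dim_prod (fdMod_fin_dim M) IH.
Qed.

Definition dsum_mod (s : seq (fdMod A)) : fdMod A := FdMod (fin_dim_dsum s).

(* A proper subspace avoiding v is enlarged along a spanning sequence to a     *)
(* hyperplane avoiding v.                                                      *)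
Lemma separating_functional (M : fdMod A) (U : M -> Prop) (v : M) :
  (forall x y (c : k), U x -> U y -> U (x + y ## c%:A)) -> U 0 -> ~ U v ->
  exists phi : M -> k, [/\ forall x y, phi (x + y) = phi x + phi y,
    forall x (c : k), phi (x ## c%:A) = c * phi x,
    forall x, U x -> phi x = 0 & phi v = 1].
Proof.
move=> UD U0 Uv.
have zE (x D U' W : M) : x - (D + W) = x - (W - U') - D - U'.
  by rewrite opprB opprD !addrA [RHS]addrAC (addrAC _ (- W) (- U')) addrK addrAC.
have [s sP] := (fin_dimP M).1 (fdMod_fin_dim M).
have [H [HD H0 UH Hv HM]] : exists H : M -> Prop,
    [/\ forall x y (c : k), H x -> H y -> H (x + y ## c%:A), H 0,
        forall x, U x -> H x, ~ H v
      & forall x, kspan s x -> exists c : k, H (x - v ## c%:A)].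
  elim: {sP} s U UD U0 Uv => [|a s IH] U UD U0 Uv.
    by exists U; split => // x /= ->; exists 0; rewrite act_k0 subr0.
  (* Adjoin the first spanning vector [a] to [U]. If this captures [v], then either [v] was in [U]
     or [a] is a combination of [v] and [U], so that the hyperplane found for the remaining list
     also handles [a]. Otherwise continue with the larger subspace. *)
  pose U' x := exists u (c : k), U u /\ x = u + a ## c%:A.
  case: (pselect (U' v)) => [[u [c [Uu vE]]]|U'v].
    have [H [HD H0 UH Hv HM]] := IH _ UD U0 Uv.
    exists H; split => // x /= [e /HM[d Hd]].
    case: (eqVneq c 0) => [c0|c0]; first by rewrite vE c0 act_k0 addr0 in Uv.
    exists (d + e / c).
    have aE : a = (v - u) ## (c^-1)%:A by rewrite vE addrC addKr act_kV.
    have -> : x - v ## (d + e / c)%:A =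
        (x - a ## e%:A - v ## d%:A) + u ## (- (e / c))%:A.
      rewrite aE act_kM actBl act_kD act_kN mulrC; exact: zE.
    by apply: HD => //; exact: UH.
  have [||H [HD H0 UH Hv HM]] := IH U' _ _ U'v.
  - move=> x y c [u [d [Uu ->]]] [w [e [Uw ->]]].
    exists (u + w ## c%:A), (d + e * c); split; first exact: UD.
    by rewrite actDl act_kM act_kD addrACA.
  - by exists 0, 0; rewrite act_k0 addr0.
  exists H; split => // [x Ux|x /= [c /HM[d Hd]]].
    by apply: UH; exists x, 0; rewrite act_k0 addr0.
  exists d; rewrite -[x](subrK (a ## c%:A)) addrAC; apply: HD => //.
  by apply: UH; exists 0, 1; rewrite act_k1 add0r.
have [phi phiP] := choice (fun x => HM x (sP x)).
have uniq x c : H (x - v ## c%:A) -> phi x = c.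
  move=> Hc; apply/eqP; rewrite -subr_eq0; apply/eqP.
  apply: contrapT => /eqP ne; apply: Hv.
  have := HD _ _ (-1) Hc (phiP x); rewrite act_kN act_k1 opprB addrC.
  rewrite subrKA -act_kN -act_kD => h.
  have := HD _ _ (phi x - c)^-1 H0 h.
  by rewrite add0r act_kV.
exists phi; split => [x y|x c|x Ux|].
- apply: uniq; rewrite act_kD opprD addrACA -[X in _ + X]act_k1; exact: HD.
- apply: uniq; rewrite mulrC -act_kM -actBl -[_ ## _]add0r; exact: HD.
- by apply: uniq; rewrite act_k0 subr0; apply: UH.
- by apply: uniq; rewrite act_k1 subrr.
Qed.

End FiniteDimension.

(** * Images of homomorphisms *)

Section Image.
Variables (k : fieldType) (A : algType k) (M N : rmodType A) (f : {linear M -> N}).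

Definition im_pred : {pred N} := fun y => `[< exists x, f x = y >].

Lemma im_pred_closed : submod_closed im_pred.
Proof.
split=> [|a x y /asboolP[x' <-] /asboolP[y' <-]]; apply/asboolP.
  by exists 0; rewrite linear0.
by exists (a *: x' + y'); rewrite linearP.
Qed.
HB.instance Definition _ := GRing.isSubmodClosed.Build A^c N im_pred im_pred_closed.

Record im_sub : Type := ImSub {im_val : N; im_valP : im_val \in im_pred}.
HB.instance Definition _ := [isSub for im_val].
HB.instance Definition _ := [Choice of im_sub by <:].
HB.instance Definition _ := [SubChoice_isSubLmodule of im_sub by <:].

End Image.

Section ImageModule.
Variables (k : fieldType) (A : algType k).

Lemma image_module (M : fdMod A) (N : rmodType A) (f : {linear M -> N}) :
  exists (I : fdMod A) (p : {linear M -> I}) (j : {linear I -> N}),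
    [/\ forall y, exists x, p x = y, injective j & forall x, f x = j (p x)].
Proof.
pose I0 : rmodType A := im_sub f.
have fP x : f x \in im_pred f by apply/asboolP; exists x.
pose p0 x : I0 := ImSub (fP x).
have pE x : val (p0 x) = f x by [].
have [p pP] : exists p : {linear M -> I0}, p =1 p0.
  apply: mk_linear => [x y|x a]; apply: val_inj; rewrite pE ?linearD //=.
  by rewrite lin_act.
have pS (y : I0) : exists x, p x = y.
  case: y => y yP; have /asboolP[x xE] := yP; exists x; rewrite pP.
  exact: val_inj.
exists (FdMod (fin_dim_surj pS (fdMod_fin_dim M))), p.
exists (\val : {linear I0 -> N}); split => // [|x]; first exact: val_inj.
by rewrite -pE -pP.
Qed.

End ImageModule.

(** * Projective resolutions and Ext *)

Section Factorisation.
Variables (k : fieldType) (A : algType k).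

Lemma factor_inj (I P Y : rmodType A) (j : {linear I -> Y}) (f : {linear P -> Y}) :
  injective j -> (forall x, exists y, j y = f x) ->
  exists g : {linear P -> I}, forall x, j (g x) = f x.
Proof.
move=> jI jf; have [g0 g0P] := choice jf.
have [g gE] : exists g : {linear P -> I}, g =1 g0.
  apply: mk_linear => [x y|x a]; apply: jI; first by rewrite linearD !g0P linearD.
  by rewrite lin_act !g0P lin_act.
by exists g => x; rewrite gE g0P.
Qed.

Lemma factor_surj (X I N : rmodType A) (p : {linear X -> I}) (f : {linear X -> N}) :
  (forall y, exists x, p x = y) -> (forall x, p x = 0 -> f x = 0) ->
  exists g : {linear I -> N}, forall x, g (p x) = f x.
Proof.
move=> pS pf; have [s sP] := choice pS.
have fE x : f (s (p x)) = f x.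
  by apply/eqP; rewrite -subr_eq0 -linearB pf // linearB sP subrr.
have [g gE] : exists g : {linear I -> N}, g =1 f \o s.
  apply: mk_linear => [x y|x a] /=.
    by rewrite -[x in LHS]sP -[y in LHS]sP -linearD fE linearD.
  by rewrite -[x in LHS]sP -lin_act fE lin_act.
by exists g => x; rewrite gE /= fE.
Qed.

Definition retract (X M : rmodType A) : Prop :=
  exists (i : {linear X -> M}) (p : {linear M -> X}), cancel i p.

Lemma retract_iso (X Y : rmodType A) : iso X Y -> retract X Y.
Proof. by move=> /isoE[f [g [fK _]]]; exists f, g. Qed.

Lemma retract_trans (X Y Z : rmodType A) : retract X Y -> retract Y Z -> retract X Z.
Proof.
move=> [i [p ip]] [j [q jq]].
exists (j \o i : {linear X -> Z}), (p \o q : {linear Z -> X}) => x /=.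
by rewrite jq ip.
Qed.

Lemma retract_prodl (X Y : rmodType A) : retract X (X * Y)%type.
Proof.
have [z zE] := zero_lin X Y; have [i iE] := pair_lin (idfun : {linear X -> X}) z.
by have [p pE] := fst_lin X Y; exists i, p => x; rewrite pE iE.
Qed.

Lemma retract_prodr (X Y : rmodType A) : retract Y (X * Y)%type.
Proof. exact: retract_trans (retract_prodl Y X) (retract_iso (iso_prodC _ _)). Qed.

(** The complement is the image of the idempotent $1 - ip$. *)
Lemma retract_complement (X : rmodType A) (F : fdMod A) :
  retract X F -> exists I : fdMod A, iso F (X * I)%type.
Proof.
move=> [i [p ip]].
have [e eE] := sub_lin (idfun : {linear F -> F}) (i \o p : {linear F -> F}).
have [I [q [j [qS jI ejq]]]] := image_module e.
have pj y : p (j y) = 0.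
  by have [x <-] := qS y; rewrite -ejq eE linearB /= ip subrr.
exists I; have [f fE] := pair_lin p q; have [g gE] := copair_lin i j.
exists f, g => [x|[x y]]; rewrite gE fE /=; first by rewrite -ejq eE addrC subrK.
rewrite !linearD ip pj addr0; congr pair; apply: jI.
by rewrite linearD -!ejq !eE /= ip pj linear0 subrr add0r subr0.
Qed.

Lemma indecomposable_retract (X F : fdMod A) :
  indecomposable F -> ~ is_zero X -> retract X F -> iso F X.
Proof.
move=> [_ indF] X0 /retract_complement[I isoF].
case: (indF X I isoF) => // I0.
exact: iso_trans isoF (iso_prod_zero _ I0).
Qed.

Lemma retract_in_add (T Y : fdMod A) : retract Y T -> in_add T Y.
Proof.
move=> /retract_complement[I TI]; exists 1%N, I => /=.
exact: iso_trans (iso_prod_zero _ (@is_zero_zero_mod k A)) TI.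
Qed.

Lemma projective_retract (P Q : fdMod A) : retract P Q -> projective Q -> projective P.
Proof.
move=> [i [p ip]] projQ M N g f gS.
have [h hE] := projQ M N g (f \o p : {linear Q -> N}) gS.
by exists (h \o i : {linear P -> M}) => x /=; rewrite hE /= ip.
Qed.

Lemma projective_prod (P Q : fdMod A) :
  projective P -> projective Q -> projective (prod_mod P Q).
Proof.
move=> projP projQ M N g f gS.
have [z zE] := zero_lin P Q; have [i iE] := pair_lin (idfun : {linear P -> P}) z.
have [w wE] := zero_lin Q P; have [j jE] := pair_lin w (idfun : {linear Q -> Q}).
have [h hE] := projP M N g (f \o i : {linear P -> N}) gS.
have [l lE] := projQ M N g (f \o j : {linear Q -> N}) gS.
have [c cE] := copair_lin h l; exists c => -[x y].
rewrite cE linearD hE lE /= -linearD iE jE zE wE.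
by congr (f _); rewrite -[LHS]/(x + 0, 0 + y) addr0 add0r.
Qed.

Lemma projective_zero_mod : projective (zero_mod A).
Proof.
move=> M N g f gS; have [h hE] := zero_lin (zero_mod A) M; exists h => x.
by rewrite hE linear0 (is_zero_zero_mod x) linear0.
Qed.

End Factorisation.

(** * Acyclicity for a square-zero element *)

Section Differential.
Variables (k : fieldType) (A : algType k) (u : A).
Hypothesis uu : u * u = 0.

Definition acyclic (M : rmodType A) : Prop := forall m : M, m ## u = 0 -> exists m', m = m' ## u.

Lemma acyclic_retract (X M : rmodType A) : retract X M -> acyclic M -> acyclic X.
Proof.
move=> [i [p ip]] exM x xu; have [|m mE] := exM (i x).
  by rewrite -lin_act xu linear0.
by exists (p m); rewrite -lin_act -mE ip.
Qed.

Lemma acyclic_prod (X Y : rmodType A) : acyclic X -> acyclic Y -> acyclic (X * Y)%type.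
Proof.
move=> eX eY [x y] xyu.
have [xu yu] : x ## u = 0 /\ y ## u = 0 by case: xyu.
have [x' ->] := eX x xu; have [y' ->] := eY y yu.
by exists (x', y').
Qed.

Lemma acyclic_zero (X : rmodType A) : is_zero X -> acyclic X.
Proof. by move=> X0 x _; exists 0; rewrite act0 (X0 x). Qed.

(** Together with [acyclic_sub], the part of the long exact homology sequence that carries
    acyclicity along resolutions and coresolutions. *)
Lemma acyclic_quotient (L M N : rmodType A) (f : {linear L -> M}) (g : {linear M -> N}) :
  injective f -> exact f g -> (forall y, exists x, g x = y) ->
  acyclic L -> acyclic M -> acyclic N.
Proof.
move=> fI ex gS eL eM y yu; have [m mE] := gS y.
have [|l lE] := (ex (m ## u)).1; first by rewrite lin_act mE.
have [|l' l'E] := eL l.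
  by apply: fI; rewrite lin_act lE actA uu act_r0 linear0.
have [|m' m'E] := eM (m - f l').
  by rewrite actBl -lE l'E lin_act subrr.
exists (g m'); rewrite -lin_act -m'E linearB mE.
by rewrite (_ : g (f l') = 0) ?subr0 //; apply/ex; exists l'.
Qed.

Lemma acyclic_sub (L M N : rmodType A) (f : {linear L -> M}) (g : {linear M -> N}) :
  injective f -> exact f g -> (forall y, exists x, g x = y) ->
  acyclic M -> acyclic N -> acyclic L.
Proof.
move=> fI ex gS eM eN l lu.
have [|m mE] := eM (f l); first by rewrite -lin_act lu linear0.
have [|n nE] := eN (g m); first by rewrite -lin_act -mE; apply/ex; exists l.
have [m' m'E] := gS n.
have [|l' l'E] := (ex (m - m' ## u)).1.
  by rewrite linearB lin_act m'E nE subrr.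
exists l'; apply: fI; rewrite lin_act l'E actBl actA uu act_r0 subr0; exact: mE.
Qed.

(** The cover is free of finite rank. Acyclicity is recorded in place of freeness, because it passes
    to a projective [M] once the cover splits. *)
Lemma fdMod_cover (M : fdMod A) : fin_dim (regular_module A) ->
  acyclic (regular_module A) ->
  exists (F : fdMod A) (f : {linear F -> M}),
    acyclic F /\ forall y, exists x, f x = y.
Proof.
move=> fA aA; have [s sP] := (fin_dimP M).1 (fdMod_fin_dim M).
suff [F [f [aF fS]]] : exists (F : fdMod A) (f : {linear F -> M}),
    acyclic F /\ forall y, kspan s y -> exists x, f x = y.
  by exists F, f; split => // y; apply: fS.
elim: {sP} s => [|a s [F [f [aF fS]]]].
  have [z zE] := zero_lin (zero_mod A) M; exists (zero_mod A), z; split.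
    exact: acyclic_zero (@is_zero_zero_mod k A).
  by move=> y /= ->; exists 0; rewrite linear0.
have [g gE] := free_lin a; have [h hE] := copair_lin g f.
exists (prod_mod (FdMod fA) F), h; split; first exact: acyclic_prod.
move=> y /= [c /fS[x xE]]; exists ((c%:A : A) : regular_module A, x).
by rewrite hE /= xE gE addrC subrK.
Qed.

Lemma acyclic_projective (P : fdMod A) : fin_dim (regular_module A) ->
  acyclic (regular_module A) -> projective P -> acyclic P.
Proof.
move=> fA aA projP; have [F [f [aF fS]]] := fdMod_cover P fA aA.
have [s sE] := projP F P f (idfun : {linear P -> P}) fS.
by apply: acyclic_retract aF; exists s, f.
Qed.

End Differential.

(** * Operations on projective resolutions *)

Section Resolutions.
Variables (k : fieldType) (A : algType k).
Implicit Types (X M N P K : fdMod A).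

Lemma res_exS X (R : projective_resolution X) i : exact (res_diff R i.+1) (res_diff R i).
Proof. exact: res_exactS. Qed.
Lemma res_ex0 X (R : projective_resolution X) : exact (res_diff R 0) (res_aug R).
Proof. exact: res_exact0. Qed.
Lemma res_proj X (R : projective_resolution X) i : projective (R i).
Proof. exact: res_projective. Qed.

Arguments res_exS [X] R i y.
Arguments res_ex0 [X] R y.
Arguments res_proj [X] R i [M N g] f _.

Section Shift.
Variables (X : fdMod A) (R : projective_resolution X) (I : fdMod A).
Variables (p : {linear R 1%N -> I}) (j : {linear I -> R 0%N}).
Hypotheses (pS : forall y, exists x, p x = y) (jI : injective j).
Hypothesis djp : forall x, res_diff R 0 x = j (p x).

Lemma res_shift_exact0 : exact (res_diff R 1) p.
Proof.
move=> y; rewrite -[X in _ <-> X](res_exS R 0 y) djp.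
by split=> [->|]; [rewrite linear0 | move=> h; apply: jI; rewrite h linear0].
Qed.

(** Dimension shifting: the truncated resolution resolves the first syzygy, given as the image [I]
    of the first differential. *)
Definition res_shift : projective_resolution I :=
  ProjectiveResolution (fun i => res_proj R i.+1) pS res_shift_exact0
    (fun i => res_exS R i.+1).

Lemma res_shift_exact : exact j (res_aug R).
Proof.
move=> y; rewrite (res_ex0 R y); split=> [[x <-]|[x <-]].
  by exists (p x); rewrite djp.
by have [z <-] := pS x; exists z; rewrite djp.
Qed.

End Shift.

Section Cons.
Variables (K P X : fdMod A) (j : {linear K -> P}) (q : {linear P -> X}).
Hypotheses (jI : injective j) (ex : exact j q) (qS : forall y, exists x, q x = y).
Hypothesis projP : projective P.
Variable Q : projective_resolution K.

Definition cons_term (i : nat) : fdMod A := if i is i'.+1 then Q i' else P.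
Definition cons_diff (i : nat) : {linear cons_term i.+1 -> cons_term i} :=
  match i return {linear cons_term i.+1 -> cons_term i} with
  | 0 => (j \o res_aug Q : {linear Q 0%N -> P})
  | i'.+1 => res_diff Q i'
  end.
Lemma cons_projective i : projective (cons_term i).
Proof. by case: i => [|i] //; exact: res_proj. Qed.
Lemma cons_exact0 : exact (cons_diff 0) q.
Proof.
move=> y; rewrite (ex y); split=> [[x <-]|[x <-]] /=.
  by have [z <-] := res_aug_surj Q x; exists z.
by exists (res_aug Q x).
Qed.
Lemma cons_exactS i : exact (cons_diff i.+1) (cons_diff i).
Proof.
case: i => [|i]; last exact: (res_exS Q i).
move=> y; rewrite -[X in _ <-> X](res_ex0 Q y) /=.
by split=> [|->]; [move=> h; apply: jI; rewrite h linear0 | rewrite linear0].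
Qed.

Definition res_cons : projective_resolution X :=
  @ProjectiveResolution _ _ X cons_term cons_diff q cons_projective qS cons_exact0
    cons_exactS.

End Cons.

(** Vanishing tested on one chosen resolution, as opposed to [Ext_zero]. *)
Definition Ext_res X (R : projective_resolution X) (i : nat) N : Prop :=
  forall f : {linear R i -> N}, cocycle f -> coboundary f.

(* Comparison of resolutions by dimension shifting: the syzygies of a retract *)
(* are again retracts, up to maps factoring through a projective.             *)
Lemma Ext_res_stable_retract (m : nat) : forall X M N (R : projective_resolution M)
    (Q : projective_resolution X) (i : {linear X -> M}) (p : {linear M -> X}) (W : fdMod A)
    (al : {linear X -> W}) (be : {linear W -> X}),
  projective W -> (forall x, x = p (i x) + be (al x)) ->
  Ext_res R m.+1 N -> Ext_res Q m.+1 N.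
Proof.
elim: m => [|m IH] X M N R Q i p W al be projW ipE extR.
all: have [phi phiE] := res_proj Q 0 (i \o res_aug Q : {linear Q 0%N -> M})
  (res_aug_surj R).
all: have [psi psiE] := res_proj R 0 (p \o res_aug R : {linear R 0%N -> X})
  (res_aug_surj Q).
all: have [be' be'E] := projW _ _ (res_aug Q) be (res_aug_surj Q).
(* The defect of [psi \o phi] from the identity, corrected by the part through [W], is killed by the
   augmentation and therefore lands in the syzygy [IQ]. *)
all: have [ka1 ka1E] := sub_lin (idfun : {linear Q 0%N -> Q 0%N})
  (psi \o phi : {linear Q 0%N -> Q 0%N}).
all: have [ka0 ka0E] := sub_lin ka1 (be' \o (al \o res_aug Q) : {linear Q 0%N -> Q 0%N}).
all: have [IQ [pQ [jQ [pQS jQI dQ]]]] := image_module (res_diff Q 0).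
all: have [IR [pR [jR [pRS jRI dR]]]] := image_module (res_diff R 0).
all: have exQ := res_shift_exact pQS dQ; have exR := res_shift_exact pRS dR.
all: have [ka kaE] : exists ka : {linear Q 0%N -> IQ}, forall x, jQ (ka x) = ka0 x
  by apply: factor_inj => // x; apply/exQ;
     rewrite ka0E ka1E !linearB psiE /= phiE /= be'E -addrA -opprD -ipE subrr.
all: have [i' i'E] : exists i' : {linear IQ -> IR}, forall x, jR (i' x) = phi (jQ x)
  by apply: (factor_inj (f := (phi \o jQ : {linear IQ -> R 0%N}))) => // x; apply/exR;
     rewrite /= phiE /= (_ : res_aug Q (jQ x) = 0) ?linear0 //; apply/exQ; exists x.
all: have [p' p'E] : exists p' : {linear IR -> IQ}, forall x, jQ (p' x) = psi (jR x)
  by apply: (factor_inj (f := (psi \o jR : {linear IR -> Q 0%N}))) => // x; apply/exQ;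
     rewrite /= psiE /= (_ : res_aug R (jR x) = 0) ?linear0 //; apply/exR; exists x.
(* On the syzygy the augmentation vanishes, and with it the part through [W]. The remaining defect
   factors through the projective [Q 0], which is the hypothesis of the induction again. *)
all: have splE z : z = p' (i' z) + ka (jQ z)
  by apply: jQI; have aug0 : res_aug Q (jQ z) = 0 by [apply/exQ; exists z];
     rewrite linearD p'E i'E kaE ka0E ka1E /= aug0 !linear0 addr0 addrC subrK.
- move=> f fc.
  have [fb fbE] : exists fb : {linear IQ -> N}, forall x, fb (pQ x) = f x.
    apply: factor_surj => // x px; have : res_diff Q 0 x = 0 by rewrite dQ px linear0.
    by move=> /(res_exS Q 0)[z <-]; exact: fc.
  have [|g gE] := extR (fb \o (p' \o pR) : {linear R 1%N -> N}).
    move=> x /=; rewrite (_ : pR _ = 0) ?linear0 //; apply: jRI; rewrite -dR linear0.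
    by apply/(res_exS R 0); exists x.
  have [h hE] := add_lin (g \o phi : {linear Q 0%N -> N}) (fb \o ka : {linear Q 0%N -> N}).
  exists h => x; rewrite hE dQ -fbE {1}[pQ x]splE linearD /= -i'E; congr (_ + _).
  by have [z zE] := pRS (i' (pQ x)); rewrite -zE -dR -gE.
- have := IH IQ IR N (res_shift pRS jRI dR) (res_shift pQS jQI dQ) i' p' (Q 0%N) jQ ka
    (res_proj Q 0) splE.
  exact.
Qed.

Definition ext_vanishes (m : nat) X N : Prop :=
  exists R : projective_resolution X, Ext_res R m N.

Lemma Ext_zero_retract m X X' N : retract X' X -> ext_vanishes m.+1 X N ->
  Ext_zero m.+1 X' N.
Proof.
move=> [i [p ip]] [R extR] Q f.
have [z zE] := zero_lin X' (zero_mod A); have [w wE] := zero_lin (zero_mod A) X'.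
move: f; apply: (Ext_res_stable_retract (R := R) (i := i) (p := p) (al := z) (be := w)) => //.
  exact: projective_zero_mod.
by move=> x; rewrite ip wE addr0.
Qed.

Lemma Ext_zero_retractr m X N N' : retract N' N -> Ext_zero m.+1 X N -> Ext_zero m.+1 X N'.
Proof.
move=> [i [p ip]] extN R f fc.
have [|g gE] := extN R (i \o f : {linear R m.+1 -> N}).
  by move=> x /=; rewrite fc linear0.
by exists (p \o g : {linear R m -> N'}) => x; rewrite -[LHS]ip /= -gE.
Qed.

Lemma Ext_zero_prodr m X N N' : Ext_zero m.+1 X N -> Ext_zero m.+1 X N' ->
  Ext_zero m.+1 X (prod_mod N N').
Proof.
move=> extN extN' R f fc; have [p pE] := fst_lin N N'; have [q qE] := snd_lin N N'.
have [|g gE] := extN R (p \o f : {linear R m.+1 -> N}).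
  by move=> x /=; rewrite fc linear0.
have [|h hE] := extN' R (q \o f : {linear R m.+1 -> N'}).
  by move=> x /=; rewrite fc linear0.
have [c cE] := pair_lin g h; exists c => x; rewrite cE -gE -hE /= pE qE.
by case: (f x).
Qed.

Lemma ext_vanishes_ses m K P X N (j : {linear K -> P}) (q : {linear P -> X}) :
  injective j -> exact j q -> (forall y, exists x, q x = y) -> projective P ->
  ext_vanishes m.+1 K N -> ext_vanishes m.+2 X N.
Proof. by move=> jI ex qS projP [Q extQ]; exists (res_cons jI ex qS projP Q). Qed.

(** A 1-cocycle of the spliced resolution is a map out of the syzygy [K], and it bounds as soon as
    this map extends to [P]. *)
Lemma ext1_vanishes_ses K P X N (j : {linear K -> P}) (q : {linear P -> X}) :
  injective j -> exact j q -> (forall y, exists x, q x = y) -> projective P ->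
  projective_resolution K ->
  (forall f : {linear K -> N}, exists g : {linear P -> N}, forall x, f x = g (j x)) ->
  ext_vanishes 1 X N.
Proof.
move=> jI ex qS projP Q ext; exists (res_cons jI ex qS projP Q) => f fc.
have [fb fbE] : exists fb : {linear K -> N}, forall x, fb (res_aug Q x) = f x.
  apply: factor_surj => [|x /(res_ex0 Q)[z <-]]; first exact: res_aug_surj.
  exact: fc.
by have [g gE] := ext fb; exists g => x; rewrite -fbE gE.
Qed.

Section Zero.
Variable zf : {linear zero_mod A -> zero_mod A}.
Hypothesis zfE : forall x, zf x = 0.
Lemma zero_surj (y : zero_mod A) : exists x, zf x = y.
Proof. by exists 0; rewrite zfE (is_zero_zero_mod y). Qed.
Lemma zero_exact : exact zf zf.
Proof.
by move=> y; split=> [_|_]; [apply: zero_surj | rewrite zfE].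
Qed.
Definition res_zero : projective_resolution (zero_mod A) :=
  @ProjectiveResolution _ _ (zero_mod A) (fun=> zero_mod A) (fun=> zf) zf
    (fun=> @projective_zero_mod k A) zero_surj zero_exact (fun=> zero_exact).
End Zero.

Section Prod.
Variables (X Y : fdMod A) (R : projective_resolution X) (Q : projective_resolution Y).

Let d i := cid (@mk_linear k A (R i.+1 * Q i.+1)%type (R i * Q i)%type
  (fun x => (res_diff R i x.1, res_diff Q i x.2))
  (fun x y => congr2 pair (linearD _ _ _) (linearD _ _ _))
  (fun x a => congr2 pair (lin_act _ _ _) (lin_act _ _ _))).
Let au := cid (@mk_linear k A (R 0%N * Q 0%N)%type (X * Y)%type
  (fun x => (res_aug R x.1, res_aug Q x.2))
  (fun x y => congr2 pair (linearD _ _ _) (linearD _ _ _))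
  (fun x a => congr2 pair (lin_act _ _ _) (lin_act _ _ _))).

Lemma prod_projective i : projective (prod_mod (R i) (Q i)).
Proof. by apply: projective_prod; apply: res_proj. Qed.
Lemma prod_surj (y : prod_mod X Y) : exists x, sval au x = y.
Proof.
case: y => y1 y2; have [x1 <-] := res_aug_surj R y1; have [x2 <-] := res_aug_surj Q y2.
by exists (x1, x2); rewrite (svalP au).
Qed.
Lemma prod_exact0 : exact (sval (d 0)) (sval au).
Proof.
move=> [y1 y2]; rewrite (svalP au) /=; split.
  case=> /(res_ex0 R)[x1 <-] /(res_ex0 Q)[x2 <-].
  by exists (x1, x2); rewrite (svalP (d 0)).
case=> -[x1 x2]; rewrite (svalP (d 0)) /= => -[<- <-].
congr pair; first by apply/(res_ex0 R); exists x1.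
by apply/(res_ex0 Q); exists x2.
Qed.
Lemma prod_exactS i : exact (sval (d i.+1)) (sval (d i)).
Proof.
move=> [y1 y2]; rewrite (svalP (d i)) /=; split.
  case=> /(res_exS R)[x1 <-] /(res_exS Q)[x2 <-].
  by exists (x1, x2); rewrite (svalP (d i.+1)).
case=> -[x1 x2]; rewrite (svalP (d i.+1)) /= => -[<- <-].
congr pair; first by apply/(res_exS R); exists x1.
by apply/(res_exS Q); exists x2.
Qed.

Definition res_prod : projective_resolution (prod_mod X Y) :=
  @ProjectiveResolution _ _ (prod_mod X Y) (fun i => prod_mod (R i) (Q i))
    (fun i => sval (d i)) (sval au) prod_projective prod_surj prod_exact0 prod_exactS.

Lemma Ext_res_prod m N : Ext_res R m.+1 N -> Ext_res Q m.+1 N -> Ext_res res_prod m.+1 N.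
Proof.
move=> extR extQ f fc.
have dE i x : res_diff res_prod i x = (res_diff R i x.1, res_diff Q i x.2).
  exact: (svalP (d i) x).
have [z zE] := zero_lin (R m.+1) (Q m.+1).
have [i iE] := pair_lin (idfun : {linear R m.+1 -> R m.+1}) z.
have [w wE] := zero_lin (Q m.+1) (R m.+1).
have [j jE] := pair_lin w (idfun : {linear Q m.+1 -> Q m.+1}).
have [|g gE] := extR (f \o i : {linear R m.+1 -> N}).
  move=> x /=; rewrite iE zE -(fc (x, 0)) dE /=; congr (f _); congr pair.
  by rewrite linear0.
have [|h hE] := extQ (f \o j : {linear Q m.+1 -> N}).
  move=> x /=; rewrite jE wE -(fc (0, x)) dE /=; congr (f _); congr pair.
  by rewrite linear0.
have [c cE] := copair_lin g h; exists c => x; rewrite dE cE /= -gE -hE /= -linearD iE jE zE wE.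
by case: x => x y; congr (f _); rewrite -[RHS]/(x + 0, 0 + y) addr0 add0r.
Qed.

End Prod.

End Resolutions.

Arguments res_exS [k A X] R i y.
Arguments res_ex0 [k A X] R y.
Arguments res_proj [k A X] R i [M N g] f _.

(** * Modules of finite projective dimension *)

Section FiniteProjectiveDimension.
Variables (k : fieldType) (A : algType k).
Implicit Types (X Y M N P K : fdMod A).

Lemma finpd_zero : finite_projective_dimension (zero_mod A).
Proof.
have [z zE] := zero_lin (zero_mod A) (zero_mod A).
by exists (res_zero zE), 0%N => i _; exact: is_zero_zero_mod.
Qed.

Lemma finpd_ses K P X (j : {linear K -> P}) (q : {linear P -> X}) :
  injective j -> exact j q -> (forall y, exists x, q x = y) -> projective P ->
  finite_projective_dimension K -> finite_projective_dimension X.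
Proof.
move=> jI ex qS projP [Q [m Q0]]; exists (res_cons jI ex qS projP Q), m.+1.
by case=> // i lt; exact: Q0.
Qed.

Lemma zero_ses X (z : {linear zero_mod A -> X}) :
  injective z /\ exact z (idfun : {linear X -> X}).
Proof.
split=> [x y _|y]; first by rewrite (is_zero_zero_mod x) (is_zero_zero_mod y).
split=> [/= ->|[x <-]]; first by exists 0; rewrite linear0.
by rewrite (is_zero_zero_mod x) linear0.
Qed.

Lemma finpd_projective P : projective P -> finite_projective_dimension P.
Proof.
move=> projP; have [z _] := zero_lin (zero_mod A) P; have [zI ex] := zero_ses z.
apply: (finpd_ses zI ex) => //; first by move=> y; exists y.
exact: finpd_zero.
Qed.

Lemma ext_vanishes_projective m P N : projective P -> ext_vanishes m.+1 P N.
Proof.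
move=> projP; have [z _] := zero_lin (zero_mod A) P; have [zI ex] := zero_ses z.
have [zf zfE] := zero_lin (zero_mod A) (zero_mod A).
have idS (y : P) : exists x, (idfun : {linear P -> P}) x = y by exists y.
exists (res_cons zI ex idS projP (res_zero zfE)) => f _.
have [g gE] := zero_lin (cons_term P (res_zero zfE) m) N; exists g => x.
by rewrite gE (is_zero_zero_mod x) linear0.
Qed.

Lemma finpd_prod X Y : finite_projective_dimension X -> finite_projective_dimension Y ->
  finite_projective_dimension (prod_mod X Y).
Proof.
move=> [R [m Rm]] [Q [l Ql]]; exists (res_prod R Q), (maxn m l) => i.
rewrite gtn_max => /andP[mi li] [x y].
by rewrite (Rm i mi x) (Ql i li y).
Qed.

Lemma ext_vanishes_prod m X Y N : ext_vanishes m.+1 X N -> ext_vanishes m.+1 Y N ->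
  ext_vanishes m.+1 (prod_mod X Y) N.
Proof. by move=> [R extR] [Q extQ]; exists (res_prod R Q); apply: Ext_res_prod. Qed.

Lemma finpd_iso X Y : iso X Y -> finite_projective_dimension X -> finite_projective_dimension Y.
Proof.
move=> /isoE[f [g [fK gK]]] [R [m Rm]].
have auS y : exists x, (f \o res_aug R : {linear R 0%N -> Y}) x = y.
  by have [x xE] := res_aug_surj R (g y); exists x; rewrite /= xE gK.
have ex0 : exact (res_diff R 0) (f \o res_aug R : {linear R 0%N -> Y}).
  move=> y; rewrite -[X in _ <-> X](res_ex0 R y) /=.
  by split=> [|->]; [move=> h; apply: (can_inj fK); rewrite h linear0 | rewrite linear0].
by exists (ProjectiveResolution (@res_proj k A X R) auS ex0 (@res_exS k A X R)), m.
Qed.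

(** Induction on the length of the resolution: the first syzygy has a shorter one, and the module is
    a quotient of an acyclic projective by this acyclic syzygy. *)
Lemma finpd_acyclic (u : A) X : u * u = 0 -> fin_dim (regular_module A) ->
  acyclic u (regular_module A) -> finite_projective_dimension X -> acyclic u X.
Proof.
move=> uu fA aA [R [m Rm]].
suff H l : forall (Y : fdMod A) (Q : projective_resolution Y),
    (forall i, (l <= i)%N -> is_zero (Q i)) -> acyclic u Y.
  by apply: (H m.+1 X R) => i; exact: Rm.
elim: l => [|l IH] Y Q Q0.
  apply: acyclic_zero => y; have [x <-] := res_aug_surj Q y.
  by rewrite (Q0 0%N _ x) ?linear0.
have [I [p [j [pS jI dE]]]] := image_module (res_diff Q 0).
apply: (acyclic_quotient uu jI (res_shift_exact pS dE)).
- exact: res_aug_surj.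
- by apply: (IH I (res_shift pS jI dE)) => i li; exact: Q0.
- exact: acyclic_projective (res_proj Q 0).
Qed.

End FiniteProjectiveDimension.

(** * Finite direct sums *)

Section DirectSums.
Variables (k : fieldType) (A : algType k).
Implicit Types (M N : fdMod A) (s t : seq (fdMod A)).

Lemma dsum_cat s t : iso (dsum (s ++ t)) (dsum s * dsum t)%type.
Proof.
elim: s => [|M s IH] /=.
  exact: iso_sym (iso_zero_prod _ (@is_zero_zero_mod k A)).
exact: iso_trans (iso_prod (iso_refl M) IH) (iso_prodA _ _ _).
Qed.

Lemma dsum_map_iso (I : eqType) (F G : I -> fdMod A) (r : seq I) :
  (forall i, i \in r -> iso (F i) (G i)) -> iso (dsum (map F r)) (dsum (map G r)).
Proof.
elim: r => [|i r IH] FG /=; first exact: iso_refl.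
apply: iso_prod; first by apply: FG; rewrite mem_head.
by apply: IH => j jr; apply: FG; rewrite in_cons jr orbT.
Qed.

Lemma dsum_perm (I : eqType) (F : I -> fdMod A) (r r' : seq I) :
  perm_eq r r' -> iso (dsum (map F r)) (dsum (map F r')).
Proof.
elim: r r' => [|i r IH] r' rr'.
  by rewrite perm_sym in rr'; rewrite (perm_nilP rr'); exact: iso_refl.
have ir' : i \in r' by rewrite -(perm_mem rr') mem_head.
case/splitPr: ir' rr' => r1 r2.
rewrite perm_sym -[i :: r2]cat1s perm_catCA /= perm_cons perm_sym => rr'.
rewrite /=; apply: iso_trans (iso_prod (iso_refl (F i)) (IH _ rr')) _.
rewrite !map_cat /=.
apply: iso_trans (iso_prod (iso_refl (F i)) (dsum_cat _ _)) _.
apply: iso_trans (iso_prodA _ _ _) _.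
apply: iso_trans (iso_prod (iso_prodC _ _) (iso_refl _)) _.
apply: iso_trans (iso_sym (iso_prodA _ _ _)) _.
exact: iso_sym (dsum_cat _ (_ :: _)).
Qed.

Lemma retract_dsum s i : (i < size s)%N -> retract (nth (zero_mod A) s i) (dsum s).
Proof.
elim: s i => [|M s IH] [|i] //= lt; first exact: retract_prodl.
exact: retract_trans (IH _ lt) (retract_prodr _ _).
Qed.

Lemma dsum_separated s (w : dsum s) : w <> 0 ->
  exists i (p : {linear dsum s -> nth (zero_mod A) s i}), (i < size s)%N /\ p w <> 0.
Proof.
elim: s w => [|M s IH] w w0; first by case: w0; rewrite [w]thinmx0.
case: w w0 => x w /= w0; case: (pselect (x = 0)) => [x0|x0].
  have {}w0 : w <> 0 by move=> w00; apply: w0; rewrite x0 w00.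
  have [i [p [lt pw]]] := IH w w0; have [q qE] := snd_lin M (dsum s).
  by exists i.+1, (p \o q : {linear (M * dsum s)%type -> _}); rewrite /= qE.
by have [p pE] := fst_lin M (dsum s); exists 0%N, p; rewrite pE.
Qed.

Lemma dsum_all (P : rmodType A -> Prop) s : P ('rV[A^c]_0 : rmodType A) ->
  (forall (M : fdMod A) (N : rmodType A), P M -> P N -> P (M * N)%type) ->
  (forall i, (i < size s)%N -> P (nth (zero_mod A) s i)) -> P (dsum s).
Proof.
move=> P0 PM; elim: s => [|M s IH] Ps //=.
apply: PM; first exact: (Ps 0%N).
by apply: IH => i lt; exact: (Ps i.+1).
Qed.

Lemma acyclic_dsum (u : A) s :
  (forall i, (i < size s)%N -> acyclic u (nth (zero_mod A) s i)) -> acyclic u (dsum s).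
Proof.
apply: dsum_all => [|M N aM aN]; first exact: acyclic_zero (@is_zero_zero_mod k A).
exact: acyclic_prod.
Qed.

Lemma dsum_mod_all (P : fdMod A -> Prop) (s : seq (fdMod A)) : P (zero_mod A) ->
  (forall M N : fdMod A, P M -> P N -> P (prod_mod M N)) ->
  (forall i, (i < size s)%N -> P (nth (zero_mod A) s i)) -> P (dsum_mod s).
Proof.
move=> P0 PM.
(* [dsum_mod (M :: s)] and [prod_mod M (dsum_mod s)] differ only in their proofs of finite
   dimension. *)
have irr (N N' : fdMod A) : fdMod_sort N = fdMod_sort N' -> N = N'.
  by case: N N' => N fN [N' fN'] /= E; case: _ / E fN' => fN'; rewrite (Prop_irrelevance fN fN').
elim: s => [|M s IH] Ps; first by rewrite (irr (dsum_mod [::]) (zero_mod A)).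
rewrite (irr (dsum_mod (M :: s)) (prod_mod M (dsum_mod s))) //.
apply: PM; first exact: (Ps 0%N).
by apply: IH => i lt; exact: (Ps i.+1).
Qed.

End DirectSums.

(** * Finite coresolutions by add T *)

Section Coresolutions.
Variables (k : fieldType) (A : algType k) (T : fdMod A).
Implicit Types (M K : fdMod A) (X Y : rmodType A).

(** The coresolution condition for an arbitrary module, so that the regular module can be treated
    one projective summand at a time. *)
Definition add_coresolved X : Prop :=
  exists (m : nat) (K : nat -> fdMod A) (eta : {linear X -> K 0})
         (d : forall i, {linear K i -> K i.+1}),
    [/\ forall i, in_add T (K i), forall i, (m < i)%N -> is_zero (K i),
        injective eta, exact eta (d 0) & forall i, exact (d i) (d i.+1)].

Lemma in_add_zero : in_add T (zero_mod A).
Proof.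
by exists 0%N, (zero_mod A); apply: iso_sym; apply: iso_prod_zero; exact: is_zero_zero_mod.
Qed.

Lemma in_add_prod M K : in_add T M -> in_add T K -> in_add T (prod_mod M K).
Proof.
move=> [a [M' Ma]] [b [K' Kb]]; exists (a + b)%N, (prod_mod M' K').
rewrite nseqD; apply: iso_trans (dsum_cat _ _) _.
apply: iso_trans (iso_prod Ma Kb) _.
apply: iso_trans (iso_prodA _ _ _) _; apply: iso_trans _ (iso_sym (iso_prodA _ _ _)).
apply: iso_prod (iso_refl _).
apply: iso_trans (iso_sym (iso_prodA _ _ _)) _; apply: iso_trans _ (iso_prodA _ _ _).
exact: iso_prod (iso_refl _) (iso_prodC _ _).
Qed.

Lemma add_coresolved_iso X Y : iso X Y -> add_coresolved X -> add_coresolved Y.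
Proof.
move=> /isoE[f [g [fK gK]]] [m [K [eta [d [Kadd K0 etaI ex0 exS]]]]].
exists m, K, (eta \o g : {linear Y -> K 0%N}), d; split => //.
  by apply: inj_comp => //; exact: can_inj gK.
move=> y; rewrite (ex0 y); split=> -[x <-]; last by exists (g x).
by exists (f x); rewrite /= fK.
Qed.

Lemma add_coresolved_ses X K Y (i : {linear X -> K}) (q : {linear K -> Y}) :
  injective i -> exact i q -> (forall y, exists x, q x = y) -> in_add T K ->
  add_coresolved Y -> add_coresolved X.
Proof.
move=> iI ex qS Kadd [m [L [eta [d [Ladd L0 etaI ex0 exS]]]]].
pose K' j := if j is j'.+1 then L j' else K.
pose d' j : {linear K' j -> K' j.+1} := match j return {linear K' j -> K' j.+1} with
  | 0 => (eta \o q : {linear K -> L 0%N})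
  | j'.+1 => d j'
  end.
exists m.+1, K', i, d'; split => //.
- by case.
- by case=> // j lt; exact: L0.
- move=> y /=; rewrite -(ex y); split=> [|->]; last by rewrite linear0.
  by move=> h; apply: etaI; rewrite h linear0.
case=> [|j]; last exact: exS.
move=> y /=; rewrite (ex0 y); split=> -[x <-]; last by exists (q x).
by have [z <-] := qS x; exists z.
Qed.

Lemma add_coresolved_zero X : is_zero X -> add_coresolved X.
Proof.
move=> X0; have [eta _] := zero_lin X (zero_mod A).
have [d dE] := zero_lin (zero_mod A) (zero_mod A).
exists 0%N, (fun=> zero_mod A), eta, (fun=> d); split => //.
- by move=> _; exact: in_add_zero.
- by move=> i _; exact: is_zero_zero_mod.
- by move=> x y _; rewrite (X0 x) (X0 y).
- by move=> y; rewrite (is_zero_zero_mod y) dE; split=> // _; exists 0; rewrite linear0.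
- by move=> _ y; rewrite (is_zero_zero_mod y) dE; split=> // _; exists 0; rewrite linear0.
Qed.

Lemma add_coresolved_add K : in_add T K -> add_coresolved K.
Proof.
move=> Kadd; have [z zE] := zero_lin K (zero_mod A).
apply: (@add_coresolved_ses K K (zero_mod A) (idfun : {linear K -> K}) z) => //.
- by move=> y; rewrite zE; split=> // _; exists y.
- by move=> y; exists 0; rewrite linear0 (is_zero_zero_mod y).
exact: add_coresolved_zero (@is_zero_zero_mod k A).
Qed.

Lemma prod_map_lin (X Y X' Y' : rmodType A) (f : {linear X -> X'}) (g : {linear Y -> Y'}) :
  exists h : {linear (X * Y)%type -> (X' * Y')%type}, forall x, h x = (f x.1, g x.2).
Proof.
by apply: (@mk_linear k A (X * Y)%type (X' * Y')%type) => [x y|x a];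
  rewrite /= ?linearD ?lin_act.
Qed.

Lemma prod_map_exact (X Y X' Y' X2 Y2 : rmodType A)
  (f : {linear X -> X'}) (g : {linear Y -> Y'}) (f' : {linear X' -> X2})
  (g' : {linear Y' -> Y2}) (h : {linear (X * Y)%type -> (X' * Y')%type})
  (h' : {linear (X' * Y')%type -> (X2 * Y2)%type}) :
  (forall x, h x = (f x.1, g x.2)) -> (forall x, h' x = (f' x.1, g' x.2)) ->
  exact f f' -> exact g g' -> exact h h'.
Proof.
move=> hE h'E exf exg [x' y']; rewrite h'E /=; split.
  by case=> /exf[x <-] /exg[y <-]; exists (x, y); rewrite hE.
case=> -[x y]; rewrite hE /= => -[<- <-].
by congr pair; [apply/exf; exists x | apply/exg; exists y].
Qed.

Lemma add_coresolved_prod X Y :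
  add_coresolved X -> add_coresolved Y -> add_coresolved (X * Y)%type.
Proof.
move=> [m [K [eta [d [Kadd K0 etaI ex0 exS]]]]] [l [L [eta' [d' [Ladd L0 etaI' ex0' exS']]]]].
have [h hE] := prod_map_lin eta eta'.
pose D i := sval (cid (prod_map_lin (d i) (d' i))).
have DE i x : D i x = (d i x.1, d' i x.2) by exact: (svalP (cid (prod_map_lin (d i) (d' i)))).
exists (maxn m l), (fun i => prod_mod (K i) (L i)), h, D; split.
- by move=> i; exact: in_add_prod.
- by move=> i; rewrite gtn_max => /andP[mi li] [x y]; rewrite (K0 i mi x) (L0 i li y).
- by move=> [x y] [x' y']; rewrite !hE => -[/etaI -> /etaI' ->].
- exact: prod_map_exact hE (DE 0%N) ex0 ex0'.
- by move=> i; exact: prod_map_exact (DE i) (DE i.+1) (exS i) (exS' i).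
Qed.

(** Peeling off [K 0]: [X] is the kernel of [K 0] onto the image of [d 0], and this image has a
    shorter coresolution. *)
Lemma add_coresolved_acyclic (u : A) X : u * u = 0 -> acyclic u T ->
  add_coresolved X -> acyclic u X.
Proof.
move=> uu aT [m [K [eta [d [Kadd K0 etaI ex0 exS]]]]].
have {Kadd} aK i : acyclic u (K i).
  have [a [N isoN]] := Kadd i.
  apply: acyclic_retract (retract_trans (retract_prodl _ _) (retract_iso (iso_sym isoN))) _.
  by apply: acyclic_dsum => j; rewrite size_nseq => lt; rewrite nth_nseq lt.
have {K0} : forall i, (m.+1 <= i)%N -> is_zero (K i) by move=> i; exact: K0.
elim: m.+1 X K eta d etaI ex0 exS aK => [|l IH] X K eta d etaI ex0 exS aK K0.
  by apply: acyclic_zero => x; apply: etaI; rewrite (K0 0%N _ (eta x)) ?linear0.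
have [I [p [j [pS jI dE]]]] := image_module (d 0%N).
have exp : exact eta p.
  move=> y; rewrite -(ex0 y) dE; split=> [->|]; first by rewrite linear0.
  by move=> h; apply: jI; rewrite h linear0.
apply: (acyclic_sub uu etaI exp pS) => //.
apply: (IH I (fun i => K i.+1) j (fun i => d i.+1)) => //.
- move=> y; rewrite (exS 0%N y); split=> -[x <-]; first by exists (p x); rewrite dE.
  by have [z <-] := pS x; exists z; rewrite dE.
- by move=> i li; exact: K0.
Qed.

End Coresolutions.

(** * Zigzag relations *)

(* Right modules over such an algebra are graded spaces M_0, ..., M_(n-1) with *)
(* commuting square-zero maps x of degree 1 and y of degree -1; e v projects   *)
(* on M_v. Vertices are numbered from 0, and e v = 0 for v >= n.               *)
Record zigzag (k : fieldType) (A : algType k) (n : nat) (e : nat -> A) (x y : A) : Prop :=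
  Zigzag {
    zz_size : (2 < n)%N;
    zz_ee : forall v w, e v * e w = if v == w then e v else 0;
    zz_out : forall v, (n <= v)%N -> e v = 0;
    zz_sum : \sum_(v < n) e v = 1;
    zz_ex : forall v, e v * x = x * e v.+1;
    zz_xe0 : x * e 0%N = 0;
    zz_ey : forall v, e v.+1 * y = y * e v;
    zz_e0y : e 0%N * y = 0;
    zz_xx : x * x = 0;
    zz_yy : y * y = 0;
    zz_xy : x * y = y * x;
    zz_span : forall a v, exists c1 c2 c3 c4 : k,
      e v * a = c1 *: e v + c2 *: (e v * x) + c3 *: (e v * y) + c4 *: (e v * x * y);
    zz_inner : forall v, (0 < v)%N -> (v.+1 < n)%N -> e v * x * y <> 0
  }.

(* Reversing the line exchanges x and y, hence the modules S and N. *)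
Definition rev_idem (k : fieldType) (A : algType k) (n : nat) (e : nat -> A) (v : nat) : A :=
  if (v < n)%N then e (n.-1 - v)%N else 0.

(** The relations at the vertex 0 of the reversed line come from $e_n = 0$, and those at its last
    vertex from [zz_xe0] and [zz_e0y]. *)
Lemma zigzag_rev (k : fieldType) (A : algType k) (n : nat) (e : nat -> A) (x y : A) :
  zigzag n e x y -> zigzag n (rev_idem n e) y x.
Proof.
move=> zz; have n0 : (0 < n)%N by apply: leq_trans (zz_size zz).
rewrite /rev_idem; split.
- exact: zz_size zz.
- move=> v w; case: ltnP => vn; last by rewrite mul0r; case: eqP.
  case: ltnP => wn; last first.
    by rewrite mulr0; case: eqP => // vw; rewrite vw ltnNge wn in vn.
  rewrite (zz_ee zz); congr (if _ then _ else _); apply/eqP/eqP => [|-> //] h.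
  by rewrite -[v](@subKn _ n.-1) ?h ?subKn // -ltnS prednK.
- by move=> v; rewrite ltnNge => ->.
- rewrite -(zz_sum zz) (reindex_inj rev_ord_inj) /=; apply: eq_bigr => v _.
  rewrite ltn_subrL n0 /=; congr (e _).
  by have := ltn_ord v; lia.
- move=> v; case: ltnP => vn; last by rewrite ltnNge (leq_trans vn) // mul0r mulr0.
  case: ltnP => vn1; last first.
    by rewrite mulr0 (_ : n.-1 - v = 0)%N ?(zz_e0y zz) //; lia.
  by rewrite (_ : n.-1 - v = (n.-1 - v.+1).+1)%N ?(zz_ey zz) //; lia.
- rewrite n0 subn0 -[n.-1]subn0 -[n.-1]/(n.-1) -(zz_ey zz) subn0 prednK //.
  by rewrite (zz_out zz) ?mul0r.
- move=> v; case: ltnP => vn1; last first.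
    case: ltnP => vn; last by rewrite mul0r mulr0.
    by rewrite mul0r (_ : n.-1 - v = 0)%N ?(zz_xe0 zz) //; lia.
  by rewrite ltnW // (zz_ex zz); congr (_ * e _); lia.
- by rewrite n0 subn0 (zz_ex zz) prednK // (zz_out zz) ?mulr0.
- exact: zz_yy zz.
- exact: zz_xx zz.
- by rewrite (zz_xy zz).
- move=> a v; case: ifP => _.
    have [c1 [c2 [c3 [c4 ->]]]] := zz_span zz a (n.-1 - v)%N.
    exists c1, c3, c2, c4; rewrite -!mulrA (zz_xy zz) -!addrA; congr (_ + _).
    by rewrite addrCA.
  by exists 0, 0, 0, 0; rewrite !mul0r !scale0r !addr0.
- move=> v v0 vn; rewrite ltnW // -mulrA -(zz_xy zz) mulrA.
  by apply: (zz_inner zz); lia.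
Qed.

Section Zigzag.
Variables (k : fieldType) (A : algType k) (n : nat) (e : nat -> A) (x y : A).
Hypothesis zz : zigzag n e x y.

Section Homogeneous.
Variable M : rmodType A.
Implicit Types (m : M) (v w : nat).

Definition homog v m : Prop := m ## e v = m.

Lemma homD v m m' : homog v m -> homog v m' -> homog v (m + m').
Proof. by rewrite /homog actDl => -> ->. Qed.
Lemma homZ v m (c : k) : homog v m -> homog v (m ## c%:A).
Proof. by rewrite /homog act_kC => ->. Qed.
Lemma homN v m : homog v m -> homog v (- m).
Proof. by rewrite /homog actNl => ->. Qed.
Lemma homB v m m' : homog v m -> homog v m' -> homog v (m - m').
Proof. by move=> h h'; apply: homD => //; apply: homN. Qed.
Lemma hom_e v m : homog v (m ## e v).
Proof. by rewrite /homog actA (zz_ee zz) eqxx. Qed.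
Lemma hom_ne v w m : homog v m -> v != w -> m ## e w = 0.
Proof. by move=> <- /negbTE vw; rewrite actA (zz_ee zz) vw act_r0. Qed.
Lemma hom_out v m : homog v m -> (n <= v)%N -> m = 0.
Proof. by move=> <- nv; rewrite (zz_out zz) // act_r0. Qed.
Lemma act_ex v m : m ## e v ## x = m ## x ## e v.+1.
Proof. by rewrite !actA (zz_ex zz). Qed.
Lemma act_ey v m : m ## e v.+1 ## y = m ## y ## e v.
Proof. by rewrite !actA (zz_ey zz). Qed.
Lemma act_xe0 m : m ## x ## e 0%N = 0.
Proof. by rewrite actA (zz_xe0 zz) act_r0. Qed.
Lemma act_xx m : m ## x ## x = 0.
Proof. by rewrite actA (zz_xx zz) act_r0. Qed.
Lemma act_yy m : m ## y ## y = 0.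
Proof. by rewrite actA (zz_yy zz) act_r0. Qed.
Lemma act_yx m : m ## y ## x = m ## x ## y.
Proof. by rewrite !actA (zz_xy zz). Qed.
Lemma hom_x v m : homog v m -> homog v.+1 (m ## x).
Proof. by rewrite /homog -act_ex => ->. Qed.
Lemma hom_y v m : homog v.+1 m -> homog v (m ## y).
Proof. by rewrite /homog -act_ey => ->. Qed.
Lemma hom0_y m : homog 0 m -> m ## y = 0.
Proof. by move=> <-; rewrite actA (zz_e0y zz) act_r0. Qed.
Lemma hom_sum m : m = \sum_(v < n) m ## e v.
Proof. by rewrite -act_sumr (zz_sum zz) act1. Qed.
Lemma hom_sep m : (forall v, m ## e v = 0) -> m = 0.
Proof. by move=> m0; rewrite [m]hom_sum big1. Qed.
Lemma hom_last_x v m : homog v m -> (n <= v.+1)%N -> m ## x = 0.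
Proof. by move=> /hom_x h nv; exact: hom_out h nv. Qed.

Lemma hom_act v m (a : A) : homog v m -> forall c1 c2 c3 c4 : k,
  e v * a = c1 *: e v + c2 *: (e v * x) + c3 *: (e v * y) + c4 *: (e v * x * y) ->
  m ## a = m ## c1%:A + m ## x ## c2%:A + m ## y ## c3%:A + m ## x ## y ## c4%:A.
Proof.
move=> hm c1 c2 c3 c4 ea; rewrite -{1}hm actA ea !actDr.
rewrite (act_kA _ c1) (act_kA _ c2) (act_kA _ c3) (act_kA _ c4).
by rewrite -(actA _ (e v * x)) -!(actA _ (e v)) hm.
Qed.

End Homogeneous.

Let act_kx (M : rmodType A) (m : M) (c : k) : m ## c%:A ## x = m ## x ## c%:A.
Proof. exact: act_kC. Qed.
Let act_ky (M : rmodType A) (m : M) (c : k) : m ## c%:A ## y = m ## y ## c%:A.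
Proof. exact: act_kC. Qed.
Definition act_simp := (@actDl k A, act_kx, act_ky, act_xx, act_yy, act_yx,
  @act0 k A, @add0r, @addr0).

Lemma hom_regular v : homog v (e v : regular_module A).
Proof. by rewrite /homog -[LHS]/(e v * e v) (zz_ee zz) eqxx. Qed.

Lemma lin_hom (M N : rmodType A) (f : {linear M -> N}) v (m : M) : homog v m -> homog v (f m).
Proof. by rewrite /homog -lin_act => ->. Qed.

(* The idempotents, x and y generate A as an algebra. *)
Lemma zz_linear (M N : rmodType A) (f : M -> N) :
  (forall m m', f (m + m') = f m + f m') ->
  (forall m (c : k), f (m ## c%:A) = f m ## c%:A) ->
  (forall m v, f (m ## e v) = f m ## e v) ->
  (forall m, f (m ## x) = f m ## x) -> (forall m, f (m ## y) = f m ## y) ->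
  exists g : {linear M -> N}, g =1 f.
Proof.
move=> fD fc fe fx fy; apply: mk_linear => // m a.
have f0 : f 0 = 0 by rewrite -[X in f X](act_k0 0) fc act_k0.
have f_sum (F : 'I_n -> M) : f (\sum_(v < n) F v) = \sum_(v < n) f (F v).
  exact: (big_morph f fD f0).
rewrite -[a]mul1r -(zz_sum zz) mulr_suml !act_sumr f_sum; apply: eq_bigr => v _.
have [c1 [c2 [c3 [c4 ->]]]] := zz_span zz a v.
rewrite !actDr !fD (act_kA _ c1) (act_kA _ c2) (act_kA _ c3) (act_kA _ c4).
rewrite (act_kA _ c1) (act_kA _ c2) (act_kA _ c3) (act_kA _ c4).
by rewrite !fc -!(actA _ (e v * x)) -!(actA _ (e v)) !(fx, fy, fe).
Qed.

(** A zero arrow would make $xy$ vanish at an inner vertex at one of its ends, and $n > 2$ provides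
    such an end. *)
Lemma e_x_neq0 v : (v.+1 < n)%N -> e v * x <> 0.
Proof.
move=> vn ex0; have n2 := zz_size zz; case: v vn ex0 => [|v] vn ex0.
  apply: (@zz_inner _ _ _ _ _ _ zz 1%N) => //.
  by rewrite -mulrA (zz_xy zz) mulrA (zz_ey zz) -mulrA ex0 mulr0.
by apply: (@zz_inner _ _ _ _ _ _ zz v.+1) => //; rewrite ex0 mul0r.
Qed.

Lemma e_y_neq0 v : (v.+1 < n)%N -> e v.+1 * y <> 0.
Proof.
move=> vn ey0; have n2 := zz_size zz; have [vn2|vn2] := ltnP v.+2 n.
  apply: (@zz_inner _ _ _ _ _ _ zz v.+1) => //.
  by rewrite -mulrA (zz_xy zz) mulrA ey0 mul0r.
apply: (@zz_inner _ _ _ _ _ _ zz v) => //; first lia.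
by rewrite (zz_ex zz) -mulrA ey0 mulr0.
Qed.

Lemma fin_dim_zz : fin_dim (regular_module A).
Proof.
apply/fin_dimP.
pose s v : seq (regular_module A) := [:: e v; e v * x; e v * y; e v * x * y].
exists (flatten [seq s v | v <- iota 0 n]) => a.
have zE (P Q R S : A) : P + Q + R + S - P - Q - R - S = 0.
  by apply/eqP; rewrite subr_eq0 !subr_eq [eqbRHS]addrC (addrC (S + R)) (addrC S) !addrA.
have sumE (b : A) : b = \sum_(v <- iota 0 n) e v * b.
  rewrite -[LHS]mul1r -(zz_sum zz) mulr_suml -(big_mkord predT (fun v => e v * b)).
  by rewrite /index_iota subn0.
rewrite [a]sumE.
elim: (iota 0 n) => [|v r IH]; first by rewrite big_nil.
rewrite big_cons /=; apply: (@kspan_cat _ _ _ (s v)) => //.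
have [c1 [c2 [c3 [c4 ->]]]] := zz_span zz a v.
have aE (b : regular_module A) (c : k) : b ## c%:A = c *: (b : A).
  by rewrite -[LHS]/((b : A) * c%:A) mulr_algr.
exists c1, c2, c3, c4; rewrite /= !aE.
exact: zE.
Qed.

End Zigzag.

(** * Generators of P(v) and S(i, i+1) *)

Section Generators.
Variables (k : fieldType) (A : algType k) (n : nat) (e : nat -> A) (x y : A).
Hypothesis zz : zigzag n e x y.
Local Notation homog := (homog e).

(* t freely generates P(v), resp. s generates S(i, i+1); over the reversed     *)
(* idempotents, genS describes the modules N.                                  *)
Definition genP v (P : fdMod A) (t : P) : Prop :=
  [/\ projective P, homog v t, forall p, exists a, p = t ## a
    & forall a, t ## a = 0 -> e v * a = 0].

Definition genS i (S : fdMod A) (s : S) : Prop :=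
  [/\ (i.+1 < n)%N, homog i s, s ## y = 0, s ## x <> 0
    & forall m, exists c d : k, m = s ## c%:A + s ## x ## d%:A].

Let zE := act_simp zz.

Lemma gen_unique (P M : rmodType A) (t : P) (f g : {linear P -> M}) :
  (forall p, exists a, p = t ## a) -> f t = g t -> f =1 g.
Proof. by move=> tP ft p; have [a ->] := tP p; rewrite !lin_act ft. Qed.

Lemma genP_map v (P : fdMod A) (t : P) (M : rmodType A) (m : M) :
  genP v t -> homog v m -> exists f : {linear P -> M}, f t = m.
Proof.
move=> [_ ht tP tfree] hm; have [p pE] := free_lin t; have [g gE] := free_lin m.
have [|a|f fE] := factor_surj (p := p) (f := g).
- by move=> z; have [a ->] := tP z; exists a.
- rewrite pE gE => /tfree ea; by rewrite -hm actA ea act_r0.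
by exists f; have := fE (1 : A); rewrite pE gE !act1.
Qed.

Lemma genP_coef v (P : fdMod A) (t : P) p : genP v t ->
  exists c1 c2 c3 c4 : k,
    p = t ## c1%:A + t ## x ## c2%:A + t ## y ## c3%:A + t ## x ## y ## c4%:A.
Proof.
move=> [_ ht tP _]; have [a ->] := tP p.
have [c1 [c2 [c3 [c4 ea]]]] := zz_span zz a v; exists c1, c2, c3, c4.
exact: hom_act ht _ _ _ _ ea.
Qed.

Lemma genP_xy v (P : fdMod A) (t : P) : genP v t -> (0 < v)%N -> (v.+1 < n)%N ->
  t ## x ## y <> 0.
Proof.
move=> [_ _ _ tfree] v0 vn; rewrite actA => /tfree; rewrite mulrA.
exact: zz_inner zz v v0 vn.
Qed.

(** Acting by $xy$, then by $y$ and by $x$, isolates one coefficient at a time in front of $txy \neq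
    0$. *)
Lemma genP_coef0 v (P : fdMod A) (t : P) (c1 c2 c3 c4 : k) : genP v t ->
  (0 < v)%N -> (v.+1 < n)%N ->
  t ## c1%:A + t ## x ## c2%:A + t ## y ## c3%:A + t ## x ## y ## c4%:A = 0 ->
  [/\ c1 = 0, c2 = 0, c3 = 0 & c4 = 0].
Proof.
move=> gt v0 vn; have txy := genP_xy gt v0 vn.
have nz (c : k) : t ## x ## y ## c%:A = 0 -> c = 0 by case/act_kI.
move=> E; have c10 : c1 = 0.
  by apply: nz; move: (congr1 (fun m => m ## x ## y) E); rewrite !zE.
move: E; rewrite c10 act_k0 add0r => E.
have c20 : c2 = 0 by apply: nz; move: (congr1 (fun m => m ## y) E); rewrite !zE.
have c30 : c3 = 0 by apply: nz; move: (congr1 (fun m => m ## x) E); rewrite !zE.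
by move: E; rewrite c20 c30 !act_k0 !add0r => /nz.
Qed.

Lemma genP_acyclic_y v (P : fdMod A) (t : P) : genP v t -> (0 < v)%N -> (v.+1 < n)%N ->
  acyclic y P.
Proof.
move=> gt v0 vn p py; have [c1 [c2 [c3 [c4 pE]]]] := genP_coef p gt.
have E : t ## (0 : k)%:A + t ## x ## (0 : k)%:A + t ## y ## c1%:A + t ## x ## y ## c2%:A = 0.
  by rewrite -py pE !zE !act_k0 !zE.
have [_ _ c10 c20] := genP_coef0 gt v0 vn E.
exists (t ## c3%:A + t ## x ## c4%:A).
by rewrite pE c10 c20 !act_k0 !zE.
Qed.

(** The spanning elements $t, tx, ty, txy$ sit at the vertices $v-1$, $v$, $v+1$. *)
Lemma genP_vanish v w (P : fdMod A) (t : P) (p : P) : genP v t -> homog w p ->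
  (w.+1 < v)%N -> p = 0.
Proof.
move=> gt; have [_ ht _ _] := gt; have [c1 [c2 [c3 [c4 ->]]]] := genP_coef p gt.
move=> <- wv; rewrite !actDl !(act_kC _ _ (e w)).
case: v ht wv gt => // v ht wv gt.
have hx := hom_x zz ht; have hy := hom_y zz ht; have hxy := hom_y zz hx.
rewrite (hom_ne zz ht) ?(hom_ne zz hx) ?(hom_ne zz hy) ?(hom_ne zz hxy) ?act0 ?addr0 //; lia.
Qed.

Lemma genS_coef0 i (S : fdMod A) (s : S) (c d : k) : genS i s ->
  s ## c%:A + s ## x ## d%:A = 0 -> c = 0 /\ d = 0.
Proof.
move=> [_ hs sy sx _] E.
have c0 : c = 0.
  by have := congr1 (fun m => m ## x) E; rewrite !zE; case/act_kI.
by split=> //; move: E; rewrite c0 act_k0 add0r; case/act_kI.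
Qed.

Lemma genS_gen i (S : fdMod A) (s : S) : genS i s -> forall p, exists a, p = s ## a.
Proof.
move=> [_ _ _ _ sS] p; have [c [d ->]] := sS p; exists (c%:A + x * d%:A).
by rewrite actDr actA.
Qed.

Lemma genS_map i (S : fdMod A) (s : S) (M : rmodType A) (m : M) :
  genS i s -> homog i m -> m ## y = 0 -> exists f : {linear S -> M}, f s = m.
Proof.
move=> gs hm my; have [_ hs sy _ _] := gs.
have [p pE] := free_lin s; have [g gE] := free_lin m.
have [|a|f fE] := factor_surj (p := p) (f := g).
- by move=> z; have [a ->] := genS_gen gs z; exists a.
- rewrite pE gE; have [c1 [c2 [c3 [c4 ea]]]] := zz_span zz a i.
  rewrite (hom_act hs ea) (hom_act hm ea) -!(act_yx zz) sy my !act0 !addr0.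
  by move=> /(genS_coef0 gs)[-> ->]; rewrite !act_k0 addr0.
by exists f; have := fE (1 : A); rewrite pE gE !act1.
Qed.

Lemma genS_iso i (S S' : fdMod A) (s : S) (s' : S') : genS i s -> genS i s' -> iso S S'.
Proof.
move=> gs gs'; have [_ hs sy _ _] := gs; have [_ hs' sy' _ _] := gs'.
have [f fs] := genS_map gs hs' sy'; have [g gs1] := genS_map gs' hs sy.
exists f, g.
  apply: (gen_unique (g := idfun : {linear S -> S}) (f := g \o f : {linear S -> S}) (genS_gen gs)).
  by rewrite /= fs.
apply: (gen_unique (g := idfun : {linear S' -> S'}) (f := f \o g : {linear S' -> S'}) (genS_gen gs')).
by rewrite /= gs1.
Qed.

Lemma genS_hom_lt i (S : fdMod A) (s : S) w (m : S) : genS i s -> homog w m -> (w < i)%N -> m = 0.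
Proof.
move=> [_ hs _ _ sS] hm wi; have [c [d mE]] := sS m.
rewrite -hm mE actDl !(act_kC _ _ (e w)) (hom_ne zz hs) ?(hom_ne zz (hom_x zz hs)); try lia.
by rewrite !act0 addr0.
Qed.

Lemma genS_acyclic_x i (S : fdMod A) (s : S) : genS i s -> acyclic x S.
Proof.
move=> gs m mx; have [_ _ _ _ sS] := gs; have [c [d mE]] := sS m.
have [|_ c0] := genS_coef0 (c := 0) (d := c) gs.
  by rewrite -mx mE !zE act_k0 add0r.
by exists (s ## d%:A); rewrite mE c0 act_k0 add0r act_kC.
Qed.

(* phi is the functional induced on the socle of S, which determines the map.  *)
Lemma genS_comap i (S : fdMod A) (s : S) (M : rmodType A) (phi : M -> k) : genS i s ->
  (forall m m', phi (m + m') = phi m + phi m') ->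
  (forall m (c : k), phi (m ## c%:A) = c * phi m) ->
  (forall m, phi (m ## y ## e i.+1) = 0) ->
  exists f : {linear M -> S}, forall m,
    f m = s ## (phi (m ## x ## e i.+1))%:A + s ## x ## (phi (m ## e i.+1))%:A.
Proof.
move=> gs phiD phiZ phiy; have [_ hs sy _ _] := gs; have hsx := hom_x zz hs.
have phi0 : phi 0 = 0 by rewrite -(act_k0 (0 : M)) phiZ mul0r.
apply: (zz_linear zz) => [m m'|m c|m v|m|m].
- by rewrite !actDl !phiD !act_kD addrACA.
- by rewrite !(act_kC m c) !(act_kC (m ## x) c) !phiZ actDl !act_kM ![c * _]mulrC.
- rewrite (act_ex zz) actDl !(act_kC _ _ (e v)).
  case: (eqVneq v i) => [->|vi].
    rewrite hs (hom_ne zz hsx) ?act0 ?addr0; last lia.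
    rewrite (hom_e zz) (hom_ne zz (hom_e zz i m)) ?phi0 ?act_k0 ?addr0 //; lia.
  rewrite (hom_ne zz hs) 1?eq_sym // act0 add0r.
  rewrite (hom_ne zz (hom_e zz v.+1 _)) ?eqSS // phi0 act_k0 add0r.
  case: (eqVneq v i.+1) => [->|vi1]; first by rewrite (hom_e zz) hsx.
  by rewrite (hom_ne zz (hom_e zz v m)) // phi0 act_k0 (hom_ne zz hsx) 1?eq_sym // act0.
- by rewrite !zE phi0 act_k0 add0r.
- by rewrite !zE !phiy !act_k0 -!(act_yx zz) sy !act0 addr0.
Qed.

(** In [genS_comap] take a functional that is 1 at $mx$ and vanishes on the image of $y$. *)
Lemma genS_comap_elt i (S M : fdMod A) (s : S) (m : M) : genS i s -> homog i m ->
  (forall u, m ## x <> u ## y) -> exists f : {linear M -> S}, f m = s.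
Proof.
move=> gs hm mx.
have [|||phi [phiD phiZ phiU phi1]] :=
  @separating_functional k A M (fun w => exists u, w = u ## y) (m ## x).
- by move=> _ _ c [u ->] [u' ->]; exists (u + u' ## c%:A); rewrite actDl act_kC.
- by exists 0; rewrite act0.
- by case=> u; exact: mx.
have [|f fE] := genS_comap gs phiD phiZ.
  by move=> w; apply: phiU; exists (w ## e i.+2); rewrite (act_ey zz).
have phi0 : phi 0 = 0 by rewrite -(act_k0 (0 : M)) phiZ mul0r.
by exists f; rewrite fE (hom_x zz hm) phi1 act_k1 (hom_ne zz hm) ?phi0 ?act_k0 ?addr0 //; lia.
Qed.

Lemma genS_retract i (S M : fdMod A) (s : S) (m : M) : genS i s -> homog i m ->
  m ## y = 0 -> (forall u, m ## x <> u ## y) -> retract S M.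
Proof.
move=> gs hm my mx; have [f fm] := genS_comap_elt gs hm mx.
have [g gs1] := genS_map gs hm my; exists g, f.
apply: (gen_unique (g := idfun : {linear S -> S}) (f := f \o g : {linear S -> S}) (genS_gen gs)).
by rewrite /= gs1.
Qed.

(** The socle of $P(v)$ is the line of $txy$. A functional with value 1 at $mxy$ therefore induces a
    homomorphism $M \to P(v)$, in which each of $t, tx, ty, txy$ is paired with the complementary
    product. *)
Lemma genP_retract v (P M : fdMod A) (t : P) (m : M) : genP v t -> homog v m ->
  m ## x ## y <> 0 -> retract P M.
Proof.
move=> gt hm mxy; have [_ ht tP _] := gt.
have [|||phi [phiD phiZ _ phi1]] :=
  @separating_functional k A M (fun w => w = 0) (m ## x ## y) => //.
  by move=> _ _ c -> ->; rewrite act0 addr0.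
have phi0 : phi 0 = 0 by rewrite -(act_k0 (0 : M)) phiZ mul0r.
have ife w u (N : rmodType A) (z : N) : homog w z -> z ## e u = if u == w then z else 0.
  by move=> hz; case: eqP => [-> //|/eqP uw]; rewrite (hom_ne zz hz) // eq_sym.
have d4 (a a' b b' c c' d d' : P) :
    a + a' + (b + b') + (c + c') + (d + d') = a + b + c + d + (a' + b' + c' + d').
  by rewrite (addrACA a) (addrACA (a + b)) (addrACA (a + b + c)).
have cse (b : bool) (z : P) (m1 m2 : M) : m1 = (if b then m2 else 0) ->
    z ## (phi m1)%:A = (if b then z else 0) ## (phi m2)%:A.
  by move=> ->; case: b; rewrite ?phi0 ?act_k0 ?act0.
have [f fE] : exists f : {linear M -> P}, forall w,
  f w = t ## (phi (w ## x ## y ## e v))%:A + t ## x ## (phi (w ## y ## e v))%:A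
      + t ## y ## (phi (w ## x ## e v))%:A + t ## x ## y ## (phi (w ## e v))%:A.
  apply: (zz_linear zz) => [w w'|w c|w u|w|w].
  - by rewrite !actDl !phiD !act_kD d4.
  - by rewrite !(act_kC _ c x) !(act_kC _ c y) !(act_kC _ c (e v)) !phiZ !actDl !act_kM ![c * _]mulrC.
  - have v0 : (0 < v)%N.
      by rewrite lt0n; apply/eqP => v0; apply: mxy; rewrite -(act_yx zz) (hom0_y zz) ?act0 // -v0.
    case: v v0 gt hm ht phi1 => // v _ gt hm ht phi1.
    have hx := hom_x zz ht; have hy := hom_y zz ht; have hxy := hom_y zz hx.
    rewrite !actDl !(act_kC _ _ (e u)).
    rewrite (ife _ _ _ _ ht) (ife _ _ _ _ hx) (ife _ _ _ _ hy) (ife _ _ _ _ hxy).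
    have ee z : z ## e u ## e v.+1 = if u == v.+1 then z ## e v.+1 else 0.
      by rewrite (ife _ _ _ _ (hom_e zz u z)) eq_sym; case: eqP => // ->.
    congr (_ + _ + _ + _); apply: cse.
    + by rewrite -ee (act_ex zz) (act_ey zz).
    + case: u ee => [|u] ee; first by rewrite (hom0_y zz (hom_e zz 0%N w)) act0.
      by rewrite (act_ey zz) (ife _ _ _ _ (hom_e zz u (w ## y))) eqSS eq_sym; case: eqP => // ->.
    + by rewrite (act_ex zz) (ife _ _ _ _ (hom_e zz u.+1 (w ## x))) eqSS eq_sym; case: eqP => // ->.
    + exact: ee.
  - by rewrite !zE phi0 !act_k0 !addr0 !add0r.
  - by rewrite !zE phi0 !act_k0 !addr0 !add0r.
have hmxy : homog v (m ## x ## y) by apply: (hom_y zz); exact: (hom_x zz).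
have mxe : m ## x ## e v = 0 by rewrite (hom_ne zz (hom_x zz hm)) //; lia.
have mye : m ## y ## e v = 0.
  case: (v) hm => [|w] hm; first by rewrite (hom0_y zz hm) act0.
  by rewrite (hom_ne zz (hom_y zz hm)) //; lia.
have fm : f m = t + t ## x ## y ## (phi m)%:A.
  by rewrite fE hmxy phi1 act_k1 mxe mye phi0 !act_k0 !addr0 hm.
(* The image of [m] is [t] only up to the socle. Sending [t] to $m - mxy\,\varphi(m)$ instead
   removes the excess, because $xyxy = 0$. *)
have [g gt1] := genP_map gt (homB hm (homZ (phi m) hmxy)).
exists g, f; apply: (gen_unique (g := idfun : {linear P -> P}) (f := f \o g : {linear P -> P}) tP).
rewrite /= gt1 linearB lin_act !(lin_act f) fm !zE.
by rewrite addrK.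
Qed.

End Generators.

(** * The exact sequences linking S and P *)

Section Sequences.
Variables (k : fieldType) (A : algType k) (n : nat) (e : nat -> A) (x y : A).
Hypothesis zz : zigzag n e x y.
Local Notation homog := (homog e).
Local Notation genP := (genP e).
Local Notation genS := (genS n e x y).

Let zE := act_simp zz.

(** The element $ty$ generates the span of $ty$ and $txy$, and $y$ acts by zero on the quotient by
    it. *)
Lemma genPS_ses i (S' P S : fdMod A) (s' : S') (t : P) (s : S) :
  genS i s' -> genP i.+1 t -> genS i.+1 s ->
  exists (j : {linear S' -> P}) (q : {linear P -> S}),
    [/\ injective j, exact j q, forall z, exists p, q p = z, j s' = t ## y & q t = s].
Proof.
move=> gs' gt gs; have [_ _ _ _ sS'] := gs'; have [_ ht tP _] := gt.
have [ilt hs sy _ _] := gs.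
have [|j js'] := genS_map zz gs' (hom_y zz ht); first by rewrite (act_yy zz).
have [q qt] := genP_map gt hs.
have jE c d : j (s' ## c%:A + s' ## x ## d%:A) = t ## y ## c%:A + t ## x ## y ## d%:A.
  by rewrite linearD !lin_act js' (act_yx zz).
exists j, q; split => //.
- move=> a b jab; apply/eqP; rewrite -subr_eq0; apply/eqP.
  have {jab} : j (a - b) = 0 by rewrite linearB jab subrr.
  have [c [d ->]] := sS' (a - b); rewrite jE => E.
  have {}E : t ## (0 : k)%:A + t ## x ## (0 : k)%:A + t ## y ## c%:A + t ## x ## y ## d%:A = 0.
    by rewrite !act_k0 !add0r.
  by have [//|//|_ _ -> ->] := genP_coef0 zz gt _ _ E; rewrite !act_k0 addr0.
- move=> p; split=> [|[z <-]].
    have [c1 [c2 [c3 [c4 ->]]]] := genP_coef zz p gt.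
    rewrite !linearD !lin_act qt -(act_yx zz) sy !act0 !addr0.
    case/(genS_coef0 zz gs) => -> ->; exists (s' ## c3%:A + s' ## x ## c4%:A).
    by rewrite jE !act_k0 !add0r.
  have [c [d ->]] := sS' z; rewrite jE linearD !lin_act qt -(act_yx zz) sy.
  by rewrite !act0 addr0.
- by move=> z; have [a ->] := genS_gen gs z; exists (t ## a); rewrite lin_act qt.
Qed.

(** At the vertex 0 the generator of the projective is already killed by $y$. *)
Lemma genS0_iso (S P : fdMod A) (s : S) (t : P) : genS 0 s -> genP 0 t -> iso S P.
Proof.
move=> gs gt; have [_ hs _ _ _] := gs; have [_ ht tP _] := gt.
have [f fs] := genS_map zz gs ht (hom0_y zz ht); have [g gt1] := genP_map gt hs.
exists f, g.
  apply: (gen_unique (g := idfun : {linear S -> S}) (f := g \o f : {linear S -> S}) (genS_gen gs)).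
  by rewrite /= fs.
apply: (gen_unique (g := idfun : {linear P -> P}) (f := f \o g : {linear P -> P}) tP).
by rewrite /= gt1.
Qed.

Lemma genS0_projective (S P : fdMod A) (s : S) (t : P) : genS 0 s -> genP 0 t -> projective S.
Proof.
move=> gs gt; apply: projective_retract (retract_iso (genS0_iso gs gt)) _.
by case: gt.
Qed.

(* The section of the cover A -> P sends t to an element whose component in    *)
(* e_v A e_v = span (e_v, e_v x y) has coefficient 1 on e_v.                   *)
Lemma generator_genP v (P : fdMod A) (t : P) : projective P -> homog v t -> t <> 0 ->
  (forall p, exists a, p = t ## a) -> genP v t.
Proof.
move=> projP ht t0 tP; split => // b tb.
have [p pE] := free_lin t.
have [|s sE] := projP (FdMod (fin_dim_zz zz)) P p (idfun : {linear P -> P}).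
  by move=> z; have [a ->] := tP z; exists (a : regular_module A).
pose a : A := s t.
have ta : t ## a = t by rewrite -pE sE.
have ab : a * b = 0 by move: (lin_act s t b); rewrite tb linear0 => /esym.
have ae : a * e v = a by move: (lin_act s t (e v)); rewrite ht => /esym.
have [c1 [c2 [c3 [c4 ea]]]] := zz_span zz a v.
have eaE : e v * a = c1 *: e v + c4 *: (e v * x * y).
  have vS w : (w == w.+1) = false by rewrite -(inj_eq succn_inj) eqn_leq ltnn andbF.
  have vS' w : (w.+1 == w) = false by rewrite eqn_leq ltnn.
  have exe : e v * x * e v = 0 by rewrite (zz_ex zz) -mulrA (zz_ee zz) vS' mulr0.
  have eye : e v * y * e v = 0.
    case: (v) => [|w]; first by rewrite (zz_e0y zz) mul0r.
    by rewrite (zz_ey zz) -mulrA (zz_ee zz) vS mulr0.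
  have exye : e v * x * y * e v = e v * x * y.
    by rewrite (zz_ex zz) -!mulrA -(zz_ey zz) (mulrA (e _)) (zz_ee zz) eqxx.
  rewrite -{1}ae mulrA ea !mulrDl -!scalerAl exe eye exye (zz_ee zz) eqxx.
  by rewrite !scaler0 !addr0.
have tE : t = t ## c1%:A + t ## x ## y ## c4%:A.
  rewrite -{1}ta -{1}ht actA eaE actDr (act_kA _ c1) (act_kA _ c4).
  by rewrite -(actA _ (e v * x)) -(actA _ (e v)) ht.
(* Acting by $xy$ on $t(1 - c_1) = c_4\,txy$ gives $txy(1 - c_1) = 0$. So $c_1 \neq 1$ would force
   $txy = 0$, and then $t = 0$. *)
have c11 : c1 = 1.
  apply/eqP; rewrite eq_sym -subr_eq0; apply/eqP; apply: contrapT => /eqP c1n.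
  have txy : t ## x ## y = 0.
    have [|//|c1e] := @act_kI k A P (t ## x ## y) (1 - c1).
      rewrite act_kD act_kN act_k1 {1}tE !zE -!(act_yx zz) !zE; by rewrite subrr.
    by rewrite c1e eqxx in c1n.
  have [|//|c1e] := @act_kI k A P t (1 - c1); last by rewrite c1e eqxx in c1n.
  by rewrite act_kD act_kN act_k1 {1}tE txy act0 addr0 subrr.
(* Since $xy$ commutes with $e_v$, the equation reads $e_v b = -c_4\,xy\,e_v b$; inserted into
   itself it produces the factor $xyxy = 0$. *)
have eb : e v * b = - (c4 *: (e v * x * y * b)).
  apply/eqP; rewrite -addr_eq0; apply/eqP.
  have := congr1 (fun z => e v * z) ab; rewrite mulr0 mulrA eaE c11 mulrDl.
  by rewrite -!scalerAl scale1r.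
have exyC : e v * x * y = x * y * e v.
  by rewrite (zz_ex zz) -!mulrA (zz_ey zz).
rewrite eb exyC -(mulrA (x * y)) eb exyC -!mulrA.
have xyxy : x * (y * (x * y)) = 0.
  by rewrite (zz_xy zz) (mulrA y) (zz_yy zz) mul0r mulr0.
have z0 (z : A) : x * (y * (x * (y * z))) = 0.
  by rewrite (mulrA x y z) (mulrA y) (mulrA x (y * (x * y))) xyxy mul0r.
by rewrite mulrN mulrN -scalerAr -scalerAr z0 !scaler0 oppr0 scaler0 oppr0.
Qed.

Hypothesis exP : forall v, (v < n)%N -> exists (P : fdMod A) (t : P), genP v t.
Hypothesis exS : forall v, (v.+1 < n)%N -> exists (S : fdMod A) (s : S), genS v s.

Lemma genS_finpd v (S : fdMod A) (s : S) : genS v s -> finite_projective_dimension S.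
Proof.
elim: v S s => [|v IH] S s gs; have [vn _ _ _ _] := gs.
  have [P [t gt]] := exP (ltnW vn); apply: finpd_projective; exact: genS0_projective gs gt.
have [P [t gt]] := exP (ltnW vn); have [S' [s' gs']] := exS (ltnW vn).
have [j [q [jI ex qS _ _]]] := genPS_ses gs' gt gs.
by apply: finpd_ses jI ex qS _ (IH _ _ gs'); case: gt.
Qed.

Lemma genS_ext_vanishes m v (S N : fdMod A) (s : S) : genS v s ->
  (forall w, (w < v)%N -> forall z : N, homog w z -> z ## y = 0 -> exists u, z = u ## y) ->
  ext_vanishes m.+1 S N.
Proof.
elim: v m S s => [|v IH] m S s gs Ny; have [vn _ _ _ _] := gs.
  have [P [t gt]] := exP (ltnW vn); apply: ext_vanishes_projective.
  exact: genS0_projective gs gt.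
have [P [t gt]] := exP (ltnW vn); have [S' [s' gs']] := exS (ltnW vn).
have [j [q [jI ex qS js' qt]]] := genPS_ses gs' gt gs; have [projP _ _ _] := gt.
case: m => [|m]; last first.
  by apply: ext_vanishes_ses jI ex qS projP (IH m _ _ gs' _) => w wv; apply: Ny; exact: ltnW.
have [R _] := genS_finpd gs'; apply: ext1_vanishes_ses jI ex qS projP R _ => f.
have [_ hs' sy' _ _] := gs'.
(* Since $s'$ goes to $ty$ in $P(v+1)$, extending [f] amounts to choosing, as image of $t$, a
   preimage under $y$ of the $y$-cycle [f s']. *)
have [|u uE] := Ny v (ltnSn v) (f s') (lin_hom f hs').
  by rewrite -lin_act sy' linear0.
have [g gtE] := genP_map gt (hom_e zz v.+1 u); exists g => z.
apply: (gen_unique (g := g \o j : {linear S' -> N}) (f := f) (genS_gen gs')).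
by rewrite /= js' lin_act gtE (act_ey zz) -uE; exact: esym (lin_hom f hs').
Qed.

(** Induction on $i - v$: the projective $P(v+1)$ lies in add T and the cokernel is $S(v+1, v+2)$,
    until the summand $S(i, i+1)$ of T is reached. *)
Lemma genS_coresolved (T : fdMod A) i (Si : fdMod A) (si : Si) :
  genS i si -> retract Si T ->
  (forall v, (0 < v)%N -> (v.+1 < n)%N -> exists (P : fdMod A) (t : P), genP v t /\ retract P T) ->
  forall v (S : fdMod A) (s : S), (v <= i)%N -> genS v s -> add_coresolved T S.
Proof.
move=> gi Ti TP v S s /subnK; move: (i - v)%N => d; elim: d v S s => [|d IH] v S s vE gs.
  apply: add_coresolved_add; apply: retract_in_add; apply: retract_trans Ti.
  by apply: retract_iso; rewrite add0n in vE; subst v; exact: genS_iso gs gi.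
have [iln _ _ _ _] := gi.
have vn : (v.+2 < n)%N by lia.
have [P [t [gt PT]]] := TP v.+1 isT vn; have [S1 [s1 gs1]] := exS vn.
have [j [q [jI ex qS _ _]]] := genPS_ses gs gt gs1.
apply: add_coresolved_ses jI ex qS (retract_in_add PT) (IH _ _ _ _ gs1).
by rewrite addnS.
Qed.

End Sequences.

(** * Chains in self-orthogonal modules *)

Section Delta.
Variables (k : fieldType) (A : algType k) (n : nat) (e : nat -> A) (x y : A).
Hypothesis zz : zigzag n e x y.
Local Notation homog := (homog e).

(** As in the total complex of a double complex, the sign alternating with the vertex turns
    commuting differentials into anticommuting ones. *)
Definition delta : A := x + (\sum_(v < n) (-1) ^+ v *: e v) * y.

Lemma e_delta v : e v * delta = e v * x + (-1) ^+ v *: (e v * y).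
Proof.
rewrite /delta mulrDr mulrA; congr (_ + _); rewrite mulr_sumr.
have [vn|nv] := ltnP v n; last first.
  by rewrite (zz_out zz nv) mul0r scaler0 big1 ?mul0r // => w _; rewrite mul0r.
rewrite (bigD1 (Ordinal vn)) //= big1 ?addr0 => [|w wv].
  by rewrite -scalerAr (zz_ee zz) eqxx scalerAl.
rewrite -scalerAr (zz_ee zz) ifN ?scaler0 //; apply: contra wv => /eqP wv.
by apply/eqP/val_inj.
Qed.

Lemma sum_e (a : A) : a = \sum_(v < n) e v * a.
Proof. by rewrite -mulr_suml (zz_sum zz) mul1r. Qed.

Lemma delta_sq : delta * delta = 0.
Proof.
rewrite [delta * delta]sum_e big1 // => v _; rewrite mulrA e_delta mulrDl -scalerAl.
rewrite (zz_ex zz) -mulrA e_delta mulrDr (mulrA x (e _)) -(zz_ex zz) -mulrA (zz_xx zz) mulr0 add0r.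
rewrite exprS mulN1r scaleNr mulrN -scalerAr (mulrA x) -(zz_ex zz) addrC.
case: v => -[|v] vn /=; rewrite ?(zz_ey zz) ?(zz_e0y zz).
  by rewrite mul0r scaler0 add0r -mulrA (zz_xy zz) mulrA (zz_e0y zz) mul0r scaler0 oppr0.
rewrite -(mulrA y) e_delta mulrDr -scalerAr !mulrA -(zz_ey zz).
rewrite -(mulrA _ y y) (zz_yy zz) mulr0 scaler0 addr0.
by rewrite -!mulrA (zz_xy zz) subrr.
Qed.

Lemma act_delta (M : rmodType A) v (m : M) : homog v m ->
  m ## delta = m ## x + m ## y ## ((-1) ^+ v)%:A.
Proof.
move=> hm; rewrite -{1}hm actA e_delta actDr act_kA.
by rewrite -!(actA _ (e v)) hm.
Qed.

Lemma delta_e v : delta * e v = x * e v + (-1) ^+ v.+1 *: (y * e v).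
Proof.
rewrite /delta mulrDl -mulrA -(zz_ey zz) mulrA; congr (_ + _); rewrite mulr_suml.
have [vn|nv] := ltnP v.+1 n; last first.
  by rewrite (zz_out zz nv) mul0r scaler0 big1 ?mul0r // => w _; rewrite mulr0.
rewrite (bigD1 (Ordinal vn)) //= big1 ?addr0 => [|w wv].
  by rewrite -scalerAl (zz_ee zz) eqxx -scalerAl.
by rewrite -scalerAl (zz_ee zz) ifN ?scaler0 //.
Qed.

Lemma delta_act (M : rmodType A) v (m : M) :
  m ## delta ## e v = m ## x ## e v + m ## y ## e v ## ((-1) ^+ v.+1)%:A.
Proof. by rewrite actA delta_e actDr act_kA -!(actA _ _ (e v)). Qed.

(** Checked on each $e_v A$ separately: it has the basis $e_v, e_v x, e_v y, e_v xy$ at an inner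
    vertex, $e_v, e_v x$ at the first and $e_v, e_v y$ at the last, and is exact in each case. *)
Lemma acyclic_delta : acyclic delta (regular_module A).
Proof.
move=> z zd.
have key (v : 'I_n) : exists w : regular_module A, ((e v : regular_module A) ## z) = w ## delta.
  pose m : regular_module A := e v.
  have [c1 [c2 [c3 [c4 ez]]]] := zz_span zz z v.
  have hm : homog v m by exact: (hom_regular zz).
  have hx := hom_x zz hm.
  have hxy : homog v (m ## x ## y) by exact: (hom_y zz).
  have n2 := zz_size zz; have vn := ltn_ord v.
  pose s : k := (-1) ^+ v; have ss : s * s = 1 by rewrite -expr2 sqrr_sign.
  have md : m ## delta = m ## x + m ## y ## s%:A by exact: act_delta.
  have mxd : m ## x ## delta = - (m ## x ## y ## s%:A).
    by rewrite (act_delta hx) (act_xx zz) add0r exprS mulN1r act_kN.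
  have myd : m ## y ## delta = m ## x ## y.
    rewrite -(act_yx zz); case: (nat_of_ord v) hm => [|w] hm.
      by rewrite (hom0_y zz hm) !act0.
    by rewrite (act_delta (hom_y zz hm)) (act_yy zz) act0 addr0.
  have mxyd : m ## x ## y ## delta = 0.
    by rewrite (act_delta hxy) (act_yy zz) (act_yx zz) (act_xx zz) !act0 addr0.
  have zE := hom_act hm ez.
  have : m ## z ## delta = 0.
    by rewrite actA (_ : (z : A) * delta = 0) ?act_r0.
  rewrite zE !actDl !(act_kC _ _ delta) md mxd myd mxyd act0 addr0 actDl !act_kM => E.
  have [v0|v0] := eqVneq (v : nat) 0%N.
    have my0 : m ## y = 0 by apply: (hom0_y zz); rewrite -v0.
    have mx0 : m ## x <> 0.
      by rewrite -[m ## x]/(e v * x); apply: (e_x_neq0 zz); rewrite v0; exact: ltnW.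
    have c10 : c1 = 0.
      by move: E; rewrite -(act_yx zz) my0 !(act0, addr0, oppr0) => /act_kI[].
    exists (m ## c2%:A); rewrite c10 -(act_yx zz) my0 !act0 act_k0 add0r !addr0.
    by rewrite (act_kC _ _ delta) md my0 act0 addr0.
  have [vl|vl] := eqVneq (v.+1 : nat) n.
    have mx0 : m ## x = 0 by apply: (hom_last_x zz hm); rewrite vl.
    have my0 : m ## y <> 0.
      rewrite -[m ## y]/(e v * y) -(prednK (n := v)) ?lt0n //.
      by apply: (e_y_neq0 zz); rewrite prednK ?lt0n.
    have c10 : c1 = 0.
      move: E; rewrite mx0 !(act0, addr0, add0r, oppr0) => /act_kI[] // /eqP.
      by rewrite mulf_eq0 signr_eq0 /= => /eqP.
    exists (m ## (s * c3)%:A); rewrite c10 mx0 !act0 act_k0 !(add0r, addr0).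
    by rewrite (act_kC _ _ delta) md mx0 add0r act_kM mulrA ss mul1r.
  have mxy0 : m ## x ## y <> 0.
    by rewrite -[m ## x ## y]/(e v * x * y); apply: (zz_inner zz); lia.
  have c10 : c1 = 0.
    have := congr1 (fun z => z ## y) E; rewrite /= !actDl !actNl !(act_kC _ _ y).
    by rewrite !(act_yy zz) !(act0, addr0, oppr0) => /act_kI[].
  have c3E : c3 = s * c2.
    move: E; rewrite c10 mulr0 !act_k0 !(addr0, add0r) actNl act_kM addrC.
    rewrite -act_kN -act_kD => /act_kI[] // /eqP; rewrite subr_eq0 => /eqP.
    by rewrite ?[c2 * s]mulrC.
  exists (m ## c2%:A + m ## y ## c4%:A); rewrite c10 c3E act_k0 add0r.
  by rewrite actDl !(act_kC _ _ delta) md myd actDl act_kM.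
have [w wE] := choice key.
exists (\sum_v w v); rewrite act_suml -(eq_bigr _ (fun v _ => wE v)).
exact: sum_e.
Qed.

End Delta.

(** * Zigzags of elements *)

Section Chains.
Variables (k : fieldType) (A : algType k) (n : nat) (e : nat -> A) (x y : A).
Hypothesis zz : zigzag n e x y.
Local Notation homog := (homog e).
Local Notation genP := (genP e).
Local Notation genS := (genS n e x y).
Local Notation delta := (delta n e x y).

(** Vertices are counted downwards from [c]. Subtraction truncates, so the guard assigns 0 to
    positions left of the line; thus the rules for $x$ and $y$ hold without side conditions. *)
Definition comp_below (M : rmodType A) (c i : nat) (m : M) : M :=
  if (i <= c)%N then m ## e (c - i) else 0.

Definition below (M : rmodType A) c i (m : M) : Prop := comp_below c i m = m.

Section Below.
Variable M : rmodType A.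
Implicit Types (m : M) (c i d : nat).

Lemma belowE c i m : below c i m -> comp_below c i m = m.
Proof. by []. Qed.
Lemma below_comp c i m : below c i (comp_below c i m).
Proof. by rewrite /below /comp_below; case: (leqP i c) => // _; exact: (hom_e zz). Qed.
Lemma comp_below_y c i m : comp_below c i m ## y = comp_below c i.+1 (m ## y).
Proof.
rewrite /comp_below; case: (ltnP i c) => ic.
  by rewrite ltnW // -(act_ey zz) subnSK.
case: ifP => [ic'|_]; last by rewrite act0.
by rewrite (_ : c - i = 0)%N ?(hom0_y zz (hom_e zz _ m)) //; apply/eqP; rewrite subn_eq0.
Qed.
Lemma comp_below_x c i m : comp_below c i.+1 m ## x = comp_below c i (m ## x).
Proof.
rewrite /comp_below; case: (ltnP i c) => ic.
  by rewrite ltnW // (act_ex zz) subnSK.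
case: ifP => [ic'|_]; last by rewrite act0.
by rewrite (_ : c - i = 0)%N ?(act_xe0 zz) ?act0 //; apply/eqP; rewrite subn_eq0.
Qed.
Lemma below_y c i m : below c i m -> below c i.+1 (m ## y).
Proof. by rewrite /below -comp_below_y => ->. Qed.
Lemma below_x c i m : below c i.+1 m -> below c i (m ## x).
Proof. by rewrite /below -comp_below_x => ->. Qed.
Lemma below0 c i : below c i (0 : M).
Proof. by rewrite /below /comp_below act0 if_same. Qed.
Lemma belowD c i m m' : below c i m -> below c i m' -> below c i (m + m').
Proof.
rewrite /below /comp_below; case: ifP => _; first by rewrite actDl => -> ->.
by move=> <- <-; rewrite addr0.
Qed.
Lemma belowZ c i m (a : k) : below c i m -> below c i (m ## a%:A).
Proof.
rewrite /below /comp_below; case: ifP => _; first by rewrite act_kC => ->.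
by move=> <-; rewrite act0.
Qed.
Lemma belowB c i m m' : below c i m -> below c i m' -> below c i (m - m').
Proof. by move=> h h'; rewrite -[m' in - m']act_k1 -act_kN; apply/belowD/belowZ. Qed.
Lemma below_hom c m : homog c m <-> below c 0 m.
Proof. by rewrite /below /comp_below leq0n subn0. Qed.
Lemma below_out c i m : below c i m -> (c < i)%N -> m = 0.
Proof. by rewrite /below /comp_below leqNgt => + ci; rewrite ci => <-. Qed.
Lemma below_homog c i m : below c i m -> (i <= c)%N -> homog (c - i) m.
Proof. by rewrite /below /comp_below => + ic; rewrite ic. Qed.
Lemma belowSS c i d m : below (c + d) (i + d) m <-> below c i m.
Proof. by rewrite /below /comp_below leq_add2r subnDr. Qed.
Lemma below_shift c i d m : below c (i + d) m -> below (c - d) i m.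
Proof.
case: (leqP d c) => dc; first by rewrite -{1}(subnK dc) => /belowSS.
by move=> /below_out ->; [exact: below0 | lia].
Qed.
End Below.

Lemma lin_below (M N : rmodType A) (f : {linear M -> N}) c i (m : M) :
  below c i m -> below c i (f m).
Proof.
rewrite /below /comp_below; case: ifP => _ <-; first by rewrite lin_act !(hom_e zz).
by rewrite linear0.
Qed.

(* u 0 sits at the vertex c, and the zigzag u r -> . <- ... -> . <- u 0 -> .   *)
(* formed by x and y does not continue to the right of u 0.                    *)
Definition chain (M : rmodType A) c r (u : nat -> M) : Prop :=
  [/\ forall i, below c i.*2 (u i), forall i, (r < i)%N -> u i = 0,
      forall i, u i.+1 ## x = u i ## y & forall w, u 0%N ## x <> w ## y].

(** If every zigzag could be continued to the right, one ending in a $y$-cycle $t_0$ could be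
    prolonged until it leaves the line. The signed sum of its terms is then a cycle, hence a
    boundary of $\delta$, and comparing components at and below the vertex of $t_0$ puts $t_0$ into
    the image of $y$. *)
Lemma chain_exists (M : rmodType A) : acyclic delta M -> ~ acyclic y M ->
  exists c r (u : nat -> M), chain c r u.
Proof.
move=> aD ay; apply: contrapT => noch; apply: ay => m my.
have H c r (u : nat -> M) : (forall i, below c i.*2 (u i)) ->
    (forall i, (r < i)%N -> u i = 0) -> (forall i, u i.+1 ## x = u i ## y) ->
    exists w, u 0%N ## x = w ## y.
  move=> uh ur ux; apply: contrapT => nw; apply: noch; exists c, r, u; split=> // w wE.
  by apply: nw; exists w.
suff key (v : 'I_n) : exists w, m ## e v = w ## y.
  have [w wE] := choice key; exists (\sum_v w v).
  by rewrite act_suml -(eq_bigr _ (fun v _ => wE v)); exact: (hom_sum zz).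
set t0 := m ## e v; pose s : k := - (-1) ^+ v.
have ss : s * s = 1 by rewrite /s mulrNN -expr2 sqrr_sign.
have t0y : t0 ## y = 0.
  rewrite /t0; case: (nat_of_ord v) => [|w]; first by rewrite (hom0_y zz (hom_e zz 0%N m)).
  by rewrite (act_ey zz) my act0.
have t0h : homog v t0 by exact: (hom_e zz).
(* Each prolongation puts a new first term two vertices further up and shifts the others, with $t_0$
   staying last. *)
have up N : exists u : nat -> M, [/\ forall i, below (v + N.*2) i.*2 (u i),
    forall i, (N < i)%N -> u i = 0, forall i, u i.+1 ## x = u i ## y & u N = t0].
  elim: N => [|N [u [uh ur ux uN]]].
    exists (fun i => if i is 0 then t0 else 0); split => //.
    - by case=> [|i]; [rewrite double0 addn0; exact: (proj1 (below_hom v t0)) | exact: below0].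
    - by case.
    - by case=> [|i]; rewrite ?t0y ?act0.
  have [w wE] := H _ _ _ uh ur ux.
  have cE : (v + N.+1.*2 = v + N.*2 + 2)%N by rewrite doubleS; lia.
  exists (fun i => if i is j.+1 then u j else comp_below (v + N.+1.*2) 0 w); split => //.
  - case=> [|i]; first exact: below_comp.
    by rewrite cE (_ : i.+1.*2 = i.*2 + 2)%N; [exact: (proj2 (belowSS _ _ 2 _)) | rewrite doubleS; lia].
  - by case=> // i; rewrite ltnS; exact: ur.
  - case=> [|i]; last exact: ux.
    rewrite comp_below_y -wE; symmetry; apply: below_x; rewrite cE.
    by rewrite (_ : 2%N = 0 + 2)%N //; exact: (proj2 (belowSS _ _ 2 _) (uh 0%N)).
(* After $n$ prolongations [u 0] would sit at $v + 2n \geq n$, hence it is zero. *)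
have [u [uh ur ux uN]] := up n.
have u00 : u 0%N = 0.
  have h := proj2 (below_hom _ _) (uh 0%N); apply: (hom_out zz h); rewrite -addnn; lia.
(* All terms sit at vertices of the parity of $v$, so $\delta$ acts on them with one sign, and the
   powers of [s] make the sum telescope. *)
pose z := \sum_(i < n.+1) u i ## (s ^+ i)%:A.
have ud i : u i ## delta = u i ## x - u i ## y ## s%:A.
  case: (leqP i.*2 (v + n.*2)) => ic; last first.
    by rewrite (below_out (uh i) ic) !act0 subr0.
  have h := below_homog (uh i) ic.
  rewrite (act_delta zz h) -act_kN /s opprK; congr (_ + _ ## _%:A).
  rewrite -signr_odd oddB // oddD !odd_double !addbF.
  by rewrite signr_odd.
have zd : z ## delta = 0.
  rewrite act_suml.
  under eq_bigr => i _ do rewrite (act_kC _ _ delta) ud actBl.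
  rewrite sumrB big_ord_recl big_ord_recr /= u00 uN t0y !act0 add0r addr0.
  apply/eqP; rewrite subr_eq0; apply/eqP; apply: eq_bigr => i _.
  by rewrite /bump /= ux act_kM exprS.
have [w wE] := aD z zd.
have ze p : (p <= v)%N -> z ## e p = if p == v then t0 ## (s ^+ n)%:A else 0.
  move=> pv; rewrite act_suml big_ord_recr /= big1 ?add0r => [|i _].
    rewrite uN (act_kC _ _ (e p)); case: eqP => [->|/eqP ne]; first by rewrite t0h.
    by rewrite (hom_ne zz t0h) 1?eq_sym // act0.
  rewrite (act_kC _ _ (e p)); have lt := ltn_ord i.
  have [|ic] := leqP i.*2 (v + n.*2); last by rewrite (below_out (uh i) ic) !act0.
  move=> ic; rewrite (hom_ne zz (below_homog (uh i) ic)) ?act0 //.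
  by rewrite -!muln2 in ic *; lia.
have wde p : (p <= v)%N -> w ## x ## e p + w ## y ## e p ## ((-1) ^+ p.+1)%:A =
    if p == v then t0 ## (s ^+ n)%:A else 0.
  by move=> pv; rewrite -(ze p pv) wE (delta_act zz).
have sn : s ^+ n * s ^+ n = 1.
  by rewrite -expr2 -exprM mulnC exprM expr2 ss expr1n.
(* The component at $v$ of $z = w\delta$ is, up to sign, $t_0 = w_{v-1}x \pm w_{v+1}y$; only the
   first term is left to treat. *)
suff [w1 w1E] : exists w1, w ## x ## e v = w1 ## y.
  have := wde v (leqnn v); rewrite eqxx w1E -(act_ey zz) => E.
  exists ((w1 + w ## e v.+1 ## ((-1) ^+ v.+1)%:A) ## (s ^+ n)%:A).
  by rewrite (act_kC _ _ y) actDl (act_kC _ _ y) E act_kM sn act_k1.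
case: (posnP v) => [v0|v0]; first by exists 0; rewrite v0 (act_xe0 zz) act0.
(* The components of $z$ below $v$ vanish. This says that $w_{v-1}, w_{v-3}, \dots$ with suitable
   signs form a zigzag, and it too continues to the right. *)
have [||i|w1 w1E] := H v.-1 v (fun i => comp_below v.-1 i.*2 w ## ((- s) ^+ i)%:A).
- by move=> i; apply: belowZ; exact: below_comp.
- move=> i vi; rewrite (below_out (below_comp v.-1 i.*2 w)) ?act0 //.
  by rewrite -addnn; lia.
- rewrite (act_kC _ _ x) (act_kC _ _ y) doubleS comp_below_x comp_below_y.
  rewrite /comp_below; case: ifP => ic; last by rewrite !act0.
  have := wde (v.-1 - i.*2.+1)%N; rewrite ifN; last by lia.
  move=> /(_ _)/eqP; rewrite addr_eq0 => /(_ _)/eqP ->; last by lia.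
  rewrite -act_kN act_kM; congr (_ ## _%:A).
  have -> : - (-1) ^+ (v.-1 - i.*2.+1).+1 = - s.
    rewrite /s opprK exprS mulN1r opprK -[LHS]signr_odd -[RHS]signr_odd.
    rewrite oddB // oddS odd_double /=.
    by case: (nat_of_ord v) v0 => //= w' _; rewrite addbT.
  by rewrite exprS mulrA mulrNN ss mul1r.
exists w1; rewrite -w1E expr0 act_k1.
rewrite (_ : comp_below v.-1 0.*2 w = w ## e v.-1) ?(act_ex zz) ?prednK //.
by rewrite /comp_below /= subn0.
Qed.

End Chains.

(** * Lifting chains to cocycles *)

Section SelfOrthogonal.
Variables (k : fieldType) (A : algType k) (n : nat) (e : nat -> A) (x y : A).
Hypothesis zz : zigzag n e x y.
Local Notation homog := (homog e).
Local Notation genP := (genP e).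
Local Notation genS := (genS n e x y).
Local Notation below := (below e).
Local Notation comp_below := (comp_below e).
Local Notation chain := (chain e x y).
Hypothesis exP : forall v, (v < n)%N -> exists (P : fdMod A) (t : P), genP v t.
Hypothesis exS : forall v, (v.+1 < n)%N -> exists (S : fdMod A) (s : S), genS v s.

Lemma genS_below c l j (S : fdMod A) (s z : S) : genS (c - l) s -> (l <= c)%N ->
  (l < j)%N -> below c j z -> z = 0.
Proof.
move=> gs lc lj hz; case: (leqP j c) => jc; last exact: (below_out hz jc).
by apply: (genS_hom_lt zz gs (below_homog hz jc)); lia.
Qed.

Section Resolution.
Variables (T : fdMod A) (R : projective_resolution T) (c r : nat).

(* rho 0, ..., rho r is the degree l part of a chain map from the resolution   *)
(* of the zigzag module given by a chain, and sigma the cocycle of R obtained  *)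
(* by lifting a map from T to S(c, c + 1).                                     *)
Definition lifted (l : nat) (rho : nat -> R l) : Prop :=
  [/\ forall i, below c (i.*2 + l) (rho i), forall i, (r < i)%N -> rho i = 0,
      forall i, exists z, res_diff R l z = rho i ## y + rho i.+1 ## x ## ((-1) ^+ l.+1)%:A
    & exists (S : fdMod A) (s : S) (sigma : {linear R l -> S}),
      [/\ genS (c - l) s, forall z, sigma (res_diff R l z) = 0 & sigma (rho 0%N) = s]].

(** The sign $(-1)^{l+1}$ makes the images of the new elements satisfy $d^2 = 0$, by $xy = yx$. The
    new cocycle is [psi] after the differential, where [psi] lifts [sigma] to $P(c-l)$; it takes
    values in the kernel $S(c-l-1, c-l)$. *)
Lemma lifted_step l rho : (l < c)%N -> @lifted l rho ->
  exists rho' : nat -> R l.+1, lifted rho' /\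
    forall i, res_diff R l (rho' i) = rho i ## y + rho i.+1 ## x ## ((-1) ^+ l.+1)%:A.
Proof.
move=> lc [rh rr rz [S [s [sigma [gs sc sE]]]]].
have rhs_below i :
    below c (i.*2 + l.+1) (rho i ## y + rho i.+1 ## x ## ((-1) ^+ l.+1)%:A).
  apply: (belowD); first by rewrite addnS; exact: (below_y zz).
  apply: belowZ; apply: (below_x zz); have := rh i.+1.
  by rewrite doubleS !addSn addnS.
have /choice[rho' rho'P] : forall i, exists z : R l.+1,
    [/\ res_diff R l z = rho i ## y + rho i.+1 ## x ## ((-1) ^+ l.+1)%:A,
        below c (i.*2 + l.+1) z & (r < i)%N -> z = 0].
  move=> i; case: (ltnP r i) => ri.
    exists 0; split => //; last exact: below0.
    by rewrite linear0 rr // (rr i.+1) ?act0 ?addr0 // ltnW.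
  have [z zE] := rz i; exists (comp_below c (i.*2 + l.+1) z); split => //; last first.
    exact: (below_comp zz).
  have /belowE := rhs_below i; rewrite -zE => <-.
  by rewrite /comp_below; case: ifP => _; rewrite ?linear0 ?lin_act.
exists rho'; split; last by move=> i; have [] := rho'P i.
split; first by move=> i; have [] := rho'P i.
- by move=> i; have [_ _] := rho'P i.
- move=> i; apply/(res_exS R l); rewrite linearD !lin_act.
  have [-> _ _] := rho'P i; have [-> _ _] := rho'P i.+1.
  rewrite !actDl !(act_kC _ _ y) !(act_kC _ _ x) (act_yy zz) (act_yx zz) (act_xx zz).
  by rewrite !act0 addr0 add0r (exprS _ l.+1) mulN1r act_kN subrr.
case: c lc rh rhs_below gs rho'P => // c' lc rh rhs_below gs rho'P.
have [cn _ _ _ _] := gs; rewrite subSn // in gs cn.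
have [P [t gt]] := exP (ltnW cn); have [S' [s' gs']] := exS (ltnW cn).
have [j [q [jI ex qS js' qt]]] := genPS_ses zz gs' gt gs.
have [psi psiE] := res_proj R l sigma qS.
have [sg sgE] : exists sg : {linear R l.+1 -> S'}, forall z, j (sg z) = psi (res_diff R l z).
  apply: (factor_inj (f := (psi \o res_diff R l : {linear R l.+1 -> P}))) => // z.
  by apply/ex; rewrite /= psiE sc.
exists S', s', sg; rewrite subSS; split => //.
  by move=> z; apply: jI; rewrite sgE linear0 (_ : res_diff R l _ = 0) ?linear0 //;
    apply/(res_exS R l); exists z.
apply: jI; rewrite sgE js'; have [-> _ _] := rho'P 0%N; rewrite linearD !lin_act.
have h0 : homog (c' - l).+1 (psi (rho 0%N)).
  rewrite -subSn //; apply: lin_hom; apply: below_homog; last exact: ltnW.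
  exact: (rh 0%N).
(* [rho 1] sits at $c - l - 2$, below the support of $P(c-l)$. *)
have -> : psi (rho 1%N) = 0.
  have h1 := lin_below zz psi (rh 1%N).
  case: (leqP (1.*2 + l) c'.+1) => lc1; last exact: (below_out h1 lc1).
  by apply: (genP_vanish zz gt (below_homog h1 lc1)); rewrite -muln2 in lc1 *; lia.
rewrite !act0 addr0; have [_ ht _ _] := gt.
(* Modulo the image of $y$ the element [psi (rho 0)] is [t], so that applying $y$ to it gives
   exactly $ty$. *)
have [c1 [c2 [c3 [c4 pE]]]] := genP_coef zz (psi (rho 0%N)) gt.
have := psiE (rho 0%N); rewrite sE pE !linearD !lin_act qt.
have [_ _ sy _ _] := gs; rewrite -!(act_yx zz) sy !act0 !addr0 => sE1.
have [] := genS_coef0 zz (c := c1 - 1) (d := c2) gs.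
  by rewrite act_kD act_kN act_k1 addrAC sE1 subrr.
move=> /eqP; rewrite subr_eq0 => /eqP -> c20.
rewrite c20 act_k0 addr0 !actDl act_k1 !(act_kC _ _ y) (act_yx zz) !(act_yy zz).
by rewrite !act0 !addr0.
Qed.

(** The elements cover the chain, whose relations say that the required combinations are killed by
    the augmentation. The cocycle comes from the map $F \to S(c, c+1)$ sending [u 0] to the
    generator, which exists because $u_0 x$ is not in the image of $y$. *)
Lemma lifted0 (F : fdMod A) (i : {linear F -> T}) (p : {linear T -> F}) (u : nat -> F)
  (S : fdMod A) (s : S) : cancel i p -> chain c r u -> genS c s ->
  exists rho : nat -> R 0%N, lifted rho.
Proof.
move=> ip [uh ur ux uw] gs.
have /choice[rho rhoP] : forall j, exists z : R 0%N,
    [/\ res_aug R z = i (u j), below c (j.*2 + 0) z & (r < j)%N -> z = 0].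
  move=> j; case: (ltnP r j) => rj.
    by exists 0; split => //; [rewrite ur // !linear0 | exact: below0].
  have [z zE] := res_aug_surj R (i (u j)); exists (comp_below c j.*2 z); split => //.
    have /belowE := lin_below zz i (uh j); rewrite -zE => <-.
    by rewrite /comp_below; case: ifP => _; rewrite ?linear0 ?lin_act.
  by rewrite addn0; exact: (below_comp zz).
exists rho; split.
- by move=> j; have [] := rhoP j.
- by move=> j; have [_ _] := rhoP j.
- move=> j; apply/(res_ex0 R); rewrite linearD !lin_act.
  have [-> _ _] := rhoP j; have [-> _ _] := rhoP j.+1.
  by rewrite -!(lin_act i) -linearD ux expr1 act_kN act_k1 subrr linear0.
have uc : homog c (u 0%N) by exact: (proj2 (below_hom _ _ _) (uh 0%N)).
have [g gE] := genS_comap_elt zz gs uc uw.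
exists S, s, (g \o (p \o res_aug R) : {linear R 0%N -> S}); split.
- by rewrite subn0.
- by move=> z /=; rewrite (_ : res_aug R _ = 0) ?linear0 //; apply/(res_ex0 R); exists z.
- by have [rE _ _] := rhoP 0%N; rewrite /= rE ip gE.
Qed.

Lemma lifted_exists l rho0 : (l <= c)%N -> @lifted 0 rho0 -> exists rho, @lifted l rho.
Proof.
move=> + h0; elim: l => [|l IH] lc; first by exists rho0.
have [rho rhoP] := IH (ltnW lc).
by have [rho' [rhoP' _]] := lifted_step lc rhoP; exists rho'.
Qed.

End Resolution.

Section Key.
Variables (T F : fdMod A) (i : {linear F -> T}) (p : {linear T -> F}).
Hypothesis ip : cancel i p.
Hypothesis pdT : finite_projective_dimension T.
Hypothesis extT : forall m, (0 < m)%N -> Ext_zero m T T.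

(* The value at t of a cochain bounding the image of the cocycle lifted from a *)
(* chain gives a new, partial chain ending in t modulo the image of y.         *)
Lemma chain_descends c r (u : nat -> F) m (t : F) : chain c r u -> (m < c)%N ->
  homog (c - m.+1) t -> t ## y = 0 ->
  exists eta : nat -> F,
    [/\ forall j, below c (j.*2 + m) (eta j), forall j, (r < j)%N -> eta j = 0
      & forall j, eta j ## y + eta j.+1 ## x ## ((-1) ^+ m.+1)%:A = if j == 0%N then t else 0].
Proof.
move=> ch mc ht ty; have [R _] := pdT; have [uh ur ux uw] := ch.
have uc : homog c (u 0%N) by exact: (proj2 (below_hom _ _ _) (uh 0%N)).
have cn : (c.+1 < n)%N.
  rewrite ltnNge; apply/negP => /(hom_last_x zz uc) ux0.
  by apply: (uw 0); rewrite ux0 act0.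
have [Sc [sc gsc]] := exS cn.
have [rho0 l0] := lifted0 R ip ch gsc.
have [rho lrho] := lifted_exists (ltnW mc) l0; have [rho' [lrho' rE]] := lifted_step mc lrho.
have [rh rr _ _] := lrho; have [rh' _ _ [S [s [sg [gs sc0 sE]]]]] := lrho'.
have [th thE] : exists th : {linear S -> T}, th s = i t.
  by apply: (genS_map zz gs); [exact: lin_hom | rewrite -lin_act ty linear0].
have [|h hE] := extT (ltn0Sn m) (R := R) (f := (th \o sg : {linear R m.+1 -> T})).
  by move=> z /=; rewrite sc0 linear0.
exists (fun j => p (h (rho j))); split.
- by move=> j; exact: (lin_below zz p (lin_below zz h (rh j))).
- by move=> j /rr ->; rewrite !linear0.
move=> j; rewrite -!(lin_act p) -linearD -!(lin_act h) -linearD -rE -hE /=.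
case: j => [|j]; first by rewrite sE thE ip.
(* These elements sit strictly below the support of the target $S(c-m-1, c-m)$. *)
suff -> : sg (rho' j.+1) = 0 by rewrite !linear0.
apply: (genS_below gs mc _ (lin_below zz sg (rh' j.+1))).
by rewrite doubleS; lia.
Qed.

(** Induction on the length, by looking at the last term, a $y$-cycle. If it lies in the image of
    $y$, it can be cut off after adjusting its neighbour; otherwise [chain_descends] provides a
    chain with one term fewer. *)
Lemma minimal_chain : (exists c r (u : nat -> F), chain c r u) ->
  exists c (u : nat -> F), chain c 0 u.
Proof.
move=> [c [r [u ch]]]; elim/ltn_ind: r c u ch => -[|r] IH c u ch; first by exists c, u.
have [uh ur ux uw] := ch.
case: (pselect (exists w, u r.+1 = w ## y)) => [[w wE]|nw].
  case: (leqP r.+1.*2 c) => rc; last first.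
    apply: (IH r _ c u) => //; split => // j; rewrite leq_eqVlt => /predU1P[<-|]; last exact: ur.
    exact: below_out (uh r.+1) rc.
  pose w' := comp_below c r.*2.+1 w.
  have w'E : w' ## y = u r.+1 by rewrite /w' (comp_below_y zz) -wE; exact: (uh r.+1).
  (* The element $w'x$ is killed by $x$, and $w'xy = w'yx = u_{r+1}x = u_r y$. So $u_r - w'x$ is a
     $y$-cycle with the same image under $x$ as $u_r$. *)
  pose u' j := if j == r then u r - w' ## x else if (j < r)%N then u j else 0.
  have u'x j : u' j ## x = if (j <= r)%N then u j ## x else 0.
    rewrite /u'; case: (ltngtP j r) => [jr|jr|->]; rewrite ?act0 //.
    by rewrite actBl (act_xx zz) subr0.
  have u'y j : u' j ## y = if (j < r)%N then u j ## y else 0.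
    rewrite /u'; case: (ltngtP j r) => [jr|jr|jr]; rewrite ?act0 //.
    by rewrite actBl -(act_yx zz) w'E ux subrr.
  apply: (IH r _ c u') => //; split.
  - move=> j; rewrite /u'; case: eqP => [->|_].
      by apply: belowB; [exact: uh | apply: (below_x zz); exact: (below_comp zz)].
    by case: ifP => _; [exact: uh | exact: below0].
  - by move=> j jr; rewrite /u'; case: ltngtP jr.
  - by move=> j; rewrite u'x u'y ux.
  - by move=> w0; rewrite u'x /=; exact: uw.
have rc : (r.*2.+1 < c)%N.
  rewrite ltnNge; apply/negP => rc; apply: nw; exists 0; rewrite act0.
  by apply: (below_out (uh r.+1)); rewrite doubleS; lia.
have ht : homog (c - r.*2.+2) (u r.+1) by rewrite -doubleS; apply: below_homog.
have [|eta [eh er eE]] := chain_descends ch rc ht; first by rewrite -ux ur ?act0.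
have {}eE j : eta j ## y + eta j.+1 ## x = if j == 0%N then u r.+1 else 0.
  by rewrite -eE -signr_odd /= negbK odd_double act_k1.
(* The term [eta 0] is dropped: $\eta_1 x = u_{r+1} - \eta_0 y$ is outside the image of $y$ because
   $u_{r+1}$ is. The new chain starts at the vertex $c - (2r+3)$ of $\eta_1$, and the alternating
   signs restore the zigzag relations. *)
apply: (IH r _ (c - r.*2.+3)%N (fun j => eta j.+1 ## ((-1) ^+ j)%:A)) => //; split.
- move=> j; apply: belowZ; apply: below_shift; have := eh j.+1.
  by congr (below _ _ _); rewrite doubleS; lia.
- by move=> j jr; rewrite er ?act0.
- move=> j; rewrite (act_kC _ _ x) (act_kC _ _ y) exprS mulN1r act_kN -act_kN.
  have /eqP := eE j.+1; rewrite addr_eq0 => /eqP ->.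
  by rewrite actNl act_kN.
- move=> w; rewrite expr0 act_k1 => wE; apply: nw; exists (eta 0%N + w).
  by rewrite actDl -wE; exact: (esym (eE 0%N)).
Qed.

End Key.

End SelfOrthogonal.

(** * Classification *)

Section OneSided.
Variables (k : fieldType) (A : algType k) (n : nat) (e : nat -> A) (x y : A).
Hypothesis zz : zigzag n e x y.
Local Notation homog := (homog e).
Local Notation genP := (genP e).
Local Notation genS := (genS n e x y).

Lemma genS_nonzero i (S : fdMod A) (s : S) : genS i s -> ~ is_zero S.
Proof. by move=> [_ _ _ sx _] S0; apply: sx; rewrite (S0 s) act0. Qed.

Lemma genS_act_y i (S : fdMod A) (s z : S) : genS i s -> z ## y = 0.
Proof.
move=> [_ _ sy _ sS]; have [c [d ->]] := sS z.
by rewrite actDl !(act_kC _ _ y) -(act_yx zz) sy !act0 addr0.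
Qed.

Lemma genS_not_acyclic i (S : fdMod A) (s : S) : genS i s -> ~ acyclic y S.
Proof.
move=> gs aS; have [_ _ sy sx _] := gs; have [w sE] := aS s sy.
by apply: sx; rewrite sE (genS_act_y w gs) act0.
Qed.

(** The component of [S] at the vertex $i$ is a line, so projecting the generator to one summand
    multiplies it by a scalar. This forces one of its two components to vanish, and the summand it
    would generate with it. *)
Lemma genS_indecomposable i (S : fdMod A) (s : S) : genS i s -> indecomposable S.
Proof.
move=> gs; split; first exact: genS_nonzero gs.
move=> X Y /isoE[f [g [fK gK]]]; have [_ hs _ _ sS] := gs; have hsx := hom_x zz hs.
pose z := g ((f s).1, 0).
have hz : homog i z.
  apply: lin_hom; have : f s ## e i = f s := lin_hom f hs; case: (f s) => a b [ha _] /=.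
  by change ((a ## e i, 0 ## e i) = (a, 0 : Y)); rewrite act0; congr pair.
have [c [d zE]] := sS z.
have {}zE : z = s ## c%:A.
  by rewrite -hz zE actDl !(act_kC _ _ (e i)) hs (hom_ne zz hsx) ?act0 ?addr0 //; lia.
have : f z = f s ## c%:A by rewrite zE lin_act.
rewrite /z gK; have fsx : f (s ## x) = f s ## x by exact: lin_act.
move: fsx; case fsE : (f s) => [a b] /= fsx.
have aE (u : A) : (a, b) ## u = (a ## u, b ## u) by [].
rewrite aE => -[ac bc]; case: (eqVneq c 0) => [c0|c0].
- left => u; have a0 : a = 0 by rewrite ac c0 act_k0.
  have [c' [d' gE]] := sS (g (u, 0)).
  have := congr1 f gE; rewrite gK linearD !lin_act fsE !aE a0 !act0 => -[-> _].
  by rewrite add0r; exact: act0.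
- right => u; have b0 : b = 0 by case: (act_kI (esym bc)) => // c00; rewrite c00 eqxx in c0.
  have [c' [d' gE]] := sS (g (0, u)).
  have := congr1 f gE; rewrite gK linearD !lin_act fsE !aE b0 !act0 => -[_ ->].
  by rewrite add0r; exact: act0.
Qed.

(** Upwards along the line: if nothing lives at $v-1$, an element at $v$ is killed by $y$, hence of
    the form $uy$, hence killed by $x$ since $xy = 0$, hence of the form $wx$ with $w$ at $v-1$. *)
Lemma acyclic_is_zero (F : rmodType A) : acyclic x F -> acyclic y F ->
  (forall m : F, m ## x ## y = 0) -> is_zero F.
Proof.
move=> ax ay xy0.
have step v : (forall m : F, m ## e v ## y = 0) -> (forall w : F, w ## x ## e v = 0) ->
    forall m : F, m ## e v = 0.
  move=> ey0 xe0 m; have [u uE] := ay _ (ey0 m).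
  have [|w wE] := ax (m ## e v); first by rewrite uE (act_yx zz) xy0.
  by rewrite -(hom_e zz v m) wE xe0.
move=> m; apply: (hom_sep zz) => v; elim: v m => [|v IH]; apply: step => m.
- by rewrite (hom0_y zz (hom_e zz 0%N m)).
- by rewrite (act_xe0 zz).
- by rewrite (act_ey zz) IH.
- by rewrite -(act_ex zz) IH act0.
Qed.

(** The element $e_0$ is a $y$-cycle, but $e_0 A e_1 y$ is spanned by $e_0 xy = 0$. *)
Lemma regular_not_acyclic : ~ acyclic y (regular_module A).
Proof.
move=> aA; have n2 := zz_size zz.
have [b bE] : exists b : A, e 0%N = b * y.
  have [|b bE] := aA (e 0%N : regular_module A); first exact: (zz_e0y zz).
  by exists b.
apply: (e_x_neq0 zz (v := 0)); first lia.
have [c1 [c2 [c3 [c4 eb]]]] := zz_span zz b 0%N.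
have xyE : e 0%N * x * y = 0 by rewrite -mulrA (zz_xy zz) mulrA (zz_e0y zz) mul0r.
have e0be1 : e 0%N * b * e 1%N = c2 *: (e 0%N * x).
  rewrite eb xyE (zz_e0y zz) !scaler0 !addr0 mulrDl -!scalerAl (zz_ee zz) scaler0 add0r.
  by rewrite (zz_ex zz) -mulrA (zz_ee zz).
have -> : e 0%N = e 0%N * b * e 1%N * y.
  have E : e 0%N * e 0%N = e 0%N by rewrite (zz_ee zz).
  by rewrite -mulrA (zz_ey zz) mulrA -(mulrA _ b) -bE !E.
by rewrite e0be1 -scalerAl xyE scaler0 mul0r.
Qed.

Section Tilting.
Variable T : fdMod A.
Hypothesis exP : forall v, (v < n)%N -> exists (P : fdMod A) (t : P), genP v t.
Hypothesis exS : forall v, (v.+1 < n)%N -> exists (S : fdMod A) (s : S), genS v s.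
Hypothesis pdT : finite_projective_dimension T.
Hypothesis extT : forall m, (0 < m)%N -> Ext_zero m T T.

Lemma summand_genS (F : fdMod A) : indecomposable F -> retract F T -> ~ acyclic y F ->
  exists i (S : fdMod A) (s : S), genS i s /\ iso F S.
Proof.
move=> indF FT ay; have [i [p ip]] := FT.
have aD : acyclic (delta n e x y) F.
  apply: (acyclic_retract FT).
  exact: (finpd_acyclic (delta_sq zz) (fin_dim_zz zz) (acyclic_delta zz) pdT).
have [c [u [uh ur ux uw]]] :=
  minimal_chain zz exP exS ip pdT extT (chain_exists zz aD ay).
have uc := proj2 (below_hom _ _ _) (uh 0%N).
have cn : (c.+1 < n)%N.
  rewrite ltnNge; apply/negP => /(hom_last_x zz uc) ux0.
  by apply: (uw 0); rewrite ux0 act0.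
have [S [s gs]] := exS cn; exists c, S, s; split => //.
apply: indecomposable_retract (genS_nonzero gs) _ => //.
by apply: (genS_retract zz gs uc); rewrite // -ux ur // act0.
Qed.

(** For $i < i'$ the generator of $S(i', i'+1)$ is a chain with one term. Descending from it to the
    generator of $S(i, i+1)$ would put the latter into the image of $y$, while $y$ is zero on $S(i,
    i+1)$. *)
Lemma genS_unique i i' (S S' : fdMod A) (s : S) (s' : S') : genS i s -> genS i' s' ->
  retract S T -> retract S' T -> i = i'.
Proof.
wlog lt : i i' S S' s s' / (i < i')%N.
  move=> H gs gs' ST ST'; case: (ltngtP i i') => // lt; first exact: H gs gs' ST ST'.
  by apply/esym; exact: H gs' gs ST' ST.
move=> gs gs' [j [p jp]] [j' [p' jp']]; exfalso.
have [_ hs sy sx _] := gs; have [_ hs' sy' sx' _] := gs'.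
have idT : cancel (idfun : {linear T -> T}) (idfun : {linear T -> T}) by [].
have ch : chain e x y i' 0 (fun l => if l is 0 then j' s' else 0).
  split.
  - case=> [|l]; last exact: below0.
    by apply: (proj1 (below_hom _ _ _)); exact: lin_hom.
  - by case.
  - by case=> [|l]; rewrite ?act0 // -lin_act sy' linear0.
  - move=> w /(congr1 p'); rewrite -lin_act jp' lin_act (genS_act_y _ gs').
    exact: sx'.
have := chain_descends zz exP exS idT pdT extT (m := (i' - i).-1) (t := j s) ch.
case; first lia.
- by rewrite (_ : (i' - (i' - i).-1.+1)%N = i); [exact: lin_hom | lia].
- by rewrite -lin_act sy linear0.
move=> eta [_ er /(_ 0%N)]; rewrite (er 1%N) // !act0 addr0 => /(congr1 p).
rewrite jp lin_act (genS_act_y _ gs) => s0.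
by apply: sx; rewrite -s0 act0.
Qed.

End Tilting.

Lemma coresolved_summand_y (T : fdMod A) (m : nat) (F : 'I_m -> fdMod A) :
  finite_add_coresolution T -> iso T (dsum [seq F a | a <- enum 'I_m]) ->
  exists a, ~ acyclic y (F a).
Proof.
move=> coT isoT; apply: contrapT => noF; apply: regular_not_acyclic.
apply: (add_coresolved_acyclic (zz_yy zz) _ coT).
apply: (acyclic_retract (retract_iso isoT)); apply: acyclic_dsum => a.
rewrite size_map size_enum_ord => am; rewrite (nth_map (Ordinal am)) ?size_enum_ord //.
by apply: contrapT => na; apply: noF; exists (nth (Ordinal am) (enum 'I_m) a).
Qed.

(** The embedding of the regular module into an object of add T preserves $e_v xy \neq 0$;
    projecting to a suitable copy of T and then to a suitable summand keeps it nonzero, and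
    [genP_retract] applies there. *)
Lemma coresolved_summand_P (T : fdMod A) (m : nat) (F : 'I_m -> fdMod A) v (P : fdMod A)
  (t : P) : finite_add_coresolution T -> iso T (dsum [seq F a | a <- enum 'I_m]) ->
  genP v t -> (0 < v)%N -> (v.+1 < n)%N -> exists a, retract P (F a).
Proof.
move=> [l [K [eta [d [Kadd _ etaI _ _]]]]] isoT gt v0 vn.
have comp (s : seq (fdMod A)) (w : dsum s) : homog v w -> w ## x ## y <> 0 ->
    exists i (z : nth (zero_mod A) s i), [/\ (i < size s)%N, homog v z & z ## x ## y <> 0].
  move=> hw /dsum_separated[i [p [lt pw]]]; exists i, (p w); split => //.
    exact: lin_hom.
  by rewrite -!lin_act.
pose r : regular_module A := e v.
have hr : homog v r by exact: (hom_regular zz).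
have rxy : r ## x ## y <> 0 by exact: (zz_inner zz).
have [b [N isoN]] := Kadd 0%N.
have [i0 [p0 ip0]] := retract_trans (retract_prodl _ _) (retract_iso (iso_sym isoN)).
have [||j [z [lt hz zxy]]] := comp (nseq b T) (i0 (eta r)).
- by do 2 apply: lin_hom.
- rewrite -!lin_act => E; apply: rxy; apply: etaI; apply: (can_inj ip0).
  by rewrite E !linear0.
move: z hz zxy; rewrite size_nseq in lt; rewrite nth_nseq lt => z hz zxy.
have [f [g [fK _]]] := isoE isoT.
have [||a [w [am hw wxy]]] := comp _ (f z).
- exact: lin_hom.
- by rewrite -!lin_act => E; apply: zxy; apply: (can_inj fK); rewrite E linear0.
rewrite size_map size_enum_ord in am.
move: w hw wxy; rewrite (nth_map (Ordinal am)) ?size_enum_ord // => w hw wxy.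
by eexists; exact: (genP_retract zz gt hw wxy).
Qed.

End OneSided.

(** * Both directions for an abstract zigzag algebra *)

Section Classification.
Variables (k : fieldType) (A : algType k) (n : nat) (e : nat -> A) (x y : A).
Hypothesis zz : zigzag n e x y.
Let zz' := zigzag_rev zz.
Local Notation e' := (rev_idem n e).
Variables (P : 'I_n -> fdMod A) (S N : 'I_n.-1 -> fdMod A).
Hypothesis gP : forall v : 'I_n, exists t : P v, genP e v t.
Hypothesis gS : forall i : 'I_n.-1, exists s : S i, genS n e x y i s.
(** The top of $N(j, j+1)$ sits at the upper vertex of the edge, which has number $n - 2 - j$ on the
    reversed line when counted from 0. *)
Hypothesis gN : forall j : 'I_n.-1, exists s : N j, genS n e' y x (n.-2 - j)%N s.
Hypothesis P_indec : forall v, indecomposable (P v).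

Lemma genP_rev v (M : fdMod A) (t : M) : (v < n)%N -> genP e (n.-1 - v)%N t -> genP e' v t.
Proof. by move=> vn; rewrite /genP /homog /rev_idem vn. Qed.

Lemma exP v : (v < n)%N -> exists (M : fdMod A) (t : M), genP e v t.
Proof. by move=> vn; have [t gt] := gP (Ordinal vn); exists (P (Ordinal vn)), t. Qed.

Lemma exP' v : (v < n)%N -> exists (M : fdMod A) (t : M), genP e' v t.
Proof.
move=> vn; have [|M [t gt]] := @exP (n.-1 - v)%N; first lia.
by exists M, t; exact: genP_rev.
Qed.

Lemma exS v : (v.+1 < n)%N -> exists (M : fdMod A) (s : M), genS n e x y v s.
Proof.
move=> vn; have vn1 : (v < n.-1)%N by lia.
by have [s gs] := gS (Ordinal vn1); exists (S (Ordinal vn1)), s.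
Qed.

Lemma exS' v : (v.+1 < n)%N -> exists (M : fdMod A) (s : M), genS n e' y x v s.
Proof.
move=> vn; have vn1 : (n.-2 - v < n.-1)%N by lia.
have [s gs] := gN (Ordinal vn1); exists (N (Ordinal vn1)), s; move: gs => /=.
by rewrite (_ : n.-2 - (n.-2 - v) = v)%N //; lia.
Qed.

Lemma genP_vertex v w (M : fdMod A) (t p : M) : genP e v t -> homog e w p ->
  p ## x ## y <> 0 -> v = w.
Proof.
move=> gt hp pxy; apply/eqP; apply: contrapT => /negP vw; apply: pxy.
have hxy : homog e w (p ## x ## y) by apply: (hom_y zz); exact: (hom_x zz).
have [_ ht _ _] := gt; have htxy := hom_y zz (hom_x zz ht).
have [c1 [c2 [c3 [c4 pE]]]] := genP_coef zz p gt.
rewrite -hxy pE !actDl !(act_kC _ _ x) !(act_kC _ _ y) !(act_xx zz) !(act_yx zz) !(act_xx zz).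
rewrite !(act0, act_yy zz) !(addr0, add0r) (act_kC _ _ (e w)) (hom_ne zz htxy vw).
by rewrite act0.
Qed.

Lemma rev_act_x i (M : fdMod A) (s z : M) : genS n e' y x i s -> z ## x = 0.
Proof. exact: (genS_act_y zz'). Qed.

(** One duplicate-free list of indices for all summands, so that comparing two decompositions
    becomes a permutation of lists. *)
Definition inner : seq ('I_n + bool) :=
  [seq inl v | v : 'I_n <- enum 'I_n & (0 < v < n.-1)%N] ++ [:: inr true; inr false].
Definition summand (i j : 'I_n.-1) (g : 'I_n + bool) : fdMod A :=
  match g with inl v => P v | inr b => if b then S i else N j end.

Lemma summand_inner i j :
  [seq P v | v : 'I_n <- enum 'I_n & (0 < v < n.-1)%N] ++ [:: S i; N j]
  = map (summand i j) inner.
Proof. by rewrite /inner map_cat -map_comp. Qed.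

Lemma mem_inner g : (g \in inner) = if g is inl v then (0 < v < n.-1)%N else true.
Proof.
rewrite /inner mem_cat; case: g => [v|b].
  rewrite orbC !inE /= (mem_map (@inl_inj _ _)) mem_filter mem_enum andbT.
  by [].
by rewrite !inE; case: b; rewrite ?orbT.
Qed.

Lemma uniq_inner : uniq inner.
Proof.
rewrite /inner cat_uniq; apply/and3P; split => //.
  by rewrite map_inj_uniq; [apply: filter_uniq; exact: enum_uniq | move=> u v []].
by apply/hasPn => g; rewrite !inE => /orP[]/eqP->; apply/mapP => -[].
Qed.

(** The invariants: $xy$ vanishes on S and N but not on an inner projective, where it determines the
    vertex; N is $y$-acyclic and S is not. *)
Lemma summand_inj i j g g' : g \in inner -> g' \in inner ->
  iso (summand i j g) (summand i j g') -> g = g'.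
Proof.
have [s gs] := gS i; have [r gr] := gN j.
have Sxy (z : S i) : z ## x ## y = 0 by exact: (genS_act_y zz _ gs).
have Nxy (z : N j) : z ## x ## y = 0 by rewrite (rev_act_x z gr) act0.
have NSiso : ~ iso (S i) (N j).
  move=> /retract_iso SN; apply: (genS_not_acyclic zz gs).
  exact: acyclic_retract SN (genS_acyclic_x zz' gr).
have Pn v (M : fdMod A) : inl v \in inner -> (forall z : M, z ## x ## y = 0) -> ~ iso (P v) M.
  rewrite mem_inner => /andP[v0 vn] M0 /isoE[f [h [fK _]]]; have [t gt] := gP v.
  apply: (genP_xy zz gt); [by [] | by lia|].
  by apply: (can_inj fK); rewrite !lin_act M0 linear0.
case: g g' => [v|[]] [v'|[]] gi gi' //= h; first 1 last.
- by case: (Pn _ _ gi Sxy h).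
- by case: (Pn _ _ gi Nxy h).
- by case: (Pn _ _ gi' Sxy (iso_sym h)).
- by case: (Pn _ _ gi' Nxy (iso_sym h)).
- by case: (NSiso (iso_sym h)).
move: gi gi'; rewrite !mem_inner => /andP[v0 vn] _.
have [t gt] := gP v; have [t' gt'] := gP v'; have [f [l [fK _]]] := isoE h.
have [_ ht _ _] := gt.
congr inl; apply/val_inj; apply/esym; apply: (genP_vertex gt' (lin_hom f ht)) => E.
apply: (genP_xy zz gt); [by [] | by lia|].
by apply: (can_inj fK); rewrite !lin_act E linear0.
Qed.

Section Converse.
Variables (i j : 'I_n.-1) (T : fdMod A).
Hypothesis isoT : iso T (dsum (map (summand i j) inner)).
Local Notation D := (dsum_mod (map (summand i j) inner)).

Lemma summand_all (Q : fdMod A -> Prop) :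
  (forall g, g \in inner -> Q (summand i j g)) ->
  forall a, (a < size (map (summand i j) inner))%N ->
  Q (nth (zero_mod A) (map (summand i j) inner) a).
Proof.
move=> H a; rewrite size_map => an; rewrite (nth_map (inr true)) //.
by apply: H; exact: mem_nth.
Qed.

Lemma retract_summand g : g \in inner -> retract (summand i j g) T.
Proof.
move=> gi; apply: retract_trans (retract_iso (iso_sym isoT)).
have := @retract_dsum k A (map (summand i j) inner) (index g inner).
by rewrite size_map index_mem gi (nth_map (inr true)) ?index_mem // nth_index // => /(_ isT).
Qed.

Lemma basic_dsum : basic T.
Proof.
exists (size inner), (fun a => summand i j (nth (inr true) inner a)); split.
- move=> a; case: (nth _ _ _) => [v|[]] /=; first exact: P_indec.
    by have [s gs] := gS i; exact: (genS_indecomposable zz gs).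
  by have [s gs] := gN j; exact: (genS_indecomposable zz' gs).
- move=> a b /summand_inj E; apply/val_inj/eqP.
  rewrite -(nth_uniq (inr true) (ltn_ord a) (ltn_ord b) uniq_inner).
  by apply/eqP/E; exact: mem_nth.
- apply: iso_trans isoT _.
  rewrite (map_comp (summand i j) (fun a : 'I__ => nth (inr true) inner a)).
  rewrite (map_comp (nth (inr true) inner) val) val_enum_ord map_nth_iota0 // take_size.
  exact: iso_refl.
Qed.

Lemma finpd_dsum : finite_projective_dimension T.
Proof.
apply: (finpd_iso (X := D)); first exact: iso_sym.
apply: dsum_mod_all; [exact: finpd_zero | exact: finpd_prod |].
apply: summand_all => -[v|[]] _ /=.
- by have [t gt] := gP v; apply: finpd_projective; case: gt.
- by have [s gs] := gS i; exact: (genS_finpd zz exP exS gs).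
- by have [s gs] := gN j; exact: (genS_finpd zz' exP' exS' gs).
Qed.

(** For S only $y$-homology below the vertex $i$ matters: inner projectives and N have none, and S
    itself is zero there. N is the mirror image. *)
Lemma ext_summand m g g' : g \in inner -> g' \in inner ->
  ext_vanishes m.+1 (summand i j g) (summand i j g').
Proof.
move=> gi gi'; have [s gs] := gS i; have [r gr] := gN j.
case: g gi => [v|[]] gi /=.
- by have [t gt] := gP v; apply: ext_vanishes_projective; case: gt.
- apply: (genS_ext_vanishes zz exP exS m gs) => w wi.
  case: g' gi' => [v'|[]] gi' /= z hz zy.
  + have [t gt] := gP v'; move: gi'; rewrite mem_inner => /andP[v0 vn].
    by apply: (genP_acyclic_y zz gt) => //; lia.
  + by exists 0; rewrite act0; exact: (genS_hom_lt zz gs hz wi).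
  + exact: (genS_acyclic_x zz' gr).
- apply: (genS_ext_vanishes zz' exP' exS' m gr) => w wi.
  case: g' gi' => [v'|[]] gi' /= z hz zx.
  + have [t gt] := gP v'; move: gi'; rewrite mem_inner => /andP[v0 vn].
    have gt' : genP e' (n.-1 - v')%N t.
      apply: genP_rev; first by lia.
      by rewrite (_ : n.-1 - (n.-1 - v') = v')%N //; lia.
    by apply: (genP_acyclic_y zz' gt') => //; lia.
  + exact: (genS_acyclic_x zz gs).
  + by exists 0; rewrite act0; exact: (genS_hom_lt zz' gr hz wi).
Qed.

Lemma Ext_zero_dsum m : (0 < m)%N -> Ext_zero m T T.
Proof.
case: m => // m _; have TD : retract T D by exact: retract_iso.
apply: (Ext_zero_retractr TD); apply: dsum_mod_all.
- by move=> R f _; have [z zE] := zero_lin (R m) (zero_mod A); exists z => u;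
    rewrite zE (is_zero_zero_mod (f u)).
- by move=> M M'; exact: Ext_zero_prodr.
apply: summand_all => g' gi'; apply: (Ext_zero_retract TD).
apply: (@dsum_mod_all k A (fun X => ext_vanishes m.+1 X (summand i j g'))).
- by apply: ext_vanishes_projective; exact: projective_zero_mod.
- by move=> M M'; exact: ext_vanishes_prod.
apply: (@summand_all (fun X => ext_vanishes m.+1 X (summand i j g'))) => g gi.
exact: ext_summand.
Qed.

(** The inner projectives are summands of T. The projective at the vertex 0 is the first module S,
    coresolved by inner projectives up to $S(i, i+1)$; the last vertex is the mirror image. *)
Lemma coresolved_P v : add_coresolved T (P v).
Proof.
have n2 := zz_size zz; have [t gt] := gP v.
have innP (w : 'I_n) : (0 < w < n.-1)%N -> retract (P w) T.
  by move=> w0; apply: (@retract_summand (inl w)); rewrite mem_inner.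
have [v0|v0] := posnP v.
  have [|S0 [s0 gs0]] := @exS 0%N; first by lia.
  have [s gs] := gS i; rewrite v0 in gt.
  apply: add_coresolved_iso (genS0_iso zz gs0 gt) _.
  apply: (genS_coresolved zz exS gs _ _ (leq0n i) gs0).
    by apply: (@retract_summand (inr true)); rewrite mem_inner.
  move=> w w0 wn; have [t' gt'] := gP (Ordinal (ltnW wn)).
  by exists (P (Ordinal (ltnW wn))), t'; split => //; apply: innP => /=; lia.
have [vn|vn] := ltnP v n.-1.
  by apply: add_coresolved_add; apply: retract_in_add; apply: innP; rewrite v0.
have vE : (v = n.-1 :> nat) by have := ltn_ord v; lia.
have [|S0 [s0 gs0]] := @exS' 0%N; first by lia.
have [s gs] := gN j.
have gt' : genP e' 0 t by apply: genP_rev; [lia | rewrite subn0 -vE].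
apply: add_coresolved_iso (genS0_iso zz' gs0 gt') _.
apply: (genS_coresolved zz' exS' gs _ _ (leq0n _) gs0).
  by apply: (@retract_summand (inr false)); rewrite mem_inner.
move=> w w0 wn; have wn' : (n.-1 - w < n)%N by lia.
have [t' gt''] := gP (Ordinal wn'); exists (P (Ordinal wn')), t'; split.
  by apply: genP_rev => //; exact: ltnW.
by apply: innP => /=; lia.
Qed.

Lemma regular_dsum : iso (dsum [seq P v | v <- enum 'I_n]) (regular_module A).
Proof.
(* The induction over the vertices needs the image of a partial sum: the elements fixed by left
   multiplication with the sum of the idempotents already used. *)
have [f [fI fS]] : exists f : {linear dsum [seq P v | v <- enum 'I_n] -> regular_module A},
    (forall q, f q = 0 -> q = 0) /\
    forall a : A, (exists q, f q = a) <-> a = \sum_(v <- enum 'I_n) e (v : 'I_n) * a.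
  elim: (enum 'I_n) (enum_uniq 'I_n) => [_|v r IH /= /andP[vr ur]].
    have [z zE] := zero_lin (dsum [seq P v | v <- [::]]) (regular_module A); exists z.
    split=> [q _|a]; first exact: is_zero_zero_mod.
    rewrite big_nil; split=> [[q <-]|->]; first by rewrite zE.
    by exists 0; rewrite zE.
  have [f [fI fS]] := IH ur; have [t gt] := gP v; have [_ ht tP tfree] := gt.
  have [g gtE] := genP_map gt (hom_regular zz v); have [c cE] := copair_lin g f.
  have gE a : g (t ## a) = e v * a :> A by rewrite lin_act gtE.
  have ev_sum (a : A) : e v * \sum_(w <- r) e (w : 'I_n) * a = 0.
    rewrite mulr_sumr big_seq big1 // => w wr; rewrite mulrA (zz_ee zz) ifN ?mul0r //.
    by apply: contra vr => /eqP vw; rewrite (_ : v = w) //; exact: val_inj.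
  have evf q : e v * (f q : A) = 0.
    by have /fS -> : exists q', f q' = f q; [exists q | exact: ev_sum].
  have evg q : e v * (g q : A) = g q.
    by have [a ->] := tP q; rewrite gE mulrA (zz_ee zz) eqxx.
  have ev_r w (a : A) : w \in r -> e (w : 'I_n) * (e v * a) = 0.
    move=> wr; rewrite mulrA (zz_ee zz) ifN ?mul0r //.
    by apply: contra vr => /eqP vw; rewrite (_ : v = w) //; exact/esym/val_inj.
  exists c; split=> [[q q'] |a].
    rewrite cE /= => E.
    have gq0 : g q = 0.
      have : e v * (g q + f q' : A) = 0 by rewrite E mulr0.
      by rewrite mulrDr evf addr0 evg.
    have -> : q = 0.
      have [a qE] := tP q; move: gq0; rewrite qE gE => ea0.
      by rewrite -ht actA ea0 act_r0.
    by have -> : q' = 0 by apply: fI; rewrite -E gq0 add0r.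
  rewrite big_cons; split=> [[[q q'] <-]|E].
    rewrite cE /= mulrDr evf addr0 evg; congr (_ + _).
    have /fS {1}-> : exists q'', f q'' = f q' by exists q'.
    rewrite big_seq [RHS]big_seq; apply: eq_bigr => w wr.
    by rewrite mulrDr -(evg q) ev_r // add0r.
  have e_sum w : w \in r -> e (w : 'I_n) * (\sum_(u <- r) e (u : 'I_n) * a) = e (w : 'I_n) * a.
    move=> wr; rewrite (bigD1_seq w) // mulrDr mulr_sumr big1 ?addr0 => [|u uw].
      by rewrite mulrA (zz_ee zz) eqxx.
    rewrite mulrA (zz_ee zz) ifN ?mul0r //; apply: contra uw => /eqP uw.
    by apply/eqP/esym/val_inj.
  have /fS[q' q'E] : \sum_(w <- r) e (w : 'I_n) * a =
      \sum_(w <- r) e (w : 'I_n) * (\sum_(u <- r) e (u : 'I_n) * a) :> A.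
    by rewrite [LHS]big_seq [RHS]big_seq; apply: eq_bigr => w wr; rewrite e_sum.
  by exists (t ## a, q'); rewrite cE /= q'E gE.
apply: (isoI (f := f)) => [q q' fq|a].
  apply/eqP; rewrite -subr_eq0; apply/eqP; apply: fI.
  by rewrite linearB fq subrr.
by apply/fS; rewrite -mulr_suml big_enum (zz_sum zz) mul1r.
Qed.

Lemma tilting_dsum : generalized_tilting T.
Proof.
split; [exact: finpd_dsum | exact: Ext_zero_dsum |].
apply: add_coresolved_iso regular_dsum _.
elim: (enum 'I_n) => [|v r IH]; first exact: add_coresolved_zero (@is_zero_zero_mod k A).
exact: add_coresolved_prod (coresolved_P v) IH.
Qed.

End Converse.

Lemma tilting_classification (T : fdMod A) : basic T -> generalized_tilting T ->
  exists i j : 'I_n.-1, iso T (dsum (map (summand i j) inner)).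
Proof.
move=> [m [F [indF injF isoT]]] [pdT extT coT]; have n2 := zz_size zz.
have FT a : retract (F a) T.
  apply: retract_trans (retract_iso (iso_sym isoT)).
  have := @retract_dsum k A [seq F b | b <- enum 'I_m] a.
  by rewrite size_map size_enum_ord (nth_map a) ?size_enum_ord // nth_ord_enum => /(_ (ltn_ord a)).
have [a0 ay0] := coresolved_summand_y zz coT isoT.
have [b0 bx0] := coresolved_summand_y zz' coT isoT.
have typeS a : ~ acyclic y (F a) -> exists i, iso (F a) (S i).
  move=> ay; have [v [M [s [gs iM]]]] := summand_genS zz exP exS pdT extT (indF a) (FT a) ay.
  have [vn _ _ _ _] := gs; have vn1 : (v < n.-1)%N by lia.
  have [s' gs'] := gS (Ordinal vn1); exists (Ordinal vn1).
  exact: iso_trans iM (genS_iso zz gs gs').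
have typeN a : ~ acyclic x (F a) -> exists j, iso (F a) (N j).
  move=> ay; have [v [M [s [gs iM]]]] := summand_genS zz' exP' exS' pdT extT (indF a) (FT a) ay.
  have [vn _ _ _ _] := gs; have vn1 : (n.-2 - v < n.-1)%N by lia.
  have [s' gs'] := gN (Ordinal vn1); exists (Ordinal vn1).
  move: gs'; rewrite /= (_ : n.-2 - (n.-2 - v) = v)%N; last by lia.
  by move=> gs'; exact: iso_trans iM (genS_iso zz' gs gs').
have [i Fi] := typeS _ ay0; have [j Fj] := typeN _ bx0.
exists i, j.
have uniqS i' a : iso (F a) (S i') -> i' = i.
  move=> Fa; have [s gs] := gS i; have [s' gs'] := gS i'; apply: val_inj.
  apply: (genS_unique zz exP exS pdT extT gs' gs).
    exact: retract_trans (retract_iso (iso_sym Fa)) (FT a).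
  exact: retract_trans (retract_iso (iso_sym Fi)) (FT a0).
have uniqN j' a : iso (F a) (N j') -> j' = j.
  move=> Fa; have [s gs] := gN j; have [s' gs'] := gN j'; apply: ord_inj.
  suff : (n.-2 - j' = n.-2 - j)%N by have := ltn_ord j; have := ltn_ord j'; lia.
  apply: (genS_unique zz' exP' exS' pdT extT gs' gs).
    exact: retract_trans (retract_iso (iso_sym Fa)) (FT a).
  exact: retract_trans (retract_iso (iso_sym Fj)) (FT b0).
have cover a : exists2 g, g \in inner & iso (F a) (summand i j g).
  case: (pselect (acyclic y (F a))) => [ay|/typeS[i' Fa]]; last first.
    by exists (inr true); rewrite ?mem_inner // /= -(uniqS _ _ Fa).
  case: (pselect (acyclic x (F a))) => [ax|/typeN[j' Fa]]; last first.
    by exists (inr false); rewrite ?mem_inner // /= -(uniqN _ _ Fa).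
  case: (pselect (exists v (w : F a), (v < n)%N /\ (w ## e v) ## x ## y <> 0)); last first.
    move=> no; have [Fn0 _] := indF a; case: Fn0.
    apply: (acyclic_is_zero zz ax ay) => w; rewrite [w](hom_sum zz) !act_suml big1 // => v _.
    by apply: contrapT => wv; apply: no; exists v, w.
  move=> [v [w [vn wxy]]].
  have v0 : (0 < v)%N.
    rewrite lt0n; apply/eqP => v0; apply: wxy; rewrite -(act_yx zz) v0.
    by rewrite (hom0_y zz (hom_e zz 0%N w)) act0.
  have vn1 : (v < n.-1)%N.
    rewrite ltnNge; apply/negP => nv; apply: wxy.
    by rewrite (hom_last_x zz (hom_e zz v w)) ?act0 //; lia.
  exists (inl (Ordinal vn)); first by rewrite mem_inner /= v0.
  have [t gt] := gP (Ordinal vn); have [P0 _] := P_indec (Ordinal vn).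
  exact: indecomposable_retract (indF a) P0 (genP_retract zz gt (hom_e zz v w) wxy).
have occur g : g \in inner -> exists a, iso (summand i j g) (F a).
  rewrite mem_inner; case: g => [v|[]] /=; last first.
  - by exists b0; exact: iso_sym.
  - by exists a0; exact: iso_sym.
  move=> /andP[v0 vn]; have [t gt] := gP v.
  have [|a Pa] := coresolved_summand_P zz coT isoT gt v0; first by lia.
  have [P0 _] := P_indec v.
  by exists a; apply: iso_sym; exact: indecomposable_retract (indF a) P0 Pa.
have /choice[h hP] : forall g, exists a, g \in inner -> iso (summand i j g) (F a).
  move=> g; case: (boolP (g \in inner)) => gi; last by exists a0.
  by have [a ga] := occur g gi; exists a.
(* [h] sends each listed type to a summand of T of that type. It is onto by [cover] together with
   basicness, and injective because the listed modules are pairwise non-isomorphic. *)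
have pe : perm_eq [seq h g | g <- inner] (enum 'I_m).
  apply: uniq_perm; last first.
  - move=> a; rewrite mem_enum; apply/mapP; have [g gi Fa] := cover a; exists g => //.
    by apply: injF; exact: iso_trans Fa (hP g gi).
  - exact: enum_uniq.
  rewrite map_inj_in_uniq; first exact: uniq_inner.
  move=> g g' gi gi' hh; apply: (summand_inj gi gi').
  by apply: iso_trans (hP g gi) _; rewrite hh; exact: iso_sym (hP g' gi').
apply: iso_trans isoT _; apply: iso_trans (iso_sym (dsum_perm F pe)) _.
by rewrite -map_comp; apply: dsum_map_iso => g gi; exact: iso_sym (hP g gi).
Qed.

End Classification.

(** * Recognising simple modules, their covers and uniserial modules *)

Section Recognition.
Variables (k : fieldType) (A : algType k) (n : nat) (e : nat -> A) (x y : A).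
Hypothesis zz : zigzag n e x y.
Local Notation homog := (homog e).
Local Notation genP := (genP e).
Local Notation genS := (genS n e x y).

Definition genL v (L : fdMod A) (z : L) : Prop :=
  [/\ homog v z, z <> 0 & forall w, exists c : k, w = z ## c%:A].

Lemma submoduleP (M : fdMod A) (U : M -> Prop) :
  U 0 -> (forall m m', U m -> U m' -> U (m + m')) ->
  (forall m (c : k), U m -> U (m ## c%:A)) -> (forall m v, U m -> U (m ## e v)) ->
  (forall m, U m -> U (m ## x)) -> (forall m, U m -> U (m ## y)) ->
  submodule (fun m => `[< U m >]).
Proof.
move=> U0 UD Uc Ue Ux Uy; split=> [|a u w /asboolP Uu /asboolP Uw]; apply/asboolP => //.
apply: (UD) => //; rewrite -[a *: u]/(u ## a) [u](hom_sum zz) act_suml.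
apply: (big_ind U) => [||v _]; [exact: U0 | exact: UD |].
have [c1 [c2 [c3 [c4 ea]]]] := zz_span zz a v.
rewrite (hom_act (hom_e zz v u) ea); have Uv := Ue u v Uu.
by repeat apply: (UD); apply: (Uc); auto.
Qed.

Lemma cyclic_submodule (M : fdMod A) (s : M) : submodule (fun m : M => `[< exists a, m = s ## a >]).
Proof.
split=> [|a _ _ /asboolP[b ->] /asboolP[c ->]]; apply/asboolP.
  by exists 0; rewrite act_r0.
by exists (b * a + c); rewrite actDr -actA.
Qed.

Lemma line_submodule v (M : fdMod A) (s : M) : homog v s -> s ## x = 0 -> s ## y = 0 ->
  submodule (fun m : M => `[< exists c : k, m = s ## c%:A >]).
Proof.
move=> hs sx sy; apply: submoduleP.
- by exists 0; rewrite act_k0.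
- by move=> _ _ [c ->] [d ->]; exists (c + d); rewrite act_kD.
- by move=> _ d [c ->]; exists (c * d); rewrite act_kM.
- move=> _ w [c ->]; case: (eqVneq v w) => [<-|vw].
    by exists c; rewrite act_kC hs.
  by exists 0; rewrite act_kC (hom_ne zz hs vw) act0 act_k0.
- by move=> _ [c ->]; exists 0; rewrite act_kC sx act0 act_k0.
- by move=> _ [c ->]; exists 0; rewrite act_kC sy act0 act_k0.
Qed.

Lemma simple_genL v (L : fdMod A) : simple L -> (exists z : L, z ## e v <> 0) ->
  exists z : L, genL v z.
Proof.
move=> [_ _ simL] [z0 z0e].
(* Either $Lu = 0$, or every element lies in $Lu$ and is killed by $u$ because $u^2 = 0$. *)
have nilp (u : A) : u * u = 0 -> submodule (fun m : L => `[< exists w, m = w ## u >]) ->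
    forall w : L, w ## u = 0.
  move=> uu subU w; case: (simL _ subU) => // [H|H]; first by apply: H; apply/asboolP; exists w.
  have /asboolP[w1 ->] := H w isT.
  by rewrite actA uu act_r0.
have Lx : forall w : L, w ## x = 0.
  apply: nilp (zz_xx zz) _; apply: submoduleP.
  - by exists 0; rewrite act0.
  - by move=> _ _ [u ->] [w ->]; exists (u + w); rewrite actDl.
  - by move=> _ c [u ->]; exists (u ## c%:A); rewrite act_kC.
  - move=> _ [|w] [u ->]; first by exists 0; rewrite (act_xe0 zz) act0.
    by exists (u ## e w); rewrite (act_ex zz).
  - by move=> _ [u ->]; exists 0; rewrite (act_xx zz) act0.
  - by move=> _ [u ->]; exists (u ## y); rewrite (act_yx zz).
have Ly : forall w : L, w ## y = 0.
  apply: nilp (zz_yy zz) _; apply: submoduleP.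
  - by exists 0; rewrite act0.
  - by move=> _ _ [u ->] [w ->]; exists (u + w); rewrite actDl.
  - by move=> _ c [u ->]; exists (u ## c%:A); rewrite act_kC.
  - by move=> _ w [u ->]; exists (u ## e w.+1); rewrite (act_ey zz).
  - by move=> _ [u ->]; exists (u ## x); rewrite (act_yx zz).
  - by move=> _ [u ->]; exists 0; rewrite (act_yy zz) act0.
have hz := hom_e zz v z0; exists (z0 ## e v); split => // w.
have subU := line_submodule hz (Lx _) (Ly _).
case: (simL _ subU) => // [H|H]; last by have /asboolP := H w isT.
by case: z0e; apply: H; apply/asboolP; exists 1; rewrite act_k1.
Qed.

Lemma cover_genP v (P L : fdMod A) (z : L) : projective_cover P L -> genL v z ->
  exists t : P, genP v t.
Proof.
move=> [projP [f [fS sup]]] [hz z0 zL]; have [t0 ft0] := fS z.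
have ht := hom_e zz v t0; have ft : f (t0 ## e v) = z by rewrite lin_act ft0.
exists (t0 ## e v); apply: (generator_genP zz projP ht).
  by move=> t00; apply: z0; rewrite -ft t00 linear0.
move=> p; have := sup _ (cyclic_submodule (t0 ## e v)) => H.
have /asboolP // : p \in (fun m : P => `[< exists a, m = t0 ## e v ## a >]).
apply: H => q; have [c fq] := zL (f q); exists (t0 ## e v ## c%:A), (q - t0 ## e v ## c%:A).
split; first by apply/asboolP; exists c%:A.
  by rewrite linearB fq lin_act ft subrr.
by rewrite addrC subrK.
Qed.

(** The middle term of the composition series contains the radical and lies in the socle, a line
    spanned by [w]; so [M] is spanned by [w] and a lift [s] of the top. If $sx$ were zero, [s] would
    span a simple submodule and hence lie in the socle, which sits at another vertex. *)
Lemma uniserial_genS i (M L L' : fdMod A) (z : L) (z' : L') :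
  uniserial_length2 M L L' -> genL i z -> genL i.+1 z' -> exists s : M, genS i s.
Proof.
move=> [_ [F [subF F0 F2 stepF]] [f [fS fE]] [g [gI gE]]] [hz z0 zL] [hz' z0' zL'].
have [_ [u0 u0F1 u0F0] F01] := stepF 0%N isT; have [_ [u1 _ u1F1] F12] := stepF 1%N isT.
pose w := g z'; have hw : homog i.+1 w by exact: lin_hom.
have w0 : w <> 0 by move=> w0; apply: z0'; apply: gI; rewrite linear0.
have socE m : socle m -> exists c : k, m = w ## c%:A.
  by move=> /gE[l <-]; have [c ->] := zL' l; exists c; rewrite lin_act.
have F1E m : m \in F 1%N -> exists c : k, m = w ## c%:A.
  move=> mF1; apply: socE => V _ H; apply: (H (F 1%N)) => //; split => //.
    by exists u0 => // u00; rewrite F0 u00 eqxx in u0F0.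
  move=> V' subV' V'F; have V'0 : {subset F 0%N <= V'}.
    by move=> m'; rewrite F0 => /eqP ->; case: subV'.
  case: (F01 V' subV' V'0 V'F) => {}H; last by right.
  by left => m' /H; rewrite F0 => /eqP.
have radE m : f m = 0 -> exists c : k, m = w ## c%:A.
  move=> /fE H; apply: F1E; apply: H; split => //; first by exists u1.
  move=> V subV FV; have VF2 : {subset V <= F 2} by move=> m' _; exact: F2.
  case: (F12 V subV FV VF2) => H; first by left.
  by right => m'; apply: H; exact: F2.
have [s0 fs0] := fS z; pose s := s0 ## e i.
have hs : homog i s by exact: (hom_e zz).
have fs : f s = z by rewrite lin_act fs0.
have genM m : exists c d : k, m = s ## c%:A + w ## d%:A.
  have [c fm] := zL (f m); have [|d E] := radE (m - s ## c%:A).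
    by rewrite linearB fm lin_act fs subrr.
  by exists c, d; rewrite -E addrC subrK.
have sy : s ## y = 0.
  have [c [d E]] := genM (s ## y).
  case: (i) hs hw => [|l] hs' hw'; first exact: hom0_y zz _ _ hs'.
  rewrite -(hom_y zz hs') E actDl !(act_kC _ _ (e l)) (hom_ne zz hs') ?(hom_ne zz hw') ?act0 ?addr0 //; lia.
have [d sxE] : exists d : k, s ## x = w ## d%:A.
  have [c [d E]] := genM (s ## x); exists d.
  rewrite -(hom_x zz hs) E actDl !(act_kC _ _ (e i.+1)) hw (hom_ne zz hs) ?act0 ?add0r //; lia.
have s00 : s <> 0 by move=> s00; apply: z0; rewrite -fs s00 linear0.
have d0 : d != 0.
  apply/eqP => d0; have sx : s ## x = 0 by rewrite sxE d0 act_k0.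
  have [|c sE] := socE s; last first.
    by apply: s00; rewrite -hs sE act_kC (hom_ne zz hw) ?act0 //; lia.
  move=> V _ H; apply: (H (fun m : M => `[< exists c : k, m = s ## c%:A >])).
    split; first exact: line_submodule hs sx sy.
    - by exists s => //; apply/asboolP; exists 1; rewrite act_k1.
    - move=> V' [V'0 V'l] V'U.
      case: (pselect (forall m, m \in V' -> m = 0)) => [|nz]; first by left.
      right=> m /asboolP[c ->]; apply: contrapT => nV; apply: nz => m' m'V.
      have /asboolP[c' m'E] := V'U _ m'V.
      case: (eqVneq c' 0) => [c'0|c'0]; first by rewrite m'E c'0 act_k0.
      case: nV; have -> : s ## c%:A = ((c'^-1 * c)%:A : A^c) *: m' + 0.
        by rewrite addr0 -[RHS]/(m' ## _) m'E act_kM mulrA divff // mul1r.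
      exact: V'l.
  by apply/asboolP; exists 1; rewrite act_k1.
exists s; split => //.
- rewrite ltnNge; apply/negP => ni; apply: w0; exact: (hom_out zz hw ni).
- by rewrite sxE => /act_kI[] // d00; rewrite d00 eqxx in d0.
- move=> m; have [c [d' ->]] := genM m; exists c, (d^-1 * d').
  by rewrite sxE act_kM mulrA divff // mul1r.
Qed.

End Recognition.

(** * The algebra C_n *)

Section Span.
Variables (k : fieldType) (A : algType k) (f x y : A).
Hypotheses (xx0 : x * x = 0) (yy0 : y * y = 0) (xy_yx : x * y = y * x).

Definition span4 (z : A) : Prop := exists c1 c2 c3 c4 : k,
  z = c1 *: f + c2 *: (f * x) + c3 *: (f * y) + c4 *: (f * x * y).

Lemma span4_0 : span4 0.
Proof. by exists 0, 0, 0, 0; rewrite !scale0r !addr0. Qed.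
Lemma span4_D c z w : span4 z -> span4 w -> span4 (c *: z + w).
Proof.
move=> [c1 [c2 [c3 [c4 ->]]]] [d1 [d2 [d3 [d4 ->]]]].
exists (c * c1 + d1), (c * c2 + d2), (c * c3 + d3), (c * c4 + d4).
rewrite !scalerDl !scalerDr !scalerA.
set a1 := (c * c1) *: _; set a2 := (c * c2) *: _; set a3 := (c * c3) *: _.
by rewrite (addrACA (a1 + a2 + a3)) (addrACA (a1 + a2)) (addrACA a1).
Qed.
Lemma span4_idem : span4 f.
Proof. by exists 1, 0, 0, 0; rewrite !scale0r !addr0 scale1r. Qed.
Lemma span4_x z : span4 z -> span4 (z * x).
Proof.
move=> [c1 [c2 [c3 [c4 ->]]]]; exists 0, c1, 0, c3.
have fxx : f * x * x = 0 by rewrite -mulrA xx0 mulr0.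
have fyx : f * y * x = f * x * y by rewrite -mulrA -xy_yx mulrA.
have fxyx : f * x * y * x = 0 by rewrite -(mulrA _ y) -xy_yx mulrA fxx mul0r.
by rewrite !mulrDl -!scalerAl fxx fyx fxyx !(scaler0, scale0r, addr0, add0r).
Qed.
Lemma span4_y z : span4 z -> span4 (z * y).
Proof.
move=> [c1 [c2 [c3 [c4 ->]]]]; exists 0, 0, c1, c2.
rewrite !mulrDl -!scalerAl -!mulrA.
by rewrite yy0 !(mul0r, mulr0, scale0r, scaler0, addr0, add0r).
Qed.

End Span.

Section LineAlgebra.
Variables (k : fieldType) (n : nat) (n_ge2 : (1 < n)%N).
Hypothesis n_gt2 : (2 < n)%N.
Local Notation Q := (C_quiver n_ge2).
Local Notation A := (C_alg n_ge2 k).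
Local Notation vtx := ('I_n).
Local Notation arr := ('I_n.-1 * bool)%type.

Definition path_class (p : qpath Q) : A := alg_quot_pi (@C_ideal n n_ge2 k) (C_path k p).

Lemma path_classM p q : path_class p * path_class q =
  if Defs.pcomp p q is Some r then path_class r else 0.
Proof.
rewrite /path_class -rmorphM /= /C_path pbasisM.
by case: Defs.pcomp => //; rewrite raddf0.
Qed.

Lemma rel_class0 (r : path_algebra k Q) : C_rel r -> alg_quot_pi (@C_ideal n n_ge2 k) r = 0.
Proof.
move=> rr; rewrite -(raddf0 (alg_quot_pi (@C_ideal n n_ge2 k))); apply/alg_quot_eq.
by rewrite subr0; apply/gen_idealP => J _; exact.
Qed.

Definition idem (v : nat) : A := if insub v is Some w then C_idem n_ge2 k w else 0.

Lemma parrow_proof (a : arrow Q) : composable (src a) [:: a].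
Proof. by rewrite /= eqxx. Qed.
Definition parrow (a : arrow Q) : qpath Q := @QPath Q (src a, [:: a]) (parrow_proof a).

Definition arrow_class (a : arr) : A := path_class (parrow a).
Definition up_arrows : A := \sum_(i < n.-1) arrow_class (i, true).
Definition down_arrows : A := \sum_(i < n.-1) arrow_class (i, false).
Local Notation x := up_arrows.
Local Notation y := down_arrows.

Lemma idem_l v p : idem v * path_class p = if v == (psrc p : vtx) :> nat then path_class p else 0.
Proof.
rewrite /idem; case: insubP => [w _ wv|vn]; last first.
  rewrite mul0r; case: eqP => // E; case/negP: vn; rewrite E; exact: ltn_ord.
rewrite path_classM -wv; case: (pcompP (@ptriv Q w) p) => [[E [r [-> r1 _ r2]]]|[E ->]].
  have wp : w = psrc p by exact/eqP.
  by rewrite -wp eqxx; congr path_class; apply: qpath_eq; rewrite ?r1 ?r2.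
by case: eqP => // wp; case/negP: E; apply/eqP/ord_inj.
Qed.

Lemma idem_r v p : path_class p * idem v = if (ptgt p : vtx) == v :> nat then path_class p else 0.
Proof.
rewrite /idem; case: insubP => [w _ wv|vn]; last first.
  rewrite mulr0; case: eqP => // E; case/negP: vn; rewrite -E; exact: ltn_ord.
rewrite path_classM -wv; case: (pcompP p (@ptriv Q w)) => [[E [r [-> r1 _ r2]]]|[E ->]].
  have wp : ptgt p = w by exact/eqP.
  by rewrite wp eqxx; congr path_class; apply: qpath_eq; rewrite ?r1 ?r2 //= cats0.
by case: eqP => // wp; case/negP: E; apply/eqP/ord_inj.
Qed.

Lemma idem_out v : (n <= v)%N -> idem v = 0.
Proof. by move=> nv; rewrite /idem insubF // ltnNge nv. Qed.

Lemma idemE (v : vtx) : idem v = path_class (@ptriv Q v).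
Proof.
rewrite /idem; case: insubP => [w _ wv|]; last by rewrite ltn_ord.
by rewrite (_ : w = v) //; exact: ord_inj.
Qed.

Lemma idem_idem v w : idem v * idem w = if v == w then idem v else 0.
Proof.
have [wn|nw] := ltnP w n; last first.
  by rewrite (idem_out nw) mulr0; case: eqP => // ->; rewrite idem_out.
by rewrite (idemE (Ordinal wn)) idem_l /=; case: eqP => // ->; rewrite (idemE (Ordinal wn)).
Qed.

Lemma idem_sum : \sum_(v < n) idem v = 1.
Proof.
under eq_bigr => v _ do rewrite idemE.
rewrite -(raddf_sum (alg_quot_pi (@C_ideal n n_ge2 k))).
by rewrite -[RHS]/(alg_quot_pi (@C_ideal n n_ge2 k) (pone k Q)) pone.unlock.
Qed.

Lemma arrow_l v (i : 'I_n.-1) b : idem v * arrow_class (i, b) =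
  if v == (if b then i : nat else i.+1) then arrow_class (i, b) else 0.
Proof. by rewrite idem_l; case: b. Qed.
Lemma arrow_r v (i : 'I_n.-1) b : arrow_class (i, b) * idem v =
  if (if b then i.+1 else i : nat) == v then arrow_class (i, b) else 0.
Proof. by rewrite idem_r; case: b. Qed.

Lemma idem_x v : idem v * x = x * idem v.+1.
Proof.
by rewrite mulr_sumr mulr_suml; apply: eq_bigr => i _; rewrite arrow_l arrow_r /= eqSS eq_sym.
Qed.
Lemma x_idem0 : x * idem 0 = 0.
Proof. by rewrite mulr_suml big1 // => i _; rewrite arrow_r. Qed.
Lemma idem_y v : idem v.+1 * y = y * idem v.
Proof.
by rewrite mulr_sumr mulr_suml; apply: eq_bigr => i _; rewrite arrow_l arrow_r /= eqSS eq_sym.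
Qed.
Lemma idem0_y : idem 0 * y = 0.
Proof. by rewrite mulr_sumr big1 // => i _; rewrite arrow_l. Qed.

Lemma idem_xE (i : 'I_n.-1) : idem i * x = arrow_class (i, true).
Proof.
rewrite mulr_sumr (bigD1 i) //= arrow_l eqxx big1 ?addr0 // => j ji.
by rewrite arrow_l ifN // eq_sym; exact: ji.
Qed.
Lemma idem_yE (i : 'I_n.-1) : idem i.+1 * y = arrow_class (i, false).
Proof.
rewrite mulr_sumr (bigD1 i) //= arrow_l eqxx big1 ?addr0 // => j ji.
by rewrite arrow_l ifN // eqSS eq_sym; exact: ji.
Qed.
Lemma idem_x_last : idem n.-1 * x = 0.
Proof.
rewrite mulr_sumr big1 // => i _; rewrite arrow_l /=.
by have := ltn_ord i; case: eqP => // <-; rewrite ltnn.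
Qed.

Lemma ppair_proof (a b : arrow Q) : tgt a = src b -> composable (src a) [:: a; b].
Proof. by move=> ab; apply/and3P; split=> //; apply/eqP. Qed.
Definition ppair (a b : arrow Q) (ab : tgt a = src b) : qpath Q :=
  @QPath Q (src a, [:: a; b]) (ppair_proof ab).

Lemma arrow_classM (a b : arrow Q) (ab : tgt a = src b) :
  arrow_class a * arrow_class b = path_class (ppair ab).
Proof.
rewrite path_classM; case: (pcompP (parrow a) (parrow b)) => [[_ [r [-> r1 _ r2]]]|[E _]].
  by congr path_class; exact: qpath_eq.
by case/negP: E; apply/eqP.
Qed.

Lemma arrow_classM0 (a b : arrow Q) : tgt a <> src b -> arrow_class a * arrow_class b = 0.
Proof.
move=> ab; rewrite path_classM; case: (pcompP (parrow a) (parrow b)) => [[E _]|[_ ->]] //.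
by case: ab; exact/eqP.
Qed.

Lemma same_direction (i j : 'I_n.-1) b : arrow_class (i, b) * arrow_class (j, b) = 0.
Proof.
case: (pselect (@tgt Q (i, b) = @src Q (j, b))) => [E|/arrow_classM0 //].
rewrite (arrow_classM E); apply: rel_class0; apply: C_rel_noncycle => //.
rewrite /psrc /ptgt /= => E'; have := congr1 val E; have := congr1 val E'.
by case: b {E E'} => /=; lia.
Qed.

Lemma xx0 : x * x = 0.
Proof.
rewrite mulr_suml big1 // => i _; rewrite mulr_sumr big1 // => j _.
exact: same_direction.
Qed.
Lemma yy0 : y * y = 0.
Proof.
rewrite mulr_suml big1 // => i _; rewrite mulr_sumr big1 // => j _.
exact: same_direction.
Qed.

Lemma updown_proof (i : 'I_n.-1) b : @tgt Q (i, b) = @src Q (i, ~~ b).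
Proof. by case: b. Qed.
Definition updown (i : 'I_n.-1) b : qpath Q := ppair (updown_proof i b).

Lemma idem_xyE (i : 'I_n.-1) : idem i * x * y = path_class (updown i true).
Proof.
rewrite idem_xE mulr_sumr (bigD1 i) //= big1 ?addr0 => [|j ji].
  exact: arrow_classM.
apply: arrow_classM0 => /= /(congr1 val) /= [ij]; case/negP: ji; apply/eqP.
by apply: ord_inj.
Qed.
Lemma idem_yxE (i : 'I_n.-1) : idem i.+1 * y * x = path_class (updown i false).
Proof.
rewrite idem_yE mulr_sumr (bigD1 i) //= big1 ?addr0 => [|j ji].
  exact: arrow_classM.
apply: arrow_classM0 => /= /(congr1 val) /= ij; case/negP: ji; apply/eqP.
by apply: ord_inj.
Qed.

(** At an inner vertex both products are cycles of length two, identified by the relations. At an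
    end vertex one product contains no path and the other is the cycle that is set to zero. *)
Lemma xy_yx : x * y = y * x.
Proof.
have sumE (a : A) : a = \sum_(v < n) idem v * a by rewrite -mulr_suml idem_sum mul1r.
rewrite [LHS]sumE [RHS]sumE; apply: eq_bigr => v _; rewrite !mulrA.
case: v => v vn /=; have [v0|v0] := posnP v.
  rewrite v0 idem0_y mul0r; have n0 : (0 < n.-1)%N by lia.
  by rewrite (idem_xyE (Ordinal n0)); apply: rel_class0; exact: C_rel_first.
case: v vn v0 => // v vn _; have vn1 : (v < n.-1)%N by lia.
have [E|E] := eqVneq v.+1 n.-1.
  rewrite {1}E idem_x_last mul0r (idem_yxE (Ordinal vn1)); symmetry.
  by apply: rel_class0; exact: C_rel_last.
have vn2 : (v.+1 < n.-1)%N by lia.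
rewrite (idem_xyE (Ordinal vn2)) (idem_yxE (Ordinal vn1)); apply/eqP; rewrite -subr_eq0.
rewrite -raddfB; apply/eqP; apply: rel_class0.
by apply: C_rel_cycles => //; apply: ord_inj.
Qed.

(** Induction from the right end of the path: the class of a path absorbs the idempotent at its
    target, so appending an arrow amounts to multiplying by $x$ or $y$. *)
Lemma span4_path (p : qpath Q) : span4 (idem (psrc p : vtx)) x y (path_class p).
Proof.
suff H (v : vtx) s : forall h : @composable Q v s,
    span4 (idem v) x y (path_class (@QPath Q (v, s) h)).
  by case: p => -[v s] h; exact: H.
elim/last_ind: s => [|s a IH] h.
  rewrite (_ : path_class _ = idem v); first exact: span4_idem.
  by rewrite idemE; congr path_class; exact: qpath_eq.
have h' : @composable Q v (s ++ [:: a]) by rewrite cats1.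
move: h'; rewrite composable_cat [composable _ [:: a]]andbT => /andP[hs /eqP ha].
pose p' := @QPath Q (v, s) hs.
have -> : path_class (@QPath Q (v, rcons s a) h) = path_class p' * arrow_class a.
  rewrite path_classM; case: (pcompP p' (parrow a)) => [[_ [r [-> r1 _ r2]]]|[E _]].
    by congr path_class; apply: qpath_eq; rewrite ?r1 ?r2 // /parrows /= cats1.
  by case/negP: E; apply/eqP; exact: esym ha.
have e' : path_class p' * idem (src a : vtx) = path_class p'.
  by rewrite idem_r ifT //; apply/eqP; congr nat_of_ord; exact: esym ha.
have {}IH := IH hs.
case: a h ha e' => i [] h ha e'.
  by rewrite -idem_xE mulrA e'; apply: span4_x IH; [exact: xx0 | exact: xy_yx].
by rewrite -idem_yE mulrA e'; apply: span4_y IH; exact: yy0.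
Qed.

Lemma span4_all v (a : A) : span4 (idem v) x y (idem v * a).
Proof.
have piZ (c : k) (g : path_algebra k Q) : alg_quot_pi (@C_ideal n n_ge2 k) (c *: g) =
    c *: alg_quot_pi (@C_ideal n n_ge2 k) g by exact: linearZ.
have sumP (c : qpath Q -> k) (r : seq (qpath Q)) : span4 (idem v) x y
    (idem v * alg_quot_pi (@C_ideal n n_ge2 k) (\sum_(p <- r) c p *: C_path k p)).
  elim: r => [|p r IH]; first by rewrite big_nil raddf0 mulr0; exact: span4_0.
  rewrite big_cons raddfD /= piZ mulrDr -scalerAr; apply: span4_D => //.
  rewrite -[alg_quot_pi _ _]/(path_class p) idem_l; case: eqP => [->|_].
    exact: span4_path.
  exact: span4_0.
rewrite -[a]alg_quot_piP; have := sumP (fun p => (repr a)@_p) (msupp (repr a)).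
by rewrite -[X in alg_quot_pi _ X](pbasisE (repr a)).
Qed.

(** * Nonvanishing of the cycles at inner vertices *)

Section Nonvanishing.
Variables (r1 r2 : qpath Q).
Hypotheses (len1 : plength r1 = 2%N) (len2 : plength r2 = 2%N).

(** Adding the coefficients of the two cycles at an inner vertex gives a functional that vanishes on
    their difference. *)
Definition cycle_coeff (f : path_algebra k Q) : k := f@_r1 + f@_r2.

Lemma cycle_coeffP c f g : cycle_coeff (c *: f + g) = c * cycle_coeff f + cycle_coeff g.
Proof.
have cD r : (c *: f + g : {malg k[qpath Q]})@_r = c * f@_r + g@_r.
  by rewrite [LHS]mcoeffD [X in X + _]mcoeffZ.
by rewrite /cycle_coeff !cD mulrDr addrACA.
Qed.

Lemma cycle_coeff0 : cycle_coeff 0 = 0.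
Proof. by have := cycle_coeffP (-1) 0 0; rewrite scaler0 addr0 mulN1r addNr. Qed.

Lemma cycle_coeff_path p : cycle_coeff (C_path k p) = (p == r1)%:R + (p == r2)%:R.
Proof. by rewrite /cycle_coeff !pbasis_coeff. Qed.

Lemma cycle_coeff_long p : (2 < plength p)%N -> cycle_coeff (C_path k p) = 0.
Proof.
move=> lp; rewrite cycle_coeff_path !(introF eqP) ?addr0 // => E.
  by rewrite E len2 in lp.
by rewrite E len1 in lp.
Qed.

(** Paths longer than two have no coefficient at [r1] or [r2], so only trivial paths may surround
    [s]. *)
Lemma cycle_coeff_mul (s p q : qpath Q) : (1 < plength s)%N ->
  cycle_coeff (C_path k p * C_path k s * C_path k q) =
  if (p == ptriv (psrc s)) && (q == ptriv (ptgt s)) then cycle_coeff (C_path k s) else 0.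
Proof.
move=> ls; rewrite /C_path pbasisM.
case: (pcompP p s) => [[ps [r [-> rs rt ra]]]|[ps ->]]; last first.
  rewrite mul0r cycle_coeff0; case: eqP => //= pE; by rewrite pE eqxx in ps.
rewrite pbasisM; case: (pcompP r q) => [[rq [w [-> ws wt wa]]]|[rq ->]]; last first.
  rewrite cycle_coeff0; case: (q =P _) => [qE|]; rewrite ?andbF //.
  by rewrite rt qE eqxx in rq.
case: ifP => [/andP[/eqP pE /eqP qE]|pq].
  congr (cycle_coeff (pbasis k _)); apply: qpath_eq; first by rewrite ws rs pE.
  by rewrite wa ra pE qE /= cats0.
rewrite -[pbasis k w]/(C_path k w); apply: cycle_coeff_long.
rewrite /plength wa ra !size_cat -/(plength p) -/(plength s) -/(plength q).
case: (posnP (plength p)) => [lp|]; last by lia.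
case: (posnP (plength q)) => [lq|]; last by lia.
case/negP: pq; rewrite /plength in lp lq.
have p0 := size0nil lp; have q0 := size0nil lq.
apply/andP; split; apply/eqP; apply: qpath_eq => //=.
  by rewrite -(eqP ps) /ptgt p0.
by rewrite -(eqP rq) rt.
Qed.

Lemma cycle_coeff_bilinear (z : path_algebra k Q) :
  (forall p q, cycle_coeff (C_path k p * z * C_path k q) = 0) ->
  forall g h, cycle_coeff (g * z * h) = 0.
Proof.
move=> H g h.
apply: (@plin_ext k Q k^o (fun g => cycle_coeff ((g : path_algebra k Q) * z * h)) (fun=> 0)).
- by move=> c u w; rewrite !mulrDl -!scalerAl cycle_coeffP.
- by move=> c u w; rewrite scaler0 addr0.
move=> p; apply: (@plin_ext k Q k^o
  (fun h => cycle_coeff ((pbasis k p : path_algebra k Q) * z * (h : path_algebra k Q))) (fun=> 0)).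
- by move=> c u w; rewrite !mulrDr -!scalerAr cycle_coeffP.
- by move=> c u w; rewrite scaler0 addr0.
exact: H.
Qed.

Hypotheses (cyc1 : psrc r1 = ptgt r1) (cyc2 : psrc r2 = ptgt r2) (src12 : psrc r1 = psrc r2).
Hypothesis inner1 : (0 < (psrc r1 : vtx))%N && ((psrc r1 : vtx) < n.-1)%N.
Hypothesis only12 : forall p : qpath Q, plength p = 2%N -> psrc p = ptgt p ->
  psrc p = psrc r1 -> p = r1 \/ p = r2.
Hypothesis ne12 : r1 != r2.

(** The elements $f$ for which [cycle_coeff] vanishes on all products $g f h$ form an ideal; it
    contains the relations but not [r1]. *)
Lemma cycle_class_neq0 : path_class r1 <> 0.
Proof.
move=> E; have : C_path k r1 \in @C_ideal n n_ge2 k.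
  rewrite -[C_path k r1]subr0; apply/alg_quot_eq; rewrite raddf0; exact: E.
move=> /gen_idealP /(_ (fun f => forall g h, cycle_coeff (g * f * h) = 0)) H.
suff : cycle_coeff (1 * C_path k r1 * 1) = 0.
  rewrite mul1r mulr1 cycle_coeff_path eqxx (negbTE ne12) addr0 => /eqP.
  by rewrite oner_eq0.
have path0 (s : qpath Q) : (1 < plength s)%N -> cycle_coeff (C_path k s) = 0 ->
    forall g h, cycle_coeff (g * C_path k s * h) = 0.
  move=> ls s0; apply: cycle_coeff_bilinear => p q; rewrite cycle_coeff_mul // s0.
  by case: ifP.
have notr (s : qpath Q) : psrc s <> psrc r1 \/ psrc s <> ptgt s -> cycle_coeff (C_path k s) = 0.
  move=> hs; rewrite cycle_coeff_path !(introF eqP) ?addr0 // => sE.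
    by case: hs => hs; apply: hs; rewrite sE.
  by case: hs => hs; apply: hs; rewrite sE.
apply: H; first split.
- by move=> g h; rewrite mulr0 mul0r cycle_coeff0.
- move=> u w hu hw g h; rewrite mulrBr mulrBl -[X in _ - X]scale1r -scaleNr addrC.
  by rewrite cycle_coeffP hu hw mulr0 addr0.
- move=> a u hu; split=> g h; first by rewrite mulrA hu.
  by rewrite mulrA -mulrA hu.
move=> _ [s ls|s ls ns|s t ls lt cs ct st|s ls cs v0|s ls cs v0].
- by apply: path0; [rewrite ls | apply: cycle_coeff_long; rewrite ls].
- by apply: path0; [rewrite ls | apply: notr; right].
- apply: cycle_coeff_bilinear => p q.
  rewrite mulrBr mulrBl -[X in _ - X]scale1r -scaleNr addrC cycle_coeffP mulN1r.
  rewrite !cycle_coeff_mul ?ls ?lt // -cs -ct -st.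
  suff -> : cycle_coeff (C_path k s) = cycle_coeff (C_path k t) by rewrite addNr.
  case: (pselect (psrc s = psrc r1)) => sr; last first.
    by rewrite !notr //; left; rewrite -?st.
  have val12 u : u = r1 \/ u = r2 -> cycle_coeff (C_path k u) = 1.
    by case=> ->; rewrite cycle_coeff_path eqxx ?[r2 == r1]eq_sym (negbTE ne12) ?addr0 ?add0r.
  by rewrite !val12 //; apply: only12; rewrite // -st.
- apply: path0; first by rewrite ls.
  apply: notr; left => sr; move: inner1; rewrite -sr v0 => /andP[_]; by rewrite ltnn.
- apply: path0; first by rewrite ls.
  by apply: notr; left => sr; move: inner1; rewrite -sr v0.
Qed.

End Nonvanishing.

Lemma idem_xy_neq0 v : (0 < v)%N -> (v.+1 < n)%N -> idem v * x * y <> 0.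
Proof.
move=> v0 vn; case: v v0 vn => // v _ vn.
have lo : (v < n.-1)%N by lia.
have hi : (v.+1 < n.-1)%N by lia.
rewrite (idem_xyE (Ordinal hi)).
apply: (@cycle_class_neq0 (updown (Ordinal hi) true) (updown (Ordinal lo) false)) => //.
- by apply: ord_inj.
(* Two arrows in the same direction do not close up, so a cycle of length two either goes up and
   back or down and back. *)
- case=> -[u [|a [|b [|c s]]]] h // _ cyc su; move: h cyc su.
  rewrite /psrc /ptgt /= => h cyc su; have := h.
  rewrite /= andbT => /andP[/eqP sa /eqP sb].
  case: a h cyc sa sb => i ba; case: b => j bb h cyc sa sb.
  move: (congr1 val sa) (congr1 val sb) (congr1 val cyc) (congr1 val su) => /=.
  case: ba h cyc sa sb; case: bb => /= h cyc sa sb e1 e2 e3 e4; try lia.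
  + left; apply: qpath_eq => //=; rewrite /parrows /=.
    by congr [:: (_, _); (_, _)]; apply: ord_inj => /=; lia.
  + right; apply: qpath_eq; first exact: ord_inj.
    by rewrite /parrows /=; congr [:: (_, _); (_, _)]; apply: ord_inj => /=; lia.
- by apply/eqP => /(congr1 (@parrows Q)).
Qed.

Lemma line_zigzag : zigzag n idem x y.
Proof.
split.
- exact: n_gt2.
- exact: idem_idem.
- exact: idem_out.
- exact: idem_sum.
- exact: idem_x.
- exact: x_idem0.
- exact: idem_y.
- exact: idem0_y.
- exact: xx0.
- exact: yy0.
- exact: xy_yx.
- by move=> a v; exact: span4_all.
- exact: idem_xy_neq0.
Qed.

End LineAlgebra.

Theorem theorem4 (k : closedFieldType) (n : nat) (n_gt2 : (2 < n)%N)
    (L P : 'I_n -> fdMod (C_alg (ltnW n_gt2) k))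
    (S N : 'I_n.-1 -> fdMod (C_alg (ltnW n_gt2) k))
    (L_simple : forall v, simple_at v (L v))
    (P_indec : forall v, indecomposable (P v))
    (P_cover : forall v, projective_cover (P v) (L v))
    (S_uniserial : forall i,
       uniserial_length2 (S i) (L (edge_lo i)) (L (edge_hi i)))
    (N_uniserial : forall i,
       uniserial_length2 (N i) (L (edge_hi i)) (L (edge_lo i)))
    (T : fdMod (C_alg (ltnW n_gt2) k)) :
  (basic T /\ generalized_tilting T) <->
  exists i j : 'I_n.-1,
    iso T (dsum ([seq P v | v : 'I_n <- enum 'I_n & (0 < v < n.-1)%N] ++ [:: S i; N j])).
Proof.
have zz := line_zigzag k (ltnW n_gt2) n_gt2.
have zz' := zigzag_rev zz.
set e := idem k (ltnW n_gt2) in zz zz'; set x := up_arrows k _ in zz zz'.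
set y := down_arrows k _ in zz zz'.
have gL (v : 'I_n) : exists z : L v, genL e v z.
  have [simL [z ez]] := L_simple v; apply: (simple_genL zz simL).
  by exists z; rewrite /e idemE.
have gL' (v : 'I_n) : exists z : L v, genL (rev_idem n e) (n.-1 - v)%N z.
  have [z [hz z0 zL]] := gL v; exists z; split => //.
  have vn := ltn_ord v; rewrite /homog /rev_idem ifT; last by lia.
  by rewrite subKn //; lia.
have gP (v : 'I_n) : exists t : P v, genP e v t.
  by have [z gz] := gL v; exact: (cover_genP zz (P_cover v) gz).
have gS (i : 'I_n.-1) : exists s : S i, genS n e x y i s.
  have [z gz] := gL (edge_lo i); have [z' gz'] := gL (edge_hi i).
  exact: (uniserial_genS zz (S_uniserial i) gz gz').
(* On the reversed line [edge_hi i] has number $n - 2 - i$ and [edge_lo i] the next one, so N is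
   recognised there as a module of type S. *)
have gN (i : 'I_n.-1) : exists s : N i, genS n (rev_idem n e) y x (n.-2 - i)%N s.
  have [z gz] := gL' (edge_hi i); have [z' gz'] := gL' (edge_lo i).
  have lt := ltn_ord i.
  rewrite (_ : n.-1 - edge_hi i = n.-2 - i)%N in gz; last by rewrite /=; lia.
  rewrite (_ : n.-1 - edge_lo i = (n.-2 - i).+1)%N in gz'; last by rewrite /=; lia.
  exact: (uniserial_genS zz' (N_uniserial i) gz gz').
split=> [[bT gT]|[i [j]]].
  have [i [j isoT]] := tilting_classification zz gP gS gN P_indec bT gT.
  by exists i, j; rewrite (summand_inner P S N i j).
rewrite (summand_inner P S N i j) => isoT; split.
  exact: (basic_dsum zz gP gS gN P_indec isoT).
exact: (tilting_dsum zz gP gS gN isoT).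
Qed.
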